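(* Let $d\in\mathbb{N}$, let the parameters satisfy the conditions in the context, and assume in addition that $2(b_j+\beta_j)>\beta_jd$ for $j=1,\dots,m$. Then the $d$-dimensional generalized Wright measure $\mu_\Psi^d$ is absolutely continuous with respect to the $d$-dimensional Lebesgue measure, and its Radon–Nikodym density is given for every $x\in\mathbb{R}^d$ by $$\varrho_H^d(x)=\frac{1}{(2\pi)^{d/2}K}\;G_d\!\left(\frac{(x,x)}{2}\right),$$ where $G_d$ is the Fox-$H$ function $H^{m+1,0}_{p,m+1}$ with upper parameters $(a_i+\alpha_i(1-d/2),\alpha_i)_{i=1,\dots,p}$ and lower parameters $(0,1),(b_j+\beta_j(1-d/2),\beta_j)_{j=1,\dots,m}$, i.e. $$G_d(z)=\frac{1}{2\pi\mathrm{i}}\int_{\gamma-\mathrm{i}\infty}^{\gamma+\mathrm{i}\infty}\Gamma(s)\,\frac{\prod_{j=1}^m\Gamma(b_j+\beta_j(1-d/2)+\beta_js)}{\prod_{i=1}^p\Gamma(a_i+\alpha_i(1-d/2)+\alpha_is)}\,z^{-s}\,\mathrm{d}s,\qquad z>0,\ \gamma\in(0,1).$$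
   Context: Parameters. $m,p\in\mathbb{N}_0=\{0,1,2,\dots\}$; $a_i\in\mathbb{R}$, $\alpha_i>0$, $a_i+\alpha_i>0$ for $i=1,\dots,p$; $b_j\in\mathbb{R}$, $\beta_j>0$, $b_j+\beta_j>0$ for $j=1,\dots,m$. Put $a^*:=\sum_{j=1}^m\beta_j-\sum_{i=1}^p\alpha_i$ and $\mu:=\sum_{j=1}^m b_j-\sum_{i=1}^p a_i+(p-m)/2$. It is assumed that either $a^*>0$, or $a^*=0$ and $\mu<-1$, and that the Fox-$H$ function $$H^{m,0}_{p,m}(\tau):=\frac{1}{2\pi\mathrm{i}}\int_{\gamma-\mathrm{i}\infty}^{\gamma+\mathrm{i}\infty}\frac{\prod_{j=1}^m\Gamma(b_j+\beta_js)}{\prod_{i=1}^p\Gamma(a_i+\alpha_is)}\,\tau^{-s}\,\mathrm{d}s,\qquad \tau>0,$$ is non-negative on $(0,\infty)$; here $\gamma\in(0,1)$ is such that all poles of the numerator lie to the left of the contour. Put $K:=\prod_{j=1}^m\Gamma(b_j+\beta_j)\big/\prod_{i=1}^p\Gamma(a_i+\alpha_i)$. Generalized Wright function. $\Psi$ is formally the power series $\Psi(z)=\sum_{k\ge0}\frac{\prod_{j=1}^m\Gamma(b_j+\beta_j(k+1))}{\prod_{i=1}^p\Gamma(a_i+\alpha_i(k+1))}\frac{z^k}{k!}$ (which is entire if $a^*<1$); in general, for $z>0$, $\Psi(-z)$ is understood through its Fox-$H$ representation $\Psi(-z)=\frac{1}{2\pi\mathrm{i}}\int_{\gamma-\mathrm{i}\infty}^{\gamma+\mathrm{i}\infty}\Gamma(s)\frac{\prod_{j=1}^m\Gamma(b_j+\beta_j-\beta_js)}{\prod_{i=1}^p\Gamma(a_i+\alpha_i-\alpha_is)}z^{-s}\,\mathrm{d}s$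 with $0<\gamma<\min\{1,\min_j(b_j+\beta_j)/\beta_j\}$, and $\Psi(0)=K$. (These agree when $a^*<1$.) The measure $\mu_\Psi^d$ is the unique probability measure on $\mathbb{R}^d$ with $\int_{\mathbb{R}^d}\mathrm{e}^{\mathrm{i}(y,x)}\,\mathrm{d}\mu_\Psi^d(x)=\frac1K\Psi\big(-\tfrac{(y,y)}{2}\big)$, $y\in\mathbb{R}^d$, where $(\cdot,\cdot)$ is the Euclidean inner product. The value of a Fox-$H$ function at $z=0$ is understood as its limit as $z\to0^+$. *)

(* Defs.v *)
From HB Require Import structures.
From mathcomp Require Import all_boot all_order all_algebra.
From mathcomp Require Import all_classical all_reals all_analysis.
From mathcomp Require Import complex.
Set Implicit Arguments.
Unset Strict Implicit.
Unset Printing Implicit Defensive.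
Import Order.TTheory GRing.Theory Num.Theory.
Import numFieldNormedType.Exports.
Local Open Scope classical_set_scope.
Local Open Scope ring_scope.
Local Open Scope complex_scope.

Local Notation Re := complex.Re.
Local Notation Im := complex.Im.

(* The measurable structure of the library on tuples is the product
   sigma-algebra, here the Borel sigma-algebra of R^n. *)
Notation Rn R n := (n.-tuple (measurableTypeR R)).

Section lebesgue_Rn.
Context (R : realType).
Local Open Scope ereal_scope.

Definition consRn n (x : measurableTypeR R * Rn R n) : Rn R n.+1 :=
  [tuple of x.1 :: x.2].

Lemma measurable_consRn n : measurable_fun setT (@consRn n).
Proof. exact: measurable_cons. Qed.

Section successor.
Variables (n : nat) (nu : {sigma_finite_measure set (Rn R n) -> \bar R}).

Definition lebesgue_RnS : set (Rn R n.+1) -> \bar R :=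
  pushforward (@lebesgue_measure R \x nu) (@consRn n).

HB.instance Definition _ := Measure.copy lebesgue_RnS
  (measure_function_pushforward__canonical__measure_function_Measure
    (@lebesgue_measure R \x nu) (@measurable_consRn n)).

Let sigma_finite_lebesgue_RnS : sigma_finite setT lebesgue_RnS.
Proof.
have /sigma_finiteP[F [TF ndF Foo]] := sigma_finiteT (@lebesgue_measure R).
have /sigma_finiteP[G [TG ndG Goo]] := sigma_finiteT nu.
pose u (x : Rn R n.+1) : measurableTypeR R * Rn R n :=
  (thead x, [tuple of behead x]).
have mu : measurable_fun setT u.
  apply/measurable_fun_pair => /=; first exact: measurable_tnth.
  exact: measurable_behead.
have uK x : u (consRn x) = x by case: x => x y; congr pair; apply/val_inj.
exists (fun k => u @^-1` (F k `*` G k)).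
  rewrite -preimage_bigcup; apply/esym; rewrite -subTset => x _.
  have [[i _ Fi] [j _ Gj]] : (\bigcup_i F i) (u x).1 /\ (\bigcup_i G i) (u x).2.
    by rewrite -TF -TG.
  exists (maxn i j) => //; split.
  - by move: Fi; exact/subsetPset/ndF/leq_maxl.
  - by move: Gj; exact/subsetPset/ndG/leq_maxr.
move=> k; have [mF Fk] := Foo k; have [mG Gk] := Goo k; split.
  by rewrite -[X in measurable X]setTI; apply: mu => //; exact: measurableX.
rewrite /lebesgue_RnS /pushforward (_ : _ @^-1` _ = F k `*` G k).
  by rewrite product_measure1E// lte_mul_pinfty// ge0_fin_numE.
by apply/funext => x; rewrite /preimage /mkset uK; case: x.
Qed.

HB.instance Definition _ := Measure_isSigmaFinite.Build _ _ _ lebesgue_RnS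
  sigma_finite_lebesgue_RnS.

End successor.

Fixpoint lebesgue_Rn n : {sigma_finite_measure set (Rn R n) -> \bar R} :=
  match n return {sigma_finite_measure set (Rn R n) -> \bar R} with
  | 0 => \d_ [tuple of [::]]
  | n'.+1 => lebesgue_RnS (lebesgue_Rn n')
  end.

Lemma lebesgue_Rn_box n (A : 'I_n -> set (measurableTypeR R)) :
  (forall i, measurable (A i)) ->
  lebesgue_Rn n [set x | forall i, A i (tnth x i)] =
    \prod_(i < n) lebesgue_measure (A i).
Proof.
elim: n A => [|n IH] A mA.
  by rewrite big_ord0 /= diracE mem_set// => -[].
rewrite big_ord_recl -IH//= /lebesgue_RnS /pushforward.
rewrite -product_measure1E//.
  congr (_ _); apply/seteqP; split => -[x y] /=.
    move=> H; split; first exact: (H ord0).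
    by move=> i; have := H (lift ord0 i); rewrite tnthS.
  move=> -[Ax Ay] i; case: (unliftP ord0 i) => [j|] ->//.
  by rewrite tnthS; exact: Ay.
have -> : [set x : Rn R n | forall i, A (lift ord0 i) (tnth x i)] =
  \bigcap_(i in [set: 'I_n]) ((fun x : Rn R n => tnth x i) @^-1` A (lift ord0 i)).
  by apply/seteqP; split => x /= H i; [move=> _|]; exact: H.
apply: fin_bigcap_measurable => [|i _]; first exact: finite_finset.
by rewrite -[X in measurable X]setTI; exact: measurable_tnth.
Qed.

End lebesgue_Rn.

Section complex_analysis.
Context (R : realType).
Implicit Types (s z : R[i]) (t g : R).

Definition cexp z : R[i] := (expR (Re z))%:C * (cos (Im z) +i* sin (Im z)).

(* t ^ s for t > 0 *)
Definition cpow t s : R[i] := cexp (s * (ln t)%:C).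

Definition cintegral d (T : measurableType d) (mu : {measure set T -> \bar R})
    (D : set T) (f : T -> R[i]) : R[i] :=
  (\int[mu]_(x in D) Re (f x)) +i* (\int[mu]_(x in D) Im (f x)).

Definition Euler_integral z : R[i] :=
  cintegral (@lebesgue_measure R) `]0%R, +oo[
    (fun t => cpow t (z - 1) * (expR (- t))%:C).

(* Euler's integral for Re z > 0, continued to the left by the functional
   equation Gamma z = Gamma (z + n) / (z (z + 1) ... (z + n - 1)). As 0^-1 = 0
   in a field, Gamma takes the junk value 0 at its poles 0, -1, -2, ..., so that
   (Gamma z)^-1 is everywhere the entire function 1 / Gamma. *)
Definition Gamma z : R[i] :=
  let n := if 0 < Re z then 0%N else (Num.truncn (- Re z)).+1 in
  Euler_integral (z + n%:R) / \prod_(k < n) (z + k%:R).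

(* The integral of f over the line Re s = g, upwards: s = g + i t, ds = i dt. *)
Definition vertical_integral g (f : R[i] -> R[i]) : R[i] :=
  'i * cintegral (@lebesgue_measure R) setT (fun t => f (g +i* t)).

Definition inverse_mellin g (F : R[i] -> R[i]) t : R[i] :=
  (2 * pi%:C * 'i)^-1 * vertical_integral g (fun s => F s * cpow t (- s)).

End complex_analysis.

Section fox_wright.
Context (R : realType).
Implicit Types (up lo : seq (R * R)) (g t : R).

Definition params n (c gam : 'I_n -> R) : seq (R * R) :=
  [seq (c i, gam i) | i <- enum 'I_n].

(* H^{q,0}_{p,q} with upper parameters up (of length p), lower parameters lo
   (of length q) and the contour Re s = g, at t > 0. *)
Definition foxH g up lo t : R[i] :=
  inverse_mellin g (fun s =>
    (\prod_(l <- lo) Gamma (l.1%:C + l.2%:C * s)) /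
    (\prod_(u <- up) Gamma (u.1%:C + u.2%:C * s))) t.

(* The poles of s |-> Gamma (l.1 + l.2 s) are the points - (l.1 + k) / l.2. *)
Definition poles_left g lo :=
  forall l (k : nat), l \in lo -> - (l.1 + k%:R) / l.2 < g.

(* w is the value at t >= 0 of a function h known on ]0, +oo[, its value at 0
   being understood as its limit at 0+ (taken in R^2). *)
Definition is_value0 (h : R -> R[i]) t (w : R[i]) :=
  if t == 0 then
    (Re (h x) @[x --> 0^'+] --> Re w) /\ (Im (h x) @[x --> 0^'+] --> Im w)
  else w = h t.

Section wright.
Variables (p m : nat) (a alpha : 'I_p -> R) (b beta : 'I_m -> R).

Definition astar : R := \sum_j beta j - \sum_i alpha i.

Definition mu_param : R := \sum_j b j - \sum_i a i + (p%:R - m%:R) / 2.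

Definition wright_const : R[i] :=
  (\prod_j Gamma (b j + beta j)%:C) / (\prod_i Gamma (a i + alpha i)%:C).

(* Psi (- t) for t >= 0 *)
Definition wright_neg g t : R[i] :=
  if t == 0 then wright_const else
  inverse_mellin g (fun s =>
    Gamma s * (\prod_j Gamma ((b j + beta j)%:C - (beta j)%:C * s)) /
    (\prod_i Gamma ((a i + alpha i)%:C - (alpha i)%:C * s))) t.

Definition foxG d g t : R[i] :=
  foxH g (params (fun i => a i + alpha i * (1 - d%:R / 2)) alpha)
    ((0, 1) :: params (fun j => b j + beta j * (1 - d%:R / 2)) beta) t.

Definition dotRn d (x y : Rn R d) : R := \sum_i tnth x i * tnth y i.

Definition is_wright_measure d g (mu : probability (Rn R d) R) :=
  forall y : Rn R d,
    cintegral mu setT (fun x => cexp ('i * (dotRn y x)%:C)) =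
    wright_const^-1 * wright_neg g (dotRn y y / 2).

End wright.
End fox_wright.

Definition is_density d (T : measurableType d) (R : realType)
    (la nu : {measure set T -> \bar R}) (rho : T -> R) :=
  la.-integrable setT (EFin \o rho) /\
  forall A, measurable A -> nu A = (\int[la]_(x in A) (rho x)%:E)%E.

(* Main.v *)
Require Import Defs.
From mathcomp Require Import all_boot all_order all_algebra.
From mathcomp Require Import all_classical all_reals all_analysis.
From mathcomp Require Import measurable_realfun complex ring lra.

(** Work in the variable [u = ln t]. If [M s] denotes the quotient of Gamma
    products that defines the Fox function H and [h u = H (exp u)], then H is the
    inverse Mellin transform of M, so that [h u] is a Fourier integral of M along
    any vertical line to the right of the poles. By assumption [h >= 0].

    Fubini's theorem and Euler's integral give the two identities, for [z > 0],
<<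
      Psi (- z) = \int exp (u - z exp u) h u du,
      G_d z     = \int exp ((1 - d / 2) u - z exp (- u)) h u du.
>>
    By the second one the claimed density is, up to a constant,
    [\int t ^ (1 - d / 2) exp (- |x| ^ 2 / (2 t)) H t dt / t], a mixture of centred
    Gaussian densities of variance [t] with the mixing density H. Its Fourier
    transform is the corresponding mixture of [exp (- t |y| ^ 2 / 2)], which is
    [Psi (- |y| ^ 2 / 2)] by the first identity. The constant K is the mass of the
    mixing density because a characteristic function is continuous at the origin.
    Hence the Wright measure and the mixture have the same Fourier transform, and
    they coincide ([fourier_unique], [mixture_density]). The assumption
    [beta_j d < 2 (b_j + beta_j)] says that [1 - d / 2] lies to the right of the
    poles, which makes [t ^ (1 - d / 2) H t dt / t] integrable; dominated
    convergence then gives the value of the density at the origin.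

    What remains is the analysis of M. That H does not depend on the contour
    and decays as needed ([fox_log_shift], [fox_log_bound]) follows from a form of
    Cauchy's theorem on a strip ([contour_shift]) and from the bound
    [|M s| <= C |Im s| ^ (- q)] with [q > 1] on vertical strips
    ([fox_kernel_decay]); there the alternative on a* and mu enters. Both rest on
    Gauss's product for [1 / Gamma] ([gauss_inv_cvg]): it provides the holomorphic
    approximations of M on which Cauchy's theorem is used, and the modulus of
    Gamma is estimated by comparing the logarithm of the product with an integral
    through the trapezoidal rule ([stirling]).

    For the uniqueness of the Fourier transform, call a bounded function a
    multiplier if multiplying two measures by it preserves the equality of their
    Fourier transforms. The multipliers form an algebra which is closed under
    bounded pointwise limits and contains the functions
    [x |-> cos ((y, x) + c)]. Polynomial iterates turn these into signs, hence into
    indicators of half-spaces, and so into indicators of all Borel sets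
    ([measurable_multiplier]). *)

Import Order.TTheory GRing.Theory Num.Theory.
Import numFieldNormedType.Exports.
Local Open Scope classical_set_scope.
Local Open Scope ring_scope.
Local Open Scope complex_scope.
Set Implicit Arguments.
Unset Strict Implicit.
Unset Printing Implicit Defensive.
Local Notation Re := complex.Re.
Local Notation Im := complex.Im.
Local Notation normc := ComplexField.Normc.normc.
Local Notation normcM := ComplexField.Normc.normcM.
Local Notation normcV := ComplexField.Normc.normcV.

(** * Complex numbers by components *)

Lemma normr_itv {R : realDomainType} (a b x : R) : a <= x <= b -> `|x| <= `|a| + `|b|.
Proof.
move=> /andP[ax xb]; rewrite ler_norml lerNl -normrN; apply/andP; split.
  by rewrite -[leLHS]addr0 lerD// (le_trans _ (ler_norm _))// lerN2.
by rewrite (le_trans xb)// (le_trans (ler_norm b))// lerDr.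
Qed.

Section complex_basics.
Context {R : realType}.
Implicit Types z w : R[i].

Lemma ReM z w : Re (z * w) = Re z * Re w - Im z * Im w.
Proof. by case: z => a b; case: w. Qed.

Lemma ImM z w : Im (z * w) = Re z * Im w + Im z * Re w.
Proof. by case: z => a b; case: w. Qed.

Lemma ReD z w : Re (z + w) = Re z + Re w.
Proof. by case: z => a b; case: w. Qed.

Lemma ImD z w : Im (z + w) = Im z + Im w.
Proof. by case: z => a b; case: w. Qed.

Lemma ReN z : Re (- z) = - Re z. Proof. by case: z. Qed.
Lemma ImN z : Im (- z) = - Im z. Proof. by case: z. Qed.

Lemma ReV z : Re z^-1 = Re z * (Re z ^+ 2 + Im z ^+ 2)^-1.
Proof. by case: z. Qed.

Lemma ImV z : Im z^-1 = - Im z * (Re z ^+ 2 + Im z ^+ 2)^-1.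
Proof. by case: z => a b /=; rewrite mulNr. Qed.

Lemma Re_nat n : Re (n%:R : R[i]) = n%:R.
Proof. by elim: n => // n IH; rewrite -natr1 ReD IH /= -natr1. Qed.

Lemma Im_nat n : Im (n%:R : R[i]) = 0.
Proof. by elim: n => // n IH; rewrite -natr1 ImD IH /= addr0. Qed.

Definition ReImE := (ReM, ImM, ReD, ImD, ReN, ImN, Re_nat, Im_nat).

Lemma complex_ext z w : Re z = Re w -> Im z = Im w -> z = w.
Proof. by case: z => a b; case: w => c e /= -> ->. Qed.

Lemma normcE2 z : normc z = Num.sqrt (Re z ^+ 2 + Im z ^+ 2).
Proof. by case: z. Qed.

Lemma sqr_normcE z : normc z ^+ 2 = Re z ^+ 2 + Im z ^+ 2.
Proof. by rewrite normcE2 sqr_sqrtr// addr_ge0// sqr_ge0. Qed.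

Lemma normc_ge0 z : 0 <= normc z.
Proof. by rewrite normcE2 sqrtr_ge0. Qed.

Lemma normr_Re z : `|Re z| <= normc z.
Proof.
by rewrite normcE2 -sqrtr_sqr ler_wsqrtr// lerDl sqr_ge0.
Qed.

Lemma normr_Im z : `|Im z| <= normc z.
Proof.
by rewrite normcE2 -sqrtr_sqr ler_wsqrtr// lerDr sqr_ge0.
Qed.

Lemma normc_real (x : R) : normc x%:C = `|x|.
Proof. by rewrite normcE2 /= expr0n /= addr0 sqrtr_sqr. Qed.

Lemma normc_nat n : normc (n%:R : R[i]) = n%:R.
Proof. by rewrite normcE2 Re_nat Im_nat expr0n addr0 sqrtr_sqr ger0_norm. Qed.

Lemma normc_eq0 z : (normc z == 0) = (z == 0).
Proof.
apply/eqP/eqP => [|->]; first exact: ComplexField.Normc.eq0_normc.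
exact: ComplexField.Normc.normc0.
Qed.

Lemma normc_gt0 z : (0 < normc z) = (z != 0).
Proof. by rewrite lt_def normc_eq0 normc_ge0 andbT. Qed.

Lemma normc_prod (I : Type) (s : seq I) (P : pred I) (F : I -> R[i]) :
  normc (\prod_(i <- s | P i) F i) = \prod_(i <- s | P i) normc (F i).
Proof.
elim/big_rec2 : _ => [|i x y _ <-]; first by rewrite ComplexField.Normc.normc1.
exact: normcM.
Qed.

Lemma Re_neq0 z : Re z != 0 -> z != 0.
Proof. by apply: contra => /eqP ->. Qed.

Lemma Im_neq0 z : Im z != 0 -> z != 0.
Proof. by apply: contra => /eqP ->. Qed.

Lemma ReImsq_gt0 z : z != 0 -> 0 < Re z ^+ 2 + Im z ^+ 2.
Proof. by rewrite -sqr_normcE -normc_gt0 => ?; rewrite exprn_gt0. Qed.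

Lemma cexp0 : cexp (0 : R[i]) = 1.
Proof. by rewrite /cexp /= expR0 cos0 sin0 mul1r. Qed.

Lemma Re_cexp z : Re (cexp z) = expR (Re z) * cos (Im z).
Proof. by rewrite /cexp ReM /= mul0r subr0. Qed.

Lemma Im_cexp z : Im (cexp z) = expR (Re z) * sin (Im z).
Proof. by rewrite /cexp ImM /= mul0r addr0. Qed.

Lemma cexpD z w : cexp (z + w) = cexp z * cexp w.
Proof.
apply: complex_ext.
  by rewrite Re_cexp [RHS]ReM !Re_cexp !Im_cexp ReD ImD expRD cosD; ring.
by rewrite Im_cexp [RHS]ImM !Re_cexp !Im_cexp ReD ImD expRD sinD; ring.
Qed.

Lemma normc_cexp z : normc (cexp z) = expR (Re z).
Proof.
rewrite normcE2 Re_cexp Im_cexp !exprMn -mulrDr cos2Dsin2 mulr1 sqrtr_sqr.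
by rewrite ger0_norm// expR_ge0.
Qed.

Lemma cexp_neq0 z : cexp z != 0.
Proof. by rewrite -normc_gt0 normc_cexp expR_gt0. Qed.

Lemma cexpN z : cexp (- z) = (cexp z)^-1.
Proof.
by apply: (mulIf (cexp_neq0 z)); rewrite mulVf ?cexp_neq0// -cexpD addNr cexp0.
Qed.

Lemma cexp_real (x : R) : cexp x%:C = (expR x)%:C.
Proof. by apply: complex_ext; rewrite ?Re_cexp ?Im_cexp /= ?cos0 ?sin0 ?mulr1 ?mulr0. Qed.

Lemma normc_realM (r : R) z : 0 <= r ->
  normc (r%:C * z) = r * normc z.
Proof. by move=> r0; rewrite normcM normc_real ger0_norm. Qed.

Lemma normc_i : normc ('i : R[i]) = 1.
Proof. by rewrite normcE2 /= expr0n expr1n add0r sqrtr1. Qed.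

End complex_basics.

Section complex_sequences.
Context {R : realType}.
Implicit Types (u v : nat -> R[i]) (z w : R[i]).

Definition ccvg u z :=
  (Re (u n) @[n --> \oo] --> Re z) /\ (Im (u n) @[n --> \oo] --> Im z).

Lemma ccvg_cst z : ccvg (fun=> z) z.
Proof. by split; exact: cvg_cst. Qed.

Lemma ccvgM u v z w : ccvg u z -> ccvg v w -> ccvg (fun n => u n * v n) (z * w).
Proof.
move=> [u1 u2] [v1 v2]; split.
  rewrite ReM; under eq_fun do rewrite ReM.
  by apply: cvgB; apply: cvgM.
rewrite ImM; under eq_fun do rewrite ImM.
by apply: cvgD; apply: cvgM.
Qed.

Lemma ccvgD u v z w : ccvg u z -> ccvg v w -> ccvg (fun n => u n + v n) (z + w).
Proof.
move=> [u1 u2] [v1 v2]; split.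
  by rewrite ReD; under eq_fun do rewrite ReD; exact: cvgD.
by rewrite ImD; under eq_fun do rewrite ImD; exact: cvgD.
Qed.

Lemma ccvgN u z : ccvg u z -> ccvg (fun n => - u n) (- z).
Proof.
move=> [u1 u2]; split.
  by rewrite ReN; under eq_fun do rewrite ReN; exact: cvgN.
by rewrite ImN; under eq_fun do rewrite ImN; exact: cvgN.
Qed.

Lemma ccvgV u z : z != 0 -> ccvg u z -> ccvg (fun n => (u n)^-1) z^-1.
Proof.
move=> z0 [u1 u2].
have H : (Re (u n) ^+ 2 + Im (u n) ^+ 2)^-1 @[n --> \oo] -->
    (Re z ^+ 2 + Im z ^+ 2)^-1.
  apply: cvgV; first by rewrite gt_eqF// ReImsq_gt0.
  by apply: cvgD; rewrite expr2; under eq_fun do rewrite expr2; exact: cvgM.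
split.
  by rewrite ReV; under eq_fun do rewrite ReV; exact: cvgM.
rewrite ImV; under eq_fun do rewrite ImV.
by apply: cvgM => //; exact: cvgN.
Qed.

Lemma ccvg_real (r : nat -> R) (l : R) : r n @[n --> \oo] --> l ->
  ccvg (fun n => (r n)%:C) l%:C.
Proof. by move=> rl; split => //=; exact: cvg_cst. Qed.

Lemma ccvg_unique u z w : ccvg u z -> ccvg u w -> z = w.
Proof.
move=> [u1 u2] [v1 v2]; apply: complex_ext.
  exact: (cvg_unique _ u1 v1).
exact: (cvg_unique _ u2 v2).
Qed.

Lemma ccvg_normc u z : ccvg u z -> normc (u n) @[n --> \oo] --> normc z.
Proof.
move=> [u1 u2]; rewrite normcE2; under eq_fun do rewrite normcE2.
apply: (@continuous_cvg _ _ _ _ _ _ (@Num.sqrt R)); first exact: sqrt_continuous.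
by apply: cvgD; rewrite expr2; under eq_fun do rewrite expr2; exact: cvgM.
Qed.

Lemma ccvg_prod (I : Type) (s : seq I) (U : I -> nat -> R[i]) (Z : I -> R[i]) :
  (forall i, ccvg (U i) (Z i)) ->
  ccvg (fun n => \prod_(i <- s) U i n) (\prod_(i <- s) Z i).
Proof.
move=> H; elim: s => [|i s IH].
  by rewrite big_nil; under eq_fun do rewrite big_nil; exact: ccvg_cst.
by rewrite big_cons; under eq_fun do rewrite big_cons; exact: ccvgM.
Qed.

Lemma ccvg0 u (r : nat -> R) :
  (forall n, normc (u n) <= r n) -> r n @[n --> \oo] --> (0 : R) -> ccvg u 0.
Proof.
move=> ur r0; split; apply/cvgr0Pnorm_le => e e0;
  move/cvgr0Pnorm_le : r0 => /(_ _ e0); apply: filterS => n; apply: le_trans;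
  apply: le_trans (le_trans (ur n) (ler_norm _)).
  exact: normr_Re.
exact: normr_Im.
Qed.

Lemma ccvg_near u v z :
  (\forall n \near \oo, u n = v n) -> ccvg u z -> ccvg v z.
Proof.
move=> uv [u1 u2]; split.
  apply: cvg_trans u1; apply: near_eq_cvg; apply: filterS uv => n /= ->//.
by apply: cvg_trans u2; apply: near_eq_cvg; apply: filterS uv => n /= ->.
Qed.

End complex_sequences.

(** * Integrals of real and complex functions *)

Section real_integrals.
Context d (T : measurableType d) {R : realType} (mu : {measure set T -> \bar R}).
Implicit Types (f g : T -> R).

Lemma integrable_dom f g : measurable_fun setT f ->
  mu.-integrable setT (EFin \o g) -> (forall x, `|f x| <= g x) ->
  mu.-integrable setT (EFin \o f).
Proof.
move=> mf ig fg; apply: le_integrable ig => //; first exact/measurable_EFinP.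
by move=> x _ /=; rewrite lee_fin (le_trans (fg x))// ler_norm.
Qed.

Lemma integrable_measurable f : mu.-integrable setT (EFin \o f) ->
  measurable_fun setT f.
Proof. by move=> /integrableP[/measurable_EFinP]. Qed.

Lemma integrable_mull (k : R) f : mu.-integrable setT (EFin \o f) ->
  mu.-integrable setT (EFin \o (fun x => k * f x)).
Proof. by move=> fi; exact: (integrableZl measurableT k fi). Qed.

Lemma Rintegral_cvg (f_ : nat -> T -> R) f g :
  (forall n, measurable_fun setT (f_ n)) ->
  (forall x, f_ n x @[n --> \oo] --> f x) ->
  mu.-integrable setT (EFin \o g) ->
  (forall n x, `|f_ n x| <= g x) ->
  (\int[mu]_x f_ n x) @[n --> \oo] --> \int[mu]_x f x.
Proof.
move=> mf ff ig fg.
have mf' : measurable_fun setT f by apply: (measurable_fun_cvg mf) => x _; exact: ff.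
have fgl x : `|f x| <= g x.
  apply: (cvgr_to_le (cvg_norm (ff x))).
  by apply: nearW => n; exact: fg.
have iF : mu.-integrable setT (EFin \o f) by apply: integrable_dom ig fgl.
have iFn n : mu.-integrable setT (EFin \o f_ n) by apply: integrable_dom ig (fg n).
have ffE : {ae mu, forall x, [set: T] x -> (EFin \o f_ n) x @[n --> \oo] --> (EFin \o f) x}.
  by apply: aeW => x _; apply: cvg_EFin; [exact: nearW|exact: ff].
have fgE : {ae mu, forall x n, [set: T] x -> (`|(EFin \o f_ n) x| <= (EFin \o g) x)%E}.
  by apply: aeW => x n _; rewrite /= lee_fin.
have mfE n : measurable_fun setT (EFin \o f_ n) by exact/measurable_EFinP.
have mfE' : measurable_fun setT (EFin \o f) by exact/measurable_EFinP.
have [_ _] := dominated_convergence measurableT mfE mfE' ffE ig fgE.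
move=> H; apply: fine_cvg.
by rewrite /Rintegral fineK; [exact: H|exact: integrable_fin_num].
Qed.

End real_integrals.

Section real_fubini.
Context d1 d2 (T1 : measurableType d1) (T2 : measurableType d2) {R : realType}.
Variables (m1 : {sigma_finite_measure set T1 -> \bar R})
  (m2 : {sigma_finite_measure set T2 -> \bar R}).
Variable f : T1 * T2 -> R.

(** Fubini for real-valued integrals; asking for integrability on every section
    (and not only almost every one) spares the passage through null sets. *)
Lemma Rintegral_Fubini : (m1 \x m2)%E.-integrable setT (EFin \o f) ->
  (forall x, m2.-integrable setT (fun y => (f (x, y))%:E)) ->
  (forall y, m1.-integrable setT (fun x => (f (x, y))%:E)) ->
  \int[m1]_x \int[m2]_y f (x, y) = \int[m2]_y \int[m1]_x f (x, y).
Proof.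
move=> int12 i2 i1; rewrite /Rintegral; congr fine.
transitivity (\int[m1]_x \int[m2]_y (f (x, y))%:E)%E.
  apply: eq_integral => x _; rewrite fineK//.
  by apply: (@integrable_fin_num _ _ _ m2 setT measurableT (fun y => (f (x,y))%:E)).
rewrite (Fubini int12); apply: eq_integral => y _ /=; rewrite fineK//.
by apply: (@integrable_fin_num _ _ _ m1 setT measurableT (fun x => (f (x,y))%:E)).
Qed.

Variables (g1 : T1 -> R) (g2 : T2 -> R).
Hypothesis mf : measurable_fun setT f.
Hypothesis ig1 : m1.-integrable setT (EFin \o g1).
Hypothesis ig2 : m2.-integrable setT (EFin \o g2).
Hypothesis fg : forall x y, `|f (x, y)| <= g1 x * g2 y.

Lemma integrable_section2 x : m2.-integrable setT (fun y => (f (x, y))%:E).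
Proof.
apply: (@integrable_dom _ _ _ m2 (fun y => f (x, y)) (fun y => g1 x * g2 y)).
- exact: measurable_fun_pair2 mf.
- exact: (integrableZl measurableT (g1 x) ig2).
- exact: fg.
Qed.

Lemma integrable_section1 y : m1.-integrable setT (fun x => (f (x, y))%:E).
Proof.
apply: (@integrable_dom _ _ _ m1 (fun x => f (x, y)) (fun x => g1 x * g2 y)).
- exact: measurable_fun_pair1 mf.
- exact: (integrableZr measurableT (g2 y) ig1).
- by move=> x; exact: fg.
Qed.

(** Tonelli's theorem, the dominating function being a product. *)
Lemma integrable_prod_dom : (m1 \x m2)%E.-integrable setT (EFin \o f).
Proof.
apply/integrable12ltyP; first exact/measurable_EFinP.
have ag x y : `|f (x, y)| <= `|g1 x| * `|g2 y|.
  by rewrite -normrM (le_trans (fg x y))// ler_norm.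
apply: (@le_lt_trans _ _ (\int[m1]_x \int[m2]_y (`|g1 x| * `|g2 y|)%:E)%E).
  apply: ge0_le_integral => //.
  - by move=> x _; apply: integral_ge0.
  - apply: (@measurable_fun_fubini_tonelli_F _ _ _ _ _ _ (fun z => `|(f z)%:E|%E)) => //.
    by apply: measurableT_comp => //; exact/measurable_EFinP.
  - apply: (@measurable_fun_fubini_tonelli_F _ _ _ _ _ _ (fun z => (`|g1 z.1| * `|g2 z.2|)%:E)) => //.
      apply/measurable_EFinP; apply: measurable_funM; apply: measurableT_comp => //.
        by apply: measurableT_comp => //; exact: integrable_measurable ig1.
      by apply: measurableT_comp => //; exact: integrable_measurable ig2.
  - move=> x _; apply: ge0_le_integral => //.
    + by apply: measurableT_comp => //; apply/measurable_EFinP; exact: measurable_fun_pair2 mf.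
    + apply/measurable_EFinP; apply: measurable_funM => //; apply: measurableT_comp => //.
      exact: integrable_measurable ig2.
    + by move=> y _; rewrite lee_fin ag.
have E x : (\int[m2]_y (`|g1 x| * `|g2 y|)%:E = `|g1 x|%:E * \int[m2]_y `|g2 y|%:E)%E.
  under eq_integral do rewrite EFinM.
  rewrite ge0_integralZl//.
  by apply/measurable_EFinP; apply: measurableT_comp => //; exact: integrable_measurable ig2.
under eq_integral do rewrite E.
have f2 : (\int[m2]_y `|g2 y|%:E)%E \is a fin_num.
  apply: integrable_fin_num => //.
  by have /= := integrable_abse ig2.
rewrite -(fineK f2) ge0_integralZr//; last 2 first.
- by apply/measurable_EFinP; apply: measurableT_comp => //; exact: integrable_measurable ig1.
- by rewrite lee_fin fine_ge0// integral_ge0.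
have f1 : (\int[m1]_y `|g1 y|%:E)%E \is a fin_num.
  apply: integrable_fin_num => //.
  by have /= := integrable_abse ig1.
by rewrite -(fineK f1) -EFinM ltry.
Qed.

Lemma Rintegral_Fubini_dom :
  \int[m1]_x \int[m2]_y f (x, y) = \int[m2]_y \int[m1]_x f (x, y).
Proof.
apply: Rintegral_Fubini; first exact: integrable_prod_dom.
- exact: integrable_section2.
- exact: integrable_section1.
Qed.

Lemma integrable_fubini_dom :
  m1.-integrable setT (fun x => (\int[m2]_y f (x, y))%:E).
Proof.
have := integrable_fubini_F integrable_prod_dom.
apply: eq_integrable => // x _ /=.
by rewrite /fubini_F /Rintegral fineK//; apply: integrable_fin_num => //; exact: integrable_section2.
Qed.

End real_fubini.

Section complex_integrals.
Context d (T : measurableType d) {R : realType} (mu : {measure set T -> \bar R}).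
Implicit Types (f g : T -> R[i]).

Definition cmeasurable f :=
  measurable_fun setT (fun x => Re (f x)) /\ measurable_fun setT (fun x => Im (f x)).

Definition cintegrable f :=
  mu.-integrable setT (EFin \o (fun x => Re (f x))) /\
  mu.-integrable setT (EFin \o (fun x => Im (f x))).

Lemma cmeasurable_cst z : cmeasurable (fun=> z).
Proof. by split; exact: measurable_cst. Qed.

Lemma cmeasurableD f g : cmeasurable f -> cmeasurable g ->
  cmeasurable (fun x => f x + g x).
Proof.
move=> [f1 f2] [g1 g2]; split.
  by under eq_fun do rewrite ReD; exact: measurable_funD.
by under eq_fun do rewrite ImD; exact: measurable_funD.
Qed.

Lemma cmeasurableN f : cmeasurable f -> cmeasurable (fun x => - f x).
Proof.
move=> [f1 f2]; split.
  by under eq_fun do rewrite ReN; apply: measurableT_comp.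
by under eq_fun do rewrite ImN; apply: measurableT_comp.
Qed.

Lemma cmeasurableM f g : cmeasurable f -> cmeasurable g ->
  cmeasurable (fun x => f x * g x).
Proof.
move=> [f1 f2] [g1 g2]; split.
  by under eq_fun do rewrite ReM; apply: measurable_funB; exact: measurable_funM.
by under eq_fun do rewrite ImM; apply: measurable_funD; exact: measurable_funM.
Qed.

Lemma measurable_fun_inv (h : T -> R) : (forall x, 0 <= h x) ->
  measurable_fun setT h -> measurable_fun setT (fun x => (h x)^-1).
Proof.
move=> h0 mh; rewrite (_ : (fun _ => _) = (fun y => y `^ (-1)) \o h).
  by apply: measurableT_comp => //; exact: measurable_powR.
by apply/funext => x /=; rewrite powR_inv1.
Qed.

Lemma cmeasurableV f : cmeasurable f -> cmeasurable (fun x => (f x)^-1).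
Proof.
move=> [f1 f2].
have H : measurable_fun setT (fun x => (Re (f x) ^+ 2 + Im (f x) ^+ 2)^-1).
  apply: measurable_fun_inv => [x|]; first by rewrite addr_ge0// sqr_ge0.
  by apply: measurable_funD; exact: measurable_funX.
split.
  by under eq_fun do rewrite ReV; exact: measurable_funM.
under eq_fun do rewrite ImV; apply: measurable_funM => //.
exact: measurableT_comp.
Qed.

Lemma cmeasurable_cexp f : cmeasurable f -> cmeasurable (fun x => cexp (f x)).
Proof.
move=> [f1 f2]; split.
  under eq_fun do rewrite Re_cexp; apply: measurable_funM; first exact: measurableT_comp.
  apply: measurableT_comp f2; apply: continuous_measurable_fun; exact: continuous_cos.
under eq_fun do rewrite Im_cexp; apply: measurable_funM; first exact: measurableT_comp.
apply: measurableT_comp f2; apply: continuous_measurable_fun; exact: continuous_sin.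
Qed.

Lemma cmeasurable_real (h : T -> R) : measurable_fun setT h ->
  cmeasurable (fun x => (h x)%:C).
Proof. by move=> mh; split => //=; exact: measurable_cst. Qed.

Lemma cmeasurable_cvg (f_ : nat -> T -> R[i]) f :
  (forall n, cmeasurable (f_ n)) -> (forall x, ccvg (fun n => f_ n x) (f x)) ->
  cmeasurable f.
Proof.
move=> mf ff; split.
  apply: (@measurable_fun_cvg _ _ _ _ (fun n x => Re (f_ n x))).
    by move=> n; have [] := mf n.
  by move=> x _; have [] := ff x.
apply: (@measurable_fun_cvg _ _ _ _ (fun n x => Im (f_ n x))).
  by move=> n; have [] := mf n.
by move=> x _; have [] := ff x.
Qed.

Lemma cintegrable_dom f (g : T -> R) : cmeasurable f ->
  mu.-integrable setT (EFin \o g) -> (forall x, normc (f x) <= g x) -> cintegrable f.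
Proof.
move=> [f1 f2] ig fg; split; apply: (@integrable_dom _ _ _ mu _ g) => // x.
  exact: le_trans (normr_Re _) (fg x).
exact: le_trans (normr_Im _) (fg x).
Qed.

Lemma eq_cintegrable f g : (forall x, f x = g x) -> cintegrable f -> cintegrable g.
Proof. by move=> fg; rewrite (_ : f = g)//; apply/funext. Qed.

Lemma cintegrableB f g : cintegrable f -> cintegrable g ->
  cintegrable (fun x => f x - g x).
Proof.
move=> [f1 f2] [g1 g2]; split.
  apply: eq_integrable (integrableB measurableT f1 g1) => // x _.
  by rewrite [in LHS]/comp [in RHS]/comp ReD ReN EFinB.
apply: eq_integrable (integrableB measurableT f2 g2) => // x _.
by rewrite [in LHS]/comp [in RHS]/comp ImD ImN EFinB.
Qed.

Lemma cintegrableZl z f : cintegrable f -> cintegrable (fun x => z * f x).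
Proof.
move=> [f1 f2]; split.
  apply: eq_integrable (integrableB measurableT (integrable_mull (Re z) f1)
    (integrable_mull (Im z) f2)) => // x _.
  by rewrite [in LHS]/comp [in RHS]/comp ReM EFinB.
apply: eq_integrable (integrableD measurableT (integrable_mull (Re z) f2)
  (integrable_mull (Im z) f1)) => // x _.
by rewrite [in LHS]/comp [in RHS]/comp ImM EFinD.
Qed.

Lemma eq_cintegral f g : (forall x, f x = g x) ->
  cintegral mu setT f = cintegral mu setT g.
Proof. by move=> fg; congr cintegral; apply/funext. Qed.

Lemma cintegralZl z f : cintegrable f ->
  cintegral mu setT (fun x => z * f x) = z * cintegral mu setT f.
Proof.
move=> [i1 i2]; apply: complex_ext.
  rewrite ReM /cintegral /=; under eq_Rintegral do rewrite ReM.
  by rewrite RintegralB ?RintegralZl//; exact: integrable_mull.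
rewrite ImM /cintegral /=; under eq_Rintegral do rewrite ImM.
by rewrite RintegralD ?RintegralZl//; exact: integrable_mull.
Qed.

Lemma cintegralZr z f : cintegrable f ->
  cintegral mu setT (fun x => f x * z) = cintegral mu setT f * z.
Proof.
by move=> fi; rewrite mulrC -cintegralZl//; apply: eq_cintegral => x; rewrite mulrC.
Qed.

Lemma cintegralB f g : cintegrable f -> cintegrable g ->
  cintegral mu setT (fun x => f x - g x) = cintegral mu setT f - cintegral mu setT g.
Proof.
move=> [f1 f2] [g1 g2]; apply: complex_ext; rewrite ?ReD ?ImD ?ReN ?ImN /=.
  by under eq_Rintegral do rewrite ReD ReN; rewrite RintegralB.
by under eq_Rintegral do rewrite ImD ImN; rewrite RintegralB.
Qed.

Lemma cintegral_cvg (f_ : nat -> T -> R[i]) f (g : T -> R) :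
  (forall n, cmeasurable (f_ n)) ->
  (forall x, ccvg (fun n => f_ n x) (f x)) ->
  mu.-integrable setT (EFin \o g) ->
  (forall n x, normc (f_ n x) <= g x) ->
  ccvg (fun n => cintegral mu setT (f_ n)) (cintegral mu setT f).
Proof.
move=> mf ff ig fg; split.
  apply: Rintegral_cvg ig _ => [n|x|n x]; first by have [] := mf n.
    by have [] := ff x.
  exact: le_trans (normr_Re _) (fg n x).
apply: Rintegral_cvg ig _ => [n|x|n x]; first by have [] := mf n.
  by have [] := ff x.
exact: le_trans (normr_Im _) (fg n x).
Qed.

End complex_integrals.

Lemma cintegral_Fubini {R : realType} d1 d2 (T1 : measurableType d1)
    (T2 : measurableType d2) (m1 : {sigma_finite_measure set T1 -> \bar R})
    (m2 : {sigma_finite_measure set T2 -> \bar R}) (f : T1 * T2 -> R[i])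
    (g1 : T1 -> R) (g2 : T2 -> R) :
  cmeasurable f ->
  m1.-integrable setT (EFin \o g1) -> m2.-integrable setT (EFin \o g2) ->
  (forall x y, normc (f (x, y)) <= g1 x * g2 y) ->
  cintegral m1 setT (fun x => cintegral m2 setT (fun y => f (x, y))) =
  cintegral m2 setT (fun y => cintegral m1 setT (fun x => f (x, y))).
Proof.
move=> [f1 f2] ig1 ig2 fg; apply: complex_ext => /=.
  apply: (@Rintegral_Fubini_dom _ _ _ _ _ m1 m2 (fun z => Re (f z)) g1 g2) => // x y.
  exact: le_trans (normr_Re _) (fg x y).
apply: (@Rintegral_Fubini_dom _ _ _ _ _ m1 m2 (fun z => Im (f z)) g1 g2) => // x y.
exact: le_trans (normr_Im _) (fg x y).
Qed.

(** * Substitutions on the line *)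

Section line_integrals.
Context {R : realType}.
Local Notation mu := (@lebesgue_measure R).
Implicit Types (f g : R -> R).

Section measure_preserving.
Variable phi : measurableTypeR R -> measurableTypeR R.
Hypothesis mphi : measurable_fun setT phi.
Hypothesis phiE : forall A, measurable A -> pushforward mu phi A = mu A.

Lemma ge0_integral_preserving (f : R -> \bar R) : measurable_fun setT f ->
  (forall x, 0 <= f x)%E -> (\int[mu]_x f (phi x) = \int[mu]_x f x)%E.
Proof.
move=> mf f0.
rewrite [RHS](_ : _ = \int[pushforward mu phi]_x f x)%E; last first.
  by apply: eq_measure_integral => //= A mA _; exact/esym/phiE.
by rewrite ge0_integral_pushforward// preimage_setT.
Qed.

Lemma Rintegral_preserving f : measurable_fun setT f ->
  \int[mu]_x f (phi x) = \int[mu]_x f x.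
Proof.
move=> mf; rewrite /Rintegral; congr fine.
rewrite integralE [RHS]integralE; congr (_ - _)%E.
  rewrite -[RHS]ge0_integral_preserving//.
    by apply: eq_integral => x _; rewrite !funeposE.
  by apply: measurable_funepos; exact/measurable_EFinP.
rewrite -[RHS]ge0_integral_preserving//.
  by apply: eq_integral => x _; rewrite !funenegE.
by apply: measurable_funeneg; exact/measurable_EFinP.
Qed.

Lemma integrable_preserving f : mu.-integrable setT (EFin \o f) ->
  mu.-integrable setT (EFin \o (f \o phi)).
Proof.
move=> /integrableP[/measurable_EFinP mf foo]; apply/integrableP; split.
  by apply/measurable_EFinP; exact: measurableT_comp.
move: foo; rewrite -(@ge0_integral_preserving (fun x => `|(f x)%:E|%E))//.
by apply: measurableT_comp => //; exact/measurable_EFinP.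
Qed.

End measure_preserving.

Lemma lebesgue_measureD (a : R) (A : set (measurableTypeR R)) : measurable A ->
  pushforward mu (fun x : measurableTypeR R => (x + a)%R : measurableTypeR R) A = mu A.
Proof.
move=> mA.
have mphi : measurable_fun setT (fun x : measurableTypeR R => (x + a)%R : measurableTypeR R).
  exact: measurable_funD.
apply/esym/lebesgue_measure_unique => //= _ [[b c]] _ <-.
rewrite /pushforward.
rewrite (_ : _ @^-1` _ = `](b - a)%R, (c - a)%R]%classic); last first.
  by apply/seteqP; split => x /=; rewrite !in_itv/= ltrBlDr lerBrDr.
by rewrite !lebesgue_measure_itv/= !lte_fin ltrD2r -!EFinD opprB addrA subrK.
Qed.

Lemma integrable_expRNabs (e : R) : 0 < e ->
  mu.-integrable setT (EFin \o (fun u => expR (- (e * `|u|)))).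
Proof.
move=> e0.
have i1 := integrable_exponential_pdf e0.
have i2 : mu.-integrable setT (EFin \o (exponential_pdf e \o -%R)).
  apply: (@integrable_preserving (fun x : measurableTypeR R => - x : measurableTypeR R)) i1 => //; first exact: oppr_measurable.
  by move=> A mA; exact: lebesgue_measureN.
have i3 := integrable_mull e^-1 (integrableD measurableT i1 i2).
apply: integrable_dom i3 _ => [|u].
  apply: measurableT_comp => //; apply: measurableT_comp => //.
  by apply: measurable_funM => //; exact: measurableT_comp.
rewrite /= ger0_norm ?expR_ge0//.
rewrite ler_pdivlMl//.
have [u0|u0] := leP 0 u.
  rewrite (exponential_pdfE _ u0) ger0_norm//.
  by rewrite mulNr lerDl; apply: exponential_pdf_ge0; exact: ltW.
have nu0 : 0 <= - u by rewrite oppr_ge0 ltW.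
rewrite addrC (exponential_pdfE _ nu0) (ltr0_norm u0).
by rewrite mulNr lerDl; apply: exponential_pdf_ge0; exact: ltW.
Qed.

(** Monotone convergence extends the substitution [t = exp u] from the compact
    intervals to the half-line. *)
Lemma ge0_integral_expR f : (forall t, 0 < t -> {for t, continuous f}) ->
  (forall t, 0 <= f t) ->
  (\int[mu]_(t in `]0%R, +oo[) (f t)%:E = \int[mu]_u (f (expR u) * expR u)%:E)%E.
Proof.
move=> cf f0.
pose A n : set R := `[expR (- n%:R), expR n%:R]%classic.
pose B n : set R := `[- n%:R, n%:R]%classic.
have AE : \bigcup_n A n = `]0%R, +oo[%classic.
  apply/seteqP; split => [t [n _]|t]; rewrite /A /= !in_itv/= ?andbT.
    by move=> /andP[+ _]; apply: lt_le_trans; exact: expR_gt0.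
  move=> t0; have [n nt] : exists n : nat, `|ln t| < n%:R.
    by exists (Num.truncn `|ln t|).+1; rewrite truncnS_gt.
  exists n => //; rewrite /A /= in_itv/= -{1 2}(lnK t0) !ler_expR.
  by rewrite -ler_norml ltW.
have BE : \bigcup_n B n = setT.
  apply/seteqP; split => // t _.
  exists (Num.truncn `|t|).+1 => //.
  by rewrite /B /= in_itv/= -ler_norml ltW// truncnS_gt.
have dE : expR^`()%classic = expR :> (R -> R).
  by apply/funext => x; rewrite derive1E derive_val.
have AB n : (\int[mu]_(t in A n) (f t)%:E = \int[mu]_(u in B n) (f (expR u) * expR u)%:E)%E.
  rewrite /A /B (@integration_by_substitution_increasing _ expR f (- n%:R) n%:R) ?dE//.
  - by rewrite lerNl (le_trans _ (ler0n _ n))// oppr_le0.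
  - by move=> x y _ _; rewrite ltr_expR.
  - by move=> x _; exact: continuous_expR.
  - apply/cvg_ex; exists (expR (- n%:R)); apply: cvg_at_right_filter; exact: continuous_expR.
  - apply/cvg_ex; exists (expR n%:R); apply: cvg_at_left_filter; exact: continuous_expR.
  - split.
    + by move=> x _; exact: derivable_expR.
    + by apply: cvg_at_right_filter; exact: continuous_expR.
    + by apply: cvg_at_left_filter; exact: continuous_expR.
  - apply: continuous_in_subspaceT => x /set_mem /=; rewrite in_itv/= => /andP[x0 _].
    by apply: cf; apply: lt_le_trans x0; exact: expR_gt0.
have mfpos : measurable_fun (`]0%R, +oo[%classic : set (measurableTypeR R)) f.
  apply: open_continuous_measurable_fun => //.
  by move=> x; rewrite inE/= in_itv/= andbT; exact: cf.
have mfe : measurable_fun setT (fun u : measurableTypeR R => f (expR u)).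
  apply: continuous_measurable_fun => u; apply: continuous_comp; first exact: continuous_expR.
  by apply: cf; exact: expR_gt0.
have ABmono (k l : nat) : (k <= l)%N -> - (l%:R : R) <= - k%:R.
  by move=> kl; rewrite lerN2 ler_nat.
rewrite -AE -BE.
have cA : (\int[mu]_(t in A n) (f t)%:E @[n --> \oo] --> \int[mu]_(t in \bigcup_n A n) (f t)%:E)%E.
  apply: ge0_nondecreasing_set_cvg_integral => //.
  - move=> k l kl; apply/subsetPset => t; rewrite /A /= !in_itv/= => /andP[t1 t2].
    by rewrite (le_trans _ t1) ?ler_expR ?ABmono//= (le_trans t2)// ler_expR ler_nat.
  - by move=> i; exact: measurable_itv.
  - move=> i; apply/measurable_EFinP; apply: measurable_funS mfpos => //.
    by rewrite -AE; exact: bigcup_sup.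
  - by move=> i x _; rewrite lee_fin.
have cB : (\int[mu]_(u in B n) (f (expR u) * expR u)%:E @[n --> \oo] -->
   \int[mu]_(u in \bigcup_n B n) (f (expR u) * expR u)%:E)%E.
  apply: ge0_nondecreasing_set_cvg_integral => //.
  - move=> k l kl; apply/subsetPset => t; rewrite /B /= !in_itv/= => /andP[t1 t2].
    by rewrite (le_trans _ t1) ?ABmono//= (le_trans t2)// ler_nat.
  - by move=> i; exact: measurable_itv.
  - move=> i; apply/measurable_EFinP; apply: measurable_funTS.
    by apply: measurable_funM => //; exact: measurable_expR.
  - by move=> i x _; rewrite lee_fin mulr_ge0// expR_ge0.
rewrite -(cvg_lim _ cA)// -(cvg_lim _ cB)//.
by congr (limn _); apply/funext => n; exact: AB.
Qed.

Lemma Rintegral_expR f : (forall t, 0 < t -> {for t, continuous f}) ->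
  \int[mu]_(t in `]0%R, +oo[) f t = \int[mu]_u (f (expR u) * expR u).
Proof.
move=> cf; rewrite /Rintegral; congr fine.
rewrite integralE [RHS]integralE; congr (_ - _)%E.
  transitivity (\int[mu]_(t in `]0%R, +oo[) (Num.max (f t) 0)%:E)%E.
    by apply: eq_integral => t _; rewrite funeposE -EFin_max.
  rewrite ge0_integral_expR.
  - apply: eq_integral => u _; rewrite funeposE -EFin_max.
    by rewrite maxr_pMl ?expR_ge0// mul0r.
  - move=> t t0; apply: continuous_max; first exact: cf.
    exact: cvg_cst.
  - by move=> t; rewrite le_max lexx orbT.
transitivity (\int[mu]_(t in `]0%R, +oo[) (Num.max (- f t) 0)%:E)%E.
  by apply: eq_integral => t _; rewrite funenegE -EFinN -EFin_max.
rewrite ge0_integral_expR.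
- apply: eq_integral => u _; rewrite funenegE -EFinN -EFin_max.
  by rewrite maxr_pMl ?expR_ge0// mul0r mulNr.
- move=> t t0; apply: continuous_max; last exact: cvg_cst.
  by apply: continuousN; exact: cf.
- by move=> t; rewrite le_max lexx orbT.
Qed.

Lemma Rintegral_shift f a : measurable_fun setT f ->
  \int[mu]_x f (x + a) = \int[mu]_x f x.
Proof.
move=> mf; apply: (@Rintegral_preserving (fun x => x + a)) => //.
  exact: measurable_funD.
by move=> A; exact: lebesgue_measureD.
Qed.

Lemma Rintegral_opp f : measurable_fun setT f ->
  \int[mu]_x f (- x) = \int[mu]_x f x.
Proof.
move=> mf; apply: (@Rintegral_preserving (fun x : measurableTypeR R => - x : measurableTypeR R)) => //; first exact: oppr_measurable.
by move=> A; exact: lebesgue_measureN.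
Qed.

Lemma integrable_shift f a : mu.-integrable setT (EFin \o f) ->
  mu.-integrable setT (EFin \o (fun x => f (x + a))).
Proof.
apply: (@integrable_preserving (fun x => x + a)) => //.
  exact: measurable_funD.
by move=> A; exact: lebesgue_measureD.
Qed.

Lemma integrable_opp f : mu.-integrable setT (EFin \o f) ->
  mu.-integrable setT (EFin \o (fun x => f (- x))).
Proof.
apply: (@integrable_preserving (fun x : measurableTypeR R => - x : measurableTypeR R)) => //; first exact: oppr_measurable.
by move=> A; exact: lebesgue_measureN.
Qed.

Implicit Types F : R -> R[i].

Lemma cintegral_shift F a : cmeasurable F ->
  cintegral mu setT (fun x => F (x + a)) = cintegral mu setT F.
Proof.
move=> [F1 F2]; apply: complex_ext => /=.
  exact: (@Rintegral_shift (fun x => Re (F x))).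
exact: (@Rintegral_shift (fun x => Im (F x))).
Qed.

Lemma cintegral_opp F : cmeasurable F ->
  cintegral mu setT (fun x => F (- x)) = cintegral mu setT F.
Proof.
move=> [F1 F2]; apply: complex_ext => /=.
  exact: (@Rintegral_opp (fun x => Re (F x))).
exact: (@Rintegral_opp (fun x => Im (F x))).
Qed.

End line_integrals.

(** * Complex-valued functions of a real variable *)

Section complex_derivatives.
Context {R : realType}.
Implicit Types (F G : R -> R[i]) (x : R).

Definition is_cderive F x (D : R[i]) :=
  is_derive x (1 : R) (fun t => Re (F t)) (Re D) /\
  is_derive x (1 : R) (fun t => Im (F t)) (Im D).

Lemma is_cderive_eq F x D D' : is_cderive F x D -> D = D' -> is_cderive F x D'.
Proof. by move=> ? <-. Qed.

Lemma is_cderive_cst z x : is_cderive (fun=> z) x 0.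
Proof. by split; exact: is_derive_cst. Qed.

Lemma is_cderive_affine (z w : R[i]) x : is_cderive (fun t => z + t%:C * w) x w.
Proof.
have aff (a b : R) : is_derive x (1 : R) (fun t : R => a + t * b) b.
  have H := is_deriveD (is_derive_cst a x (1 : R))
    (is_deriveM (is_derive_id x (1 : R)) (is_derive_cst b x (1 : R))).
  by apply: is_derive_eq H _; rewrite /GRing.scale /=; ring.
split; first by under eq_fun do rewrite ReD ReM /= mul0r subr0; exact: aff.
by under eq_fun do rewrite ImD ImM /= mul0r addr0; exact: aff.
Qed.

Lemma is_cderiveM F G x DF DG : is_cderive F x DF -> is_cderive G x DG ->
  is_cderive (fun t => F t * G t) x (DF * G x + F x * DG).
Proof.
move=> [F1 F2] [G1 G2]; split.
  under eq_fun do rewrite ReM.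
  have H := is_deriveB (is_deriveM F1 G1) (is_deriveM F2 G2).
  apply: is_derive_eq H _; rewrite /GRing.scale /= ReD !ReM; ring.
under eq_fun do rewrite ImM.
have H := is_deriveD (is_deriveM F1 G2) (is_deriveM F2 G1).
apply: is_derive_eq H _; rewrite /GRing.scale /= ImD !ImM; ring.
Qed.

Lemma is_cderive_cexp F x D : is_cderive F x D ->
  is_cderive (fun t => cexp (F t)) x (D * cexp (F x)).
Proof.
move=> [F1 F2].
have E : is_derive x (1 : R) (fun t => expR (Re (F t))) (expR (Re (F x)) * Re D).
  exact: is_derive1_comp F1.
have C : is_derive x (1 : R) (fun t => cos (Im (F t))) (- sin (Im (F x)) * Im D).
  exact: is_derive1_comp F2.
have S : is_derive x (1 : R) (fun t => sin (Im (F t))) (cos (Im (F x)) * Im D).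
  exact: is_derive1_comp F2.
split.
  under eq_fun do rewrite Re_cexp.
  apply: is_derive_eq (is_deriveM E C) _.
  by rewrite /GRing.scale /= [RHS]ReM Re_cexp Im_cexp; ring.
under eq_fun do rewrite Im_cexp.
apply: is_derive_eq (is_deriveM E S) _.
by rewrite /GRing.scale /= [RHS]ImM Re_cexp Im_cexp; ring.
Qed.

Lemma is_cderiveV F x D : F x != 0 -> is_cderive F x D ->
  is_cderive (fun t => (F t)^-1) x (- D * (F x)^-1 ^+ 2).
Proof.
move=> Fx0 [F1 F2].
have n0 := ReImsq_gt0 Fx0.
have N := is_deriveD (is_deriveM F1 F1) (is_deriveM F2 F2).
have NE : ((fun t => Re (F t)) * (fun t => Re (F t)) + (fun t => Im (F t)) * (fun t => Im (F t)))%R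
  = (fun t => Re (F t) ^+ 2 + Im (F t) ^+ 2).
  by apply/funext => t; rewrite !expr2.
rewrite NE in N.
have V := is_deriveV (f := fun t => Re (F t) ^+ 2 + Im (F t) ^+ 2) (lt0r_neq0 n0) N.
have n0' : Re (F x) ^+ 2 + Im (F x) ^+ 2 != 0 by rewrite gt_eqF.
split.
  under eq_fun do rewrite ReV.
  apply: is_derive_eq (is_deriveM F1 V) _.
  rewrite /GRing.scale /= ReM ReN ImN expr2 ReM ImM ReV ImV.
  by field.
under eq_fun do rewrite ImV.
apply: is_derive_eq (is_deriveM (is_deriveN F2) V) _.
rewrite /GRing.scale /= ImM ReN ImN expr2 ReM ImM ReV ImV.
change ((- (fun t => Im (F t))) x) with (- Im (F x)).
by field.
Qed.

Lemma is_cderive_continuous F x D : is_cderive F x D ->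
  {for x, continuous (fun t => Re (F t))} /\ {for x, continuous (fun t => Im (F t))}.
Proof.
by move=> [F1 F2]; split; apply/differentiable_continuous/derivable1_diffP.
Qed.

End complex_derivatives.

(** * Harmonic sums *)

Section harmonic.
Context {R : realType}.
Implicit Types (t : R) (n : nat).

Lemma harmonic_bounds n :
  ln (n.+1%:R : R) <= \sum_(j < n.+1) (j.+1%:R)^-1 <= 1 + ln (n.+1%:R : R).
Proof.
have lb m : ln (m.+1%:R : R) <= \sum_(j < m) (j.+1%:R)^-1.
  elim: m => [|m IH]; first by rewrite big_ord0 ln1.
  rewrite big_ord_recr /=.
  rewrite (_ : m.+2%:R = m.+1%:R * (1 + (m.+1%:R)^-1) :> R); last first.
    by rewrite mulrDr mulr1 mulfV ?pnatr_eq0// natr1.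
  rewrite lnM ?posrE ?ltr0n// ?addr_gt0// ?invr_gt0 ?ltr0n//.
  rewrite lerD// le_ln1Dx// (lt_trans (ltrN10 _))// invr_gt0 ltr0n//.
apply/andP; split.
  rewrite (le_trans _ (lb n.+1))// ler_ln ?posrE ?ltr0n// ler_nat//.
elim: n => [|n IH]; first by rewrite big_ord1 ln1 invr1 addr0.
rewrite big_ord_recr /= (le_trans (lerD IH (lexx _)))// -addrA lerD2l.
have -> : n.+1%:R = n.+2%:R * (1 + - (n.+2%:R)^-1) :> R.
  by rewrite mulrDr mulr1 mulrN mulfV ?pnatr_eq0// -[in RHS]natr1 addrK.
have v1 : (n.+2%:R)^-1 < 1 :> R by rewrite invf_lt1 ?ltr0n// ltr1n.
rewrite lnM ?posrE ?ltr0n ?subr_gt0//.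
rewrite -addrA gerDl -lerBrDr sub0r le_ln1Dx//.
by rewrite ltrN2.
Qed.

Lemma sum_invsq_le n : \sum_(j < n) ((j.+1%:R : R)^-1) ^+ 2 <= 2.
Proof.
suff H m : \sum_(j < m.+1) ((j.+1%:R : R)^-1) ^+ 2 <= 2 - (m.+1%:R)^-1.
  case: n => [|n]; first by rewrite big_ord0.
  by rewrite (le_trans (H n))// gerBl invr_ge0.
elim: m => [|m IH]; first by rewrite big_ord1 invr1 expr1n; lra.
rewrite big_ord_recr /= (le_trans (lerD IH (lexx _)))//.
rewrite -addrA lerD2l -lerBrDl opprK -[X in _ <= X]addrC.
have a0 : 0 < m.+1%:R :> R by rewrite ltr0n.
have -> : m.+2%:R = m.+1%:R + 1 :> R by rewrite natr1.
move: (m.+1%:R) a0 => a a0.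
rewrite -subr_ge0 (_ : _ - _ = (a * (a + 1) ^+ 2)^-1); last by field; lra.
by rewrite invr_ge0 mulr_ge0 ?sqr_ge0// ltW.
Qed.

Lemma expR_le_1D t : 0 <= t -> expR (t - t ^+ 2) <= 1 + t.
Proof.
move=> t0; rewrite -[X in expR X]opprK expRN -[leRHS]invrK lef_pV2 ?posrE ?expR_gt0//; last first.
  by rewrite invr_gt0; lra.
apply: le_trans (expR_ge1Dx _).
rewrite -[leLHS]mul1r ler_pdivrMr; last lra.
rewrite -subr_ge0 (_ : _ - _ = t ^+ 3); last by ring.
by rewrite exprn_ge0.
Qed.

End harmonic.

(** * Integrals over segments *)

Section segments.
Context {R : realType}.
Local Notation mu := (@lebesgue_measure R).
Implicit Types (x : R).

(** Integrals over a segment are written as integrals over the line of a product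
    with this indicator, to which the theorems of Fubini and of dominated
    convergence on the whole line apply. *)
Definition seg (a b x : R) : R := (a <= x <= b)%R%:R.

Lemma seg_ge0 a b x : 0 <= seg a b x. Proof. by rewrite /seg ler0n. Qed.

Lemma seg_restrict a b (f : R -> R) : (fun x => seg a b x * f x) = f \_ `[a, b].
Proof.
apply/funext => x; rewrite patchE mem_setE in_itv /= /seg.
by case: (a <= x <= b); rewrite ?mul1r ?mul0r.
Qed.

Lemma seg_bound a b x (r M : R) : (a <= x <= b -> r <= M) -> seg a b x * r <= M * seg a b x.
Proof.
move=> H; rewrite /seg; case: (boolP (a <= x <= b)) => xc.
  by rewrite mul1r mulr1 H.
by rewrite mul0r mulr0.
Qed.

Lemma measurable_seg a b : measurable_fun setT (seg a b : measurableTypeR R -> R).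
Proof.
rewrite (_ : seg a b = \1_(`[a, b]%classic : set (measurableTypeR R))).
  exact: measurable_indic.
by apply/funext => u; rewrite indicE mem_setE in_itv.
Qed.

Lemma integrable_seg a b : mu.-integrable setT (EFin \o seg a b).
Proof.
have i1 := integrable_mull (expR (`|a| + `|b|)) (integrable_expRNabs (@ltr01 R)).
apply: integrable_dom i1 _ => [|x]; first exact: measurable_seg.
rewrite ger0_norm ?seg_ge0// mul1r /seg -expRD.
case: (boolP (a <= x <= b)) => [/andP[ax xb]|_]; last exact: expR_ge0.
rewrite -[leLHS]expR0 ler_expR subr_ge0.
by apply: normr_itv; rewrite ax xb.
Qed.

Lemma Rintegral_seg_FTC (f H : R -> R) a b : a < b ->
  (forall x, a <= x <= b -> {for x, continuous f}) ->
  (forall x, a <= x <= b -> is_derive x (1 : R) H (f x)) ->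
  \int[mu]_x (seg a b x * f x) = H b - H a.
Proof.
move=> ab cf dH.
rewrite (_ : \int[mu]_x _ = \int[mu]_(x in `[a, b]) f x); last first.
  rewrite [RHS]Rintegral_mkcond; apply: eq_Rintegral => x _.
  exact: (congr1 (fun h => h x) (seg_restrict a b f)).
have cH x : a <= x <= b -> {for x, continuous H}.
  by move=> xab; have ? := dH _ xab; apply/differentiable_continuous/derivable1_diffP.
rewrite /Rintegral (@continuous_FTC2 _ f H)//.
- apply: continuous_in_subspaceT => x /set_mem /=; rewrite in_itv/=; exact: cf.
- split.
  + by move=> x; rewrite in_itv/= => /andP[ax xb]; have [] := dH x _; rewrite ?ltW.
  + by apply: cvg_at_right_filter; apply: cH; rewrite lexx ltW.
  + by apply: cvg_at_left_filter; apply: cH; rewrite lexx ltW.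
- move=> x; rewrite in_itv/= => /andP[ax xb].
  have axb : a <= x <= b by rewrite !ltW.
  by have ? := dH x axb; rewrite derive1E derive_val.
Qed.

Definition ccontinuous_at (f : R -> R[i]) x :=
  {for x, continuous (fun t => Re (f t))} /\ {for x, continuous (fun t => Im (f t))}.

Lemma cintegral_seg_FTC (f H : R -> R[i]) a b : a < b ->
  (forall x, a <= x <= b -> ccontinuous_at f x) ->
  (forall x, a <= x <= b -> is_cderive H x (f x)) ->
  cintegral mu setT (fun x => (seg a b x)%:C * f x) = H b - H a.
Proof.
move=> ab cf dH; apply: complex_ext.
  have H1 := @Rintegral_seg_FTC _ (fun x => Re (H x)) a b ab
    (fun x xc => (cf x xc).1) (fun x xc => (dH x xc).1).
  rewrite ReD ReN -H1.
  by apply: eq_Rintegral => x _; rewrite [LHS]ReM /= mul0r subr0.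
have H1 := @Rintegral_seg_FTC _ (fun x => Im (H x)) a b ab
  (fun x xc => (cf x xc).2) (fun x xc => (dH x xc).2).
rewrite ImD ImN -H1.
by apply: eq_Rintegral => x _; rewrite [LHS]ImM /= mul0r addr0.
Qed.

End segments.

(** * Gauss's limit for Euler's integral *)

Section euler_gauss.
Context {R : realType}.
Local Notation mu := (@lebesgue_measure R).
Implicit Types (z w : R[i]) (x u : R).

(** Euler's integrand after the substitution [t = exp u]. *)
Definition euler_exp z u : R[i] := cexp (z * u%:C - (expR u)%:C).

Lemma measurable_Cid : cmeasurable (fun u : measurableTypeR R => u%:C).
Proof. by apply: cmeasurable_real. Qed.

Lemma measurable_euler_exp z : cmeasurable (euler_exp z).
Proof.
apply: cmeasurable_cexp; apply: cmeasurableD.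
  by apply: cmeasurableM; [exact: cmeasurable_cst|exact: measurable_Cid].
by apply: cmeasurableN; apply: cmeasurable_real; exact: measurable_expR.
Qed.

Lemma normc_euler_exp z u : normc (euler_exp z u) = expR (Re z * u - expR u).
Proof. by rewrite normc_cexp !ReImE /= mulr0 subr0. Qed.

(** The double exponential decay at plus infinity leaves only the pole of
    Euler's integrand at minus infinity, where [Re z > 0] is needed. *)
Lemma integrable_normc_euler_exp z : 0 < Re z ->
  mu.-integrable setT (EFin \o (fun u => expR (Re z * u - expR u))).
Proof.
move=> z0; set x := Re z.
have i1 := integrable_expRNabs z0.
(* For [u >= 0], [x u - exp u <= x u - u ^ 2 / 2 <= (x + 1) ^ 2 / 2 - u]. *)
have i2 := integrable_mull (expR ((x + 1) ^+ 2 / 2)) (integrable_expRNabs (@ltr01 R)).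
have i3 := integrableD measurableT i1 i2.
apply: integrable_dom i3 _ => [|u].
  by apply: measurableT_comp => //; apply: measurable_funB => //; exact: measurable_funM.
rewrite /= ger0_norm ?expR_ge0//.
have [u0|u0] := leP 0 u.
  rewrite ger0_norm// (@le_trans _ _ (expR ((x + 1) ^+ 2 / 2) * expR (- (1 * u))))//; last first.
    by rewrite lerDr expR_ge0.
  rewrite -expRD ler_expR.
  have := expR_ge1Dxn 1 u0; rewrite (_ : 2`!%:R = 2)// => H.
  have := sqr_ge0 (u - (x + 1)); rewrite sqrrB => H2.
  rewrite mul1r; lra.
rewrite ltr0_norm// (@le_trans _ _ (expR (- (x * - u))))//; last first.
  by rewrite lerDl mulr_ge0 ?expR_ge0.
by rewrite ler_expR mulrN opprK gerBl expR_ge0.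
Qed.

Lemma cintegrable_euler_exp z : 0 < Re z -> cintegrable mu (euler_exp z).
Proof.
move=> z0; apply: cintegrable_dom (integrable_normc_euler_exp z0) _.
  exact: measurable_euler_exp.
by move=> u; rewrite normc_euler_exp.
Qed.

Lemma Euler_integralE z : Euler_integral z = cintegral mu setT (euler_exp z).
Proof.
have cl t : 0 < t -> {for t, continuous (@ln R)} by move=> t0; exact: continuous_ln.
have ce (h : R -> R) t : {for t, continuous h} -> {for t, continuous (fun s => expR (h s))}.
  by move=> hc; apply: continuous_comp => //; exact: continuous_expR.
have cN t : {for t, continuous (fun s : R => expR (- s))}.
  by apply: ce; exact: continuousN.
have cz t : 0 < t -> {for t, continuous (fun s : R => expR ((Re z - 1) * ln s))}.
  by move=> t0; apply: ce; apply: cvgM; [exact: cvg_cst|exact: cl].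
have ci t : 0 < t -> {for t, continuous (fun s : R => Im z * ln s)}.
  by move=> t0; apply: cvgM; [exact: cvg_cst|exact: cl].
have E t : cpow t (z - 1) * (expR (- t))%:C =
    (expR ((Re z - 1) * ln t) * cos (Im z * ln t) * expR (- t)) +i*
    (expR ((Re z - 1) * ln t) * sin (Im z * ln t) * expR (- t)).
  rewrite /cpow; apply: complex_ext.
    by rewrite ReM Re_cexp /= !ReImE /= !mulr0 subr0 subr0 oppr0 addr0 add0r.
  by rewrite ImM Im_cexp /= !ReImE /= !mulr0 subr0 add0r oppr0 addr0 add0r.
have e1 u : Re (z * u%:C - (expR u)%:C) = Re z * u - expR u by rewrite !ReImE /=; ring.
have e2 u : Im (z * u%:C - (expR u)%:C) = Im z * u by rewrite !ReImE /=; ring.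
have e3 u : expR (Re z * u - expR u) = expR ((Re z - 1) * u) * expR (- expR u) * expR u.
  by rewrite -!expRD; congr expR; ring.
rewrite /Euler_integral /cintegral; congr (_ +i* _).
  under eq_Rintegral do rewrite E /=.
  rewrite Rintegral_expR.
    apply: eq_Rintegral => u _; rewrite expRK /euler_exp Re_cexp e1 e2 e3; ring.
  move=> t t0; apply: cvgM; last exact: cN.
  apply: cvgM; first exact: cz.
  by apply: (continuous_comp (ci _ t0)); exact: continuous_cos.
under eq_Rintegral do rewrite E /=.
rewrite Rintegral_expR.
  apply: eq_Rintegral => u _; rewrite expRK /euler_exp Im_cexp e1 e2 e3; ring.
move=> t t0; apply: cvgM; last exact: cN.
apply: cvgM; first exact: cz.
by apply: (continuous_comp (ci _ t0)); exact: continuous_sin.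
Qed.

Lemma measurable_indic_le (c : R) :
  measurable_fun setT (fun u : measurableTypeR R => ((u <= c)%R%:R : R)).
Proof.
rewrite (_ : (fun _ => _) = \1_(`]-oo, c]%classic : set (measurableTypeR R))).
  exact: measurable_indic.
by apply/funext => u; rewrite indicE mem_setE in_itv.
Qed.

(** Integrate over [-n, c] and let [n] grow. *)
Lemma cintegral_exp_Ny z c : 0 < Re z ->
  cintegrable mu (fun u => ((u <= c)%R%:R)%:C * cexp (z * u%:C)) /\
  cintegral mu setT (fun u => ((u <= c)%R%:R)%:C * cexp (z * u%:C)) = cexp (z * c%:C) / z.
Proof.
move=> z0; have zn0 : z != 0 by apply: Re_neq0; rewrite gt_eqF.
have mE : cmeasurable (fun u : measurableTypeR R => cexp (z * u%:C)).
  apply: cmeasurable_cexp; apply: cmeasurableM; first exact: cmeasurable_cst.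
  exact: measurable_Cid.
pose f u := ((u <= c)%R%:R : R)%:C * cexp (z * u%:C).
have mf : cmeasurable (f : measurableTypeR R -> _).
  by apply: cmeasurableM mE; apply: cmeasurable_real; exact: measurable_indic_le.
pose g u := expR (2 * Re z * `|c|) * expR (- (Re z * `|u|)).
have ig : mu.-integrable setT (EFin \o g) by apply: integrable_mull; exact: integrable_expRNabs.
have fg u : normc (f u) <= g u.
  rewrite /f normcM normc_real normc_cexp !ReImE /= mulr0 subr0 /g -expRD.
  case: (leP u c) => uc; last by rewrite normr0 mul0r expR_ge0.
  rewrite normr1 mul1r ler_expR -mulrN (mulrC 2) -mulrA -mulrDr ler_pM2l//.
  move: (ler_norm c) (normr_ge0 c); case: (leP 0 u) => u0; rewrite ?(ger0_norm u0) ?(ltr0_norm u0); lra.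
split; first exact: cintegrable_dom mf ig fg.
pose f_ (n : nat) u := (seg (- n%:R) c u)%:C * cexp (z * u%:C).
have L : ccvg (fun n => cintegral mu setT (f_ n)) (cintegral mu setT f).
  apply: (cintegral_cvg _ _ ig) => [n|u|n u].
  - by apply: cmeasurableM mE; apply: cmeasurable_real; exact: measurable_seg.
  - apply: ccvgM; last exact: ccvg_cst.
    apply: ccvg_real; apply: cvg_near_cst; near=> n.
    rewrite /seg (_ : - n%:R <= u)// lerNl (le_trans (ler_norm _))// normrN.
    by near: n; exact: nbhs_infty_ger.
  - apply: le_trans (fg u); rewrite /f_ /f (normc_realM _ (seg_ge0 _ _ _)) (normc_realM _ (ler0n _ _)).
    rewrite ler_wpM2r ?normc_ge0// /seg; case: (u <= c); last by rewrite andbF.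
    by rewrite ler_nat leq_b1.
pose G u := z^-1 * cexp (0 + u%:C * z).
have dG u : is_cderive G u (cexp (z * u%:C)).
  apply: is_cderive_eq.
    apply: is_cderiveM; first exact: is_cderive_cst.
    by apply: is_cderive_cexp; exact: is_cderive_affine.
  by rewrite mul0r !add0r mulrA mulVf// mul1r mulrC.
have cE u : ccontinuous_at (fun u => cexp (z * u%:C)) u.
  have E v : cexp (z * v%:C) = cexp (0 + v%:C * z) by rewrite add0r mulrC.
  rewrite (_ : (fun v => _) = fun v => cexp (0 + v%:C * z)); last by apply/funext.
  exact: is_cderive_continuous (is_cderive_cexp (is_cderive_affine 0 z u)).
have G0 : ccvg (fun n => G (- n%:R)) 0.
  apply: (ccvg0 (r := fun n => normc z^-1 * expR (- Re z) ^+ n)) => [n|].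
    rewrite /G normcM normc_cexp !ReImE /= add0r mul0r subr0 -expRM_natl.
    by rewrite mulNr mulrN.
  have H : normc z^-1 * expR (- Re z) ^+ n @[n --> \oo] --> normc z^-1 * 0.
    apply: cvgM; first exact: cvg_cst.
    by apply: cvg_expr; rewrite ger0_norm ?expR_ge0// expR_lt1 oppr_lt0.
  by rewrite mulr0 in H.
have L' : ccvg (fun n => cintegral mu setT (f_ n)) (G c - 0).
  apply: ccvg_near (ccvgD (ccvg_cst (G c)) (ccvgN G0)); near=> n.
  have nc : - n%:R < c.
    rewrite ltrNl (le_lt_trans (ler_norm _))// normrN.
    by near: n; exact: nbhs_infty_gtr.
  exact: esym (cintegral_seg_FTC nc (fun u _ => cE u) (fun u _ => dG u)).
by rewrite (ccvg_unique L L') subr0 /G add0r mulrC (mulrC z).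
Unshelve. all: by end_near. Qed.

(** Euler's integrand with [exp (- t)] replaced by [(1 - t / N) ^ k] on [0, N],
    again in the variable [u = ln t]. *)
Definition gauss_integrand (N : R) k z u : R[i] :=
  ((u <= ln N)%R%:R * (1 - expR u / N) ^+ k)%:C * cexp (z * u%:C).

(** By induction on [k]: expanding one factor of [(1 - exp u / N) ^ (k + 1)] shifts
    [z] to [z + 1]. *)
Lemma gauss_integral (N : R) k z : 0 < N -> 0 < Re z ->
  cintegrable mu (gauss_integrand N k z) /\
  cintegral mu setT (gauss_integrand N k z) =
    cexp (z * (ln N)%:C) * (k`!%:R / \prod_(j < k.+1) (z + j%:R)).
Proof.
move=> N0; elim: k z => [|k IH] z z0.
  have -> : gauss_integrand N 0 z = fun u => ((u <= ln N)%R%:R)%:C * cexp (z * u%:C).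
    by apply/funext => u; rewrite /gauss_integrand expr0 mulr1.
  have [H1 H2] := cintegral_exp_Ny (ln N) z0; split => //.
  by rewrite H2 big_ord1 addr0 fact0 mul1r.
have z1 : 0 < Re (z + 1) by rewrite ReD /= addr_gt0.
have [i1 e1] := IH z z0; have [i2 e2] := IH _ z1.
have E u : gauss_integrand N k.+1 z u =
    gauss_integrand N k z u - (N^-1)%:C * gauss_integrand N k (z + 1) u.
  rewrite /gauss_integrand mulrDl mul1r cexpD cexp_real exprS !rmorphM rmorphB rmorph1 /= rmorphM /=.
  ring.
have i3 := cintegrableZl (N^-1)%:C i2.
split.
  apply: eq_cintegrable (cintegrableB i1 i3) => u; exact/esym/E.
have -> : cintegral mu setT (gauss_integrand N k.+1 z) =
    cintegral mu setT (fun u => gauss_integrand N k z u -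
      (N^-1)%:C * gauss_integrand N k (z + 1) u) by exact: eq_cintegral.
rewrite cintegralB// cintegralZl// e1 e2.
have -> : cexp ((z + 1) * (ln N)%:C) = cexp (z * (ln N)%:C) * N%:C.
  by rewrite mulrDl mul1r cexpD cexp_real lnK.
rewrite mulrA (_ : (N^-1)%:C * _ = cexp (z * (ln N)%:C)); last first.
  by rewrite mulrCA -rmorphM mulVf ?gt_eqF// mulr1.
rewrite -mulrBr; congr (_ * _).
rewrite [in LHS]big_ord_recl /= [X in _ - _ / X]big_ord_recr /=.
rewrite [in RHS]big_ord_recl [X in _ = _ / (_ * X)]big_ord_recr /= addr0.
have -> : \prod_(i < k) (z + (bump 0 i)%:R) = \prod_(i < k) (z + 1 + i%:R).
  by apply: eq_bigr => i _; rewrite /bump /= add1n -natr1 (addrC i%:R) addrA.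
have -> : z + (bump 0 k)%:R = z + 1 + k%:R.
  by rewrite /bump /= add1n -natr1 (addrC k%:R) addrA.
have P0 : \prod_(i < k) (z + 1 + i%:R) != 0.
  apply/prodf_neq0 => i _; apply: Re_neq0; rewrite !ReImE /= gt_eqF//.
  by rewrite ltr_wpDr// addr_gt0.
have zn0 : z != 0 by apply: Re_neq0; rewrite gt_eqF.
have zk0 : z + 1 + k%:R != 0.
  by apply: Re_neq0; rewrite !ReImE /= gt_eqF// ltr_wpDr// addr_gt0.
rewrite factS natrM; move: (\prod_(i < k) _) P0 => P P0.
rewrite -natr1; move: (k%:R : R[i]) zk0 => kk zk0.
field.
by rewrite ?zn0 ?P0 ?zk0.
Qed.

Lemma expR_pow_bounds (w : R) n : 0 <= w -> w <= n.+1%:R ->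
  expR (- w) * (1 - w ^+ 2 / n.+1%:R) <= (1 - w / n.+1%:R) ^+ n.+1 <= expR (- w).
Proof.
move=> w0 wn; set t := w / n.+1%:R.
have N0 : 0 < n.+1%:R :> R by rewrite ltr0n.
have t0 : 0 <= t by rewrite divr_ge0.
have t1 : t <= 1 by rewrite ler_pdivrMr// mul1r.
have wE : w = n.+1%:R * t by rewrite /t mulrCA mulfV ?mulr1// gt_eqF.
clearbody t.
apply/andP; split; last first.
  rewrite wE -mulrN expRM_natl lerXn2r ?nnegrE ?subr_ge0 ?expR_ge0//.
  exact: expR_ge1Dx.
have H : 1 - w ^+ 2 / n.+1%:R <= ((1 - t) * expR t) ^+ n.+1.
  have B : 1 - t ^+ 2 <= (1 - t) * expR t.
    rewrite (_ : 1 - t ^+ 2 = (1 - t) * (1 + t)); last by ring.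
    by rewrite ler_wpM2l ?subr_ge0// expR_ge1Dx.
  have B0 : 0 <= 1 - t ^+ 2 by rewrite subr_ge0 expr_le1.
  apply: le_trans (_ : (1 - t ^+ 2) ^+ n.+1 <= _); last first.
    by rewrite lerXn2r ?nnegrE// (le_trans B0).
  have -> : w ^+ 2 / n.+1%:R = t ^+ 2 *+ n.+1.
    by rewrite wE -[RHS]mulr_natl; field; rewrite gt_eqF.
  have BI (s : R) m : 0 <= s <= 1 -> 1 - s *+ m <= (1 - s) ^+ m.
    move=> /andP[s0 s1]; elim: m => [|m IH]; first by rewrite mulr0n subr0 expr0.
    rewrite exprS (le_trans _ (ler_wpM2l _ IH)) ?subr_ge0//.
    rewrite -subr_ge0 (_ : _ - _ = s * (s *+ m)); last by rewrite mulrSr; ring.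
    by rewrite mulr_ge0// mulrn_wge0.
  by apply: BI; rewrite sqr_ge0/= expr_le1.
rewrite mulrC; apply: le_trans (ler_wpM2r (expR_ge0 _) H) _.
by rewrite exprMn -mulrA -expRM_natl -wE -expRD subrr expR0 mulr1.
Qed.

(** Gauss's limit formula, by dominated convergence from
    [(1 - t / N) ^ N --> exp (- t)]. *)
Lemma gauss_cvg z : 0 < Re z ->
  ccvg (fun n => cexp (z * (ln n.+1%:R)%:C) *
    (n.+1`!%:R / \prod_(j < n.+2) (z + j%:R))) (Euler_integral z).
Proof.
move=> z0; rewrite Euler_integralE.
pose f_ n := gauss_integrand (n.+1%:R) n.+1 z.
have -> : (fun n => cexp (z * (ln n.+1%:R)%:C) *
    (n.+1`!%:R / \prod_(j < n.+2) (z + j%:R))) = fun n => cintegral mu setT (f_ n).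
  by apply/funext => n; rewrite /f_ (gauss_integral _ _ z0).2.
have le_ln n u : (u <= ln (n.+1%:R : R)) = (expR u <= n.+1%:R).
  by rewrite -ler_expR lnK// posrE ltr0n.
pose r n u : R := (u <= ln n.+1%:R)%R%:R * (1 - expR u / n.+1%:R) ^+ n.+1.
have rE n u : 0 <= r n u <= expR (- expR u) /\
    (expR u <= n.+1%:R -> expR (- expR u) * (1 - expR u ^+ 2 / n.+1%:R) <= r n u).
  rewrite /r le_ln; case: (leP (expR u) n.+1%:R) => h; last by rewrite mul0r lexx expR_ge0.
  have /andP[h1 h2] := expR_pow_bounds (expR_ge0 u) h.
  rewrite mul1r h1 h2; split => //; rewrite andbT exprn_ge0// subr_ge0.
  by rewrite ler_pdivrMr ?ltr0n// mul1r.
have eE u : euler_exp z u = (expR (- expR u))%:C * cexp (z * u%:C).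
  by rewrite /euler_exp addrC -rmorphN cexpD cexp_real.
apply: (cintegral_cvg _ _ (integrable_normc_euler_exp z0)).
- move=> n; apply: cmeasurableM.
    apply: cmeasurable_real; apply: measurable_funM; first exact: measurable_indic_le.
    apply: measurable_funX; apply: measurable_funB => //.
    by apply: measurable_funM => //.
  apply: cmeasurable_cexp; apply: cmeasurableM; first exact: cmeasurable_cst.
  exact: measurable_Cid.
- move=> u; rewrite eE; apply: ccvgM; last exact: ccvg_cst.
  apply: ccvg_real.
  apply: (squeeze_cvgr (_ : \forall n \near \oo,
    expR (- expR u) * (1 - expR u ^+ 2 / n.+1%:R) <= r n u <= expR (- expR u))).
  + near=> n; have [/andP[_ ->] ->//] := rE n u.
    rewrite (@le_trans _ _ (n%:R))// ?ler_nat//.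
    by near: n; exact: nbhs_infty_ger.
  + have : expR (- expR u) * (1 - expR u ^+ 2 / n.+1%:R) @[n --> \oo] -->
        expR (- expR u) * (1 - expR u ^+ 2 * 0).
      apply: cvgM; first exact: cvg_cst.
      apply: cvgB; first exact: cvg_cst.
      by apply: cvgM; [exact: cvg_cst|exact: cvg_harmonic].
    by rewrite mulr0 subr0 mulr1.
  + exact: cvg_cst.
- move=> n u; have [/andP[r0 r1] _] := rE n u.
  rewrite normcM normc_real ger0_norm// normc_cexp !ReImE /= mulr0 subr0.
  have -> : expR (Re z * u - expR u) = expR (- expR u) * expR (Re z * u).
    by rewrite -expRD addrC.
  by rewrite ler_wpM2r ?expR_ge0.
Unshelve. all: by end_near. Qed.

End euler_gauss.

(** * The reciprocal of the Gamma function *)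

Section reciprocal_gamma.
Context {R : realType}.
Implicit Types (z w : R[i]) (x u : R) (n : nat).

(** The reciprocal of Gauss's product: an entire function of [z], hence free of
    the poles of Gamma. *)
Definition gauss_inv n z : R[i] :=
  (\prod_(j < n.+2) (z + j%:R)) / n.+1`!%:R * cexp (- (z * (ln n.+1%:R)%:C)).

Lemma gauss_invE n z : gauss_inv n z =
  z * \prod_(j < n.+1) (1 + z / j.+1%:R) * cexp (- (z * (ln n.+1%:R)%:C)).
Proof.
rewrite /gauss_inv; congr (_ * _); rewrite big_ord_recl /= addr0 -mulrA; congr (_ * _).
rewrite fact_prod big_add1 big_mkord natr_prod -prodfV -big_split /=.
apply: eq_bigr => i _; rewrite /bump /= add1n.
by rewrite mulrDl mulfV ?pnatr_eq0// addrC.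
Qed.

Lemma normc_gauss_inv n z : normc (gauss_inv n z) =
  normc z * \prod_(j < n.+1) normc (1 + z / j.+1%:R) * expR (- (Re z * ln n.+1%:R)).
Proof.
by rewrite gauss_invE 2!normcM normc_prod normc_cexp !ReImE /= mulr0 subr0.
Qed.

Lemma normc_1Ddiv z (j : nat) :
  normc (1 + z / j.+1%:R) ^+ 2 = 1 + 2 * Re z * (j.+1%:R)^-1 + normc z ^+ 2 * (j.+1%:R)^-1 ^+ 2.
Proof.
have -> : z / j.+1%:R = (j.+1%:R^-1)%:C * z by rewrite mulrC fmorphV rmorph_nat.
rewrite !sqr_normcE !ReImE /=; ring.
Qed.

(** As [|1 + z / j| ^ 2 <= exp (2 x / j + |z| ^ 2 / j ^ 2)], the logarithm of the
    product is at most [x] times a harmonic sum plus a bounded term, and the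
    power of [n] compensates the former. *)
Lemma gauss_inv_le n z :
  normc (gauss_inv n z) <= normc z * expR (`|Re z| + normc z ^+ 2).
Proof.
rewrite normc_gauss_inv -mulrA ler_wpM2l ?normc_ge0//.
set x := Re z.
have H j : normc (1 + z / j.+1%:R) <=
    expR (x * (j.+1%:R)^-1 + normc z ^+ 2 / 2 * ((j.+1%:R)^-1) ^+ 2).
  rewrite -(@ler_pXn2r _ 2)// ?nnegrE ?normc_ge0 ?expR_ge0//.
  rewrite normc_1Ddiv -expRM_natl; apply: le_trans (expR_ge1Dx _).
  by rewrite /x; move: (j.+1%:R^-1) => v; lra.
apply: le_trans (_ : (\prod_(j < n.+1) expR (x * (j.+1%:R)^-1 +
    normc z ^+ 2 / 2 * ((j.+1%:R)^-1) ^+ 2)) * expR (- (x * ln n.+1%:R)) <= _).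
  rewrite ler_wpM2r ?expR_ge0// ler_prod// => j _.
  by rewrite normc_ge0 H.
rewrite -expR_sum -expRD ler_expR big_split /= -!mulr_sumr.
have /andP[h1 h2] := harmonic_bounds (R := R) n.
have h3 := sum_invsq_le (R := R) n.+1.
have h4 : normc z ^+ 2 / 2 * (\sum_(j < n.+1) (j.+1%:R)^-1 ^+ 2) <= normc z ^+ 2.
  rewrite -mulrA -[leRHS]mulr1 ler_wpM2l ?sqr_ge0// mulrC ler_pdivrMr// mul1r//.
have h5 : x * (\sum_(j < n.+1) (j.+1%:R)^-1) - x * ln n.+1%:R <= `|x|.
  rewrite -mulrBr (le_trans (ler_norm _))// normrM -[leRHS]mulr1 ler_wpM2l//.
  by rewrite ger0_norm ?subr_ge0// lerBlDr.
lra.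
Qed.

Lemma gauss_inv_ge n z : 0 < Re z ->
  Re z * expR (- (2 * Re z ^+ 2)) <= normc (gauss_inv n z).
Proof.
move=> x0; rewrite normc_gauss_inv -mulrA; set x := Re z in x0 *.
have xz : x <= normc z by rewrite (le_trans (ler_norm _))// normr_Re.
apply: ler_pM => //; rewrite ?expR_ge0 ?(ltW x0)//.
have H j : expR (x * (j.+1%:R)^-1 - x ^+ 2 * ((j.+1%:R)^-1) ^+ 2) <= normc (1 + z / j.+1%:R).
  rewrite -exprMn (le_trans (expR_le_1D _))//; first by rewrite mulr_ge0// ltW.
  have -> : 1 + x * (j.+1%:R)^-1 = Re (1 + z / j.+1%:R).
    have -> : z / j.+1%:R = (j.+1%:R^-1)%:C * z by rewrite mulrC fmorphV rmorph_nat.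
    by rewrite !ReImE /=; rewrite -/x; ring.
  by rewrite (le_trans (ler_norm _))// normr_Re.
apply: le_trans (_ : _ <= (\prod_(j < n.+1) expR (x * (j.+1%:R)^-1 -
    x ^+ 2 * ((j.+1%:R)^-1) ^+ 2)) * expR (- (x * ln n.+1%:R))) _; last first.
  rewrite ler_wpM2r ?expR_ge0// ler_prod// => j _.
  by rewrite expR_ge0 H.
rewrite -expR_sum -expRD ler_expR big_split /= sumrN -!mulr_sumr.
have /andP[h1 h2] := harmonic_bounds (R := R) n.
have h3 := sum_invsq_le (R := R) n.+1.
have h4 : x ^+ 2 * (\sum_(j < n.+1) (j.+1%:R)^-1 ^+ 2) <= x ^+ 2 * 2.
  by rewrite ler_wpM2l ?sqr_ge0.
have h5 : 0 <= x * (\sum_(j < n.+1) (j.+1%:R)^-1) - x * ln n.+1%:R.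
  by rewrite -mulrBr mulr_ge0 ?subr_ge0// ltW.
lra.
Qed.

Lemma gauss_inv_shift n z : z + n.+2%:R != 0 ->
  gauss_inv n z = gauss_inv n (z + 1) * z * (n.+1%:R / (z + n.+2%:R)).
Proof.
move=> zn0; rewrite /gauss_inv.
have -> : cexp (- ((z + 1) * (ln n.+1%:R)%:C)) =
    cexp (- (z * (ln n.+1%:R)%:C)) / n.+1%:R.
  rewrite mulrDl mul1r opprD cexpD cexpN; congr (_ * _); rewrite cexpN cexp_real.
  by rewrite lnK ?posrE ?ltr0n// rmorph_nat.
rewrite big_ord_recl [X in _ = X / _ * _ * _ * _]big_ord_recr /= addr0.
have -> : \prod_(i < n.+1) (z + (bump 0 i)%:R) = \prod_(i < n.+1) (z + 1 + i%:R).
  by apply: eq_bigr => i _; rewrite /bump /= add1n -natr1 (addrC i%:R) addrA.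
have e : z + 1 + n.+1%:R = z + n.+2%:R by rewrite -addrA nat1r.
rewrite e; move: (\prod_(i < _) _) => P; move: (cexp _) => c.
have f0 : n.+1`!%:R != 0 :> R[i] by rewrite pnatr_eq0 -lt0n fact_gt0.
have n0 : n.+1%:R != 0 :> R[i] by rewrite pnatr_eq0.
move: (n.+2%:R : R[i]) (n.+1`!%:R : R[i]) (n.+1%:R : R[i]) f0 n0 zn0 => a f N f0 n0 zn0.
by field; rewrite f0 n0 zn0.
Qed.

Lemma Euler_integral_neq0 z : 0 < Re z -> Euler_integral z != 0.
Proof.
move=> z0; have H := gauss_cvg z0.
rewrite -normc_gt0.
pose C := normc z * expR (`|Re z| + normc z ^+ 2).
have C0 : 0 < C.
  by rewrite mulr_gt0 ?expR_gt0// normc_gt0; apply: Re_neq0; rewrite gt_eqF.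
apply: (@lt_le_trans _ _ C^-1); first by rewrite invr_gt0.
apply: (cvgr_to_ge (ccvg_normc H)).
apply: nearW => n.
have E : cexp (z * (ln n.+1%:R)%:C) * (n.+1`!%:R / \prod_(j < n.+2) (z + j%:R)) =
    (gauss_inv n z)^-1.
  by rewrite /gauss_inv cexpN !invfM !invrK mulrC (mulrC n.+1`!%:R).
rewrite E normcV lef_pV2 ?posrE ?gauss_inv_le//.
rewrite (lt_le_trans _ (gauss_inv_ge n z0))// mulr_gt0 ?expR_gt0//.
Qed.

Lemma gauss_inv_cvg_Euler z : 0 < Re z ->
  ccvg (fun n => gauss_inv n z) (Euler_integral z)^-1.
Proof.
move=> z0; have := ccvgV (Euler_integral_neq0 z0) (gauss_cvg z0).
congr ccvg; apply/funext => n.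
rewrite /gauss_inv cexpN !invfM !invrK [LHS]mulrC; congr (_ * _).
by rewrite mulrC.
Qed.

Lemma ccvg_ratio z : ccvg (fun n => n.+1%:R / (z + n.+2%:R)) (1 : R[i]).
Proof.
have H : ccvg (fun n => (z + 1) * (n.+1%:R^-1)%:C + 1) ((z + 1) * 0%:C + 1).
  apply: ccvgD; last exact: ccvg_cst.
  apply: ccvgM; first exact: ccvg_cst.
  by apply: ccvg_real; exact: cvg_harmonic.
rewrite mulr0 add0r in H.
have := ccvgV (oner_neq0 _) H; rewrite invr1; congr ccvg; apply/funext => n.
have n0 : n.+1%:R != 0 :> R[i] by rewrite pnatr_eq0.
have -> : (z + 1) * (n.+1%:R^-1)%:C + 1 = (z + 1 + n.+1%:R) / n.+1%:R.
  by rewrite fmorphV rmorph_nat [RHS]mulrDl mulfV.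
by rewrite invfM invrK mulrC -addrA nat1r.
Qed.

Lemma near_addn_neq0 z : \forall n \near \oo, z + n.+2%:R != 0.
Proof.
near=> n; apply: Re_neq0; rewrite !ReImE gt_eqF//.
rewrite -ltrBlDl sub0r (le_lt_trans (ler_norm _))// normrN (@le_lt_trans _ _ n%:R)//.
  by near: n; exact: nbhs_infty_ger.
by rewrite ltr_nat ltnS leqnSn.
Unshelve. all: by end_near. Qed.

Lemma gauss_inv_cvg_shift z k l : ccvg (fun n => gauss_inv n (z + k%:R)) l ->
  ccvg (fun n => gauss_inv n z) (l * \prod_(j < k) (z + j%:R)).
Proof.
elim: k z l => [|k IH] z l; first by rewrite addr0 big_ord0 mulr1.
rewrite -natr1 (addrC k%:R) addrA => /IH H.
rewrite big_ord_recl addr0 [z * _]mulrC mulrA.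
have -> : \prod_(i < k) (z + (lift ord0 i)%:R) = \prod_(j < k) (z + 1 + j%:R).
  by apply: eq_bigr => i _; rewrite /= /bump /= add1n -natr1 (addrC i%:R) addrA.
have H2 := ccvgM (ccvgM H (ccvg_cst z)) (ccvg_ratio z).
rewrite mulr1 in H2; apply: ccvg_near H2.
by apply: filterS (near_addn_neq0 z) => n zn; rewrite -gauss_inv_shift.
Qed.

(** For [Re z > 0] this is Gauss's limit. The functional equation, which
    [gauss_inv n] satisfies up to a factor tending to 1, carries it to the left
    half-plane, poles of Gamma included. *)
Lemma gauss_inv_cvg z : ccvg (fun n => gauss_inv n z) (Gamma z)^-1.
Proof.
rewrite /Gamma; set n0 := (if _ then _ else _).
rewrite invfM invrK; apply: gauss_inv_cvg_shift; apply: gauss_inv_cvg_Euler.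
rewrite !ReImE /n0; case: ifPn => [|_]; first by rewrite addr0.
by rewrite -ltrBlDl sub0r truncnS_gt.
Qed.

Lemma GammaE z : 0 < Re z -> Gamma z = Euler_integral z.
Proof. by move=> z0; rewrite /Gamma z0 big_ord0 addr0 divr1. Qed.

Lemma Gamma_neq0 z : 0 < Re z -> Gamma z != 0.
Proof. by move=> z0; rewrite GammaE// Euler_integral_neq0. Qed.

Lemma GammaV_shift z : (Gamma z)^-1 = (Gamma (z + 1))^-1 * z.
Proof.
have := @gauss_inv_cvg_shift z 1 _ (gauss_inv_cvg _).
by rewrite big_ord1 addr0 => /(ccvg_unique (gauss_inv_cvg z)) ->.
Qed.

Lemma gauss_cvg_Gamma z : 0 < Re z -> ccvg (fun n => (gauss_inv n z)^-1) (Gamma z).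
Proof.
move=> z0; rewrite -[Gamma z]invrK; apply: ccvgV (gauss_inv_cvg z).
by rewrite invr_neq0// Gamma_neq0.
Qed.

End reciprocal_gamma.

(** * Stirling's bounds on vertical strips *)

Section stirling.
Context {R : realType}.
Implicit Types (x y u v t : R) (n k : nat).

(** [log_mod y u] is [ln |u + i y|] and [log_mod_prim y] an antiderivative of it: the
    logarithm of the modulus of a Gauss product is a sum of such terms. *)
Definition log_mod y u : R := ln (u ^+ 2 + y ^+ 2) / 2.
Definition log_mod_prim y u : R := u * log_mod y u - u + y * atan (u / y).

Lemma sq_sum_gt0 u y : 0 < y -> 0 < u ^+ 2 + y ^+ 2.
Proof. by move=> y0; rewrite ltr_wpDl ?sqr_ge0// exprn_gt0. Qed.

Lemma is_derive_log_mod y u : 0 < y ->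
  is_derive u (1 : R) (log_mod y) (u / (u ^+ 2 + y ^+ 2)).
Proof.
move=> y0; have s0 := sq_sum_gt0 u y0.
have H1 : is_derive u (1 : R) (fun v : R => v ^+ 2 + y ^+ 2) (2 * u).
  have H := is_deriveD (is_deriveM (is_derive_id u (1 : R)) (is_derive_id u (1 : R)))
    (is_derive_cst (y ^+ 2) u (1 : R)).
  have -> : (fun v : R => v ^+ 2 + y ^+ 2) = (id * id + cst (y ^+ 2))%R.
    by apply/funext => v; rewrite expr2.
  by apply: is_derive_eq H _; rewrite /GRing.scale /=; ring.
have H2 := is_derive1_comp (g := fun v => v ^+ 2 + y ^+ 2) (is_derive1_ln s0) H1.
have H3 := is_deriveM H2 (is_derive_cst (2^-1 : R) u (1 : R)).
apply: is_derive_eq H3 _; rewrite /GRing.scale /=; field.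
by rewrite gt_eqF.
Qed.

Lemma is_derive_log_mod_prim y u : 0 < y ->
  is_derive u (1 : R) (log_mod_prim y) (log_mod y u).
Proof.
move=> y0; have s0 := sq_sum_gt0 u y0.
have H1 : is_derive u (1 : R) (fun v : R => v / y) y^-1.
  have H := is_deriveM (is_derive_id u (1 : R)) (is_derive_cst (y^-1) u (1 : R)).
  by apply: is_derive_eq H _; rewrite /GRing.scale /=; ring.
have H2 := is_derive1_comp (g := fun v => v / y) (is_derive1_atan (u / y)) H1.
have H3 := is_deriveM (is_derive_cst y u (1 : R)) H2.
have H4 := is_deriveM (is_derive_id u (1 : R)) (is_derive_log_mod u y0).
have H5 := is_deriveD (is_deriveB H4 (is_derive_id u (1 : R))) H3.
apply: is_derive_eq H5 _; rewrite /GRing.scale /=; field.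
have e : y ^+ 2 + u ^+ 2 = u ^+ 2 + y ^+ 2 by rewrite addrC.
by rewrite ?e !gt_eqF.
Qed.

Lemma is_derive_continuous (f df : R -> R) : (forall u, is_derive u (1 : R) f (df u)) ->
  continuous f.
Proof. by move=> H u; apply/differentiable_continuous/derivable1_diffP. Qed.

Lemma mvt (f df : R -> R) (a b : R) : a < b -> (forall u, is_derive u (1 : R) f (df u)) ->
  exists2 c, a < c < b & f b - f a = df c * (b - a).
Proof.
move=> ab H; have [|c] := @MVT R f df a b ab.
- by apply: continuous_subspaceT; exact: is_derive_continuous H.
- by rewrite in_itv/= => ? ?; exists c.
Qed.

Lemma log_mod_deriv_lip y u (a b : R) : 0 < y -> 0 <= u -> u <= a -> u <= b ->
  `|a - b| <= 1 ->
  `|a / (a ^+ 2 + y ^+ 2) - b / (b ^+ 2 + y ^+ 2)| <= (u ^+ 2 + y ^+ 2)^-1.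
Proof.
move=> y0 u0 ua ub ab.
have sa := sq_sum_gt0 a y0; have sb := sq_sum_gt0 b y0; have su := sq_sum_gt0 u y0.
have -> : a / (a ^+ 2 + y ^+ 2) - b / (b ^+ 2 + y ^+ 2) =
    (a - b) * (y ^+ 2 - a * b) / ((a ^+ 2 + y ^+ 2) * (b ^+ 2 + y ^+ 2)).
  by field; rewrite !gt_eqF.
rewrite normrM normrM normfV (gtr0_norm (mulr_gt0 sa sb)).
rewrite ler_pdivrMr ?mulr_gt0// [leRHS]mulrC ler_pdivlMr//.
apply: le_trans (_ : (1 * (y ^+ 2 + a * b)) * (u ^+ 2 + y ^+ 2) <= _).
  rewrite ler_wpM2r ?(ltW su)// ler_pM//.
  rewrite (le_trans (ler_normB _ _))// ger0_norm ?sqr_ge0// lerD2l normrM !ger0_norm//; lra.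
rewrite mul1r.
have ab0 : 0 <= a /\ 0 <= b by split; lra.
case: ab0 => a0 b0.
have su' (c : R) : u <= c -> u ^+ 2 + y ^+ 2 <= c ^+ 2 + y ^+ 2.
  by move=> uc; rewrite lerD2r lerXn2r// nnegrE; lra.
have [le_ab|le_ba] := leP a b.
  rewrite mulrC ler_pM// ?su' ?(ltW su)//; first by rewrite addr_ge0 ?sqr_ge0 ?mulr_ge0.
  by rewrite addrC lerD2r expr2 ler_wpM2r.
rewrite [leRHS]mulrC mulrC ler_pM// ?su' ?(ltW su)//; first by rewrite addr_ge0 ?sqr_ge0 ?mulr_ge0.
by rewrite addrC lerD2r expr2 ler_wpM2l// ltW.
Qed.

(** The error, as a function of the step [t], has the derivative
    [(t f'(e) - t f'(u + t)) / 2] for some [e] between [u] and [u + t], where [f'] is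
    Lipschitz with the constant [1 / (u ^ 2 + y ^ 2)]. *)
Lemma trapezoid_error y u : 0 < y -> 0 <= u ->
  `|log_mod_prim y (u + 1) - log_mod_prim y u - (log_mod y u + log_mod y (u + 1)) / 2|
    <= (u ^+ 2 + y ^+ 2)^-1 / 2.
Proof.
move=> y0 u0.
pose df v := v / (v ^+ 2 + y ^+ 2).
pose g t := log_mod_prim y (u + t) - log_mod_prim y u - t * (log_mod y u + log_mod y (u + t)) / 2.
pose dg t := (log_mod y (u + t) - log_mod y u - t * df (u + t)) / 2.
have dshift (h dh : R -> R) t : (forall v, is_derive v (1 : R) h (dh v)) ->
    is_derive t (1 : R) (fun s : R => h (u + s)) (dh (u + t)).
  move=> H; have D : is_derive t (1 : R) (fun s : R => u + s) 1.
    have H0 := is_deriveD (is_derive_cst u t (1 : R)) (is_derive_id t (1 : R)).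
    by apply: is_derive_eq H0 _; rewrite add0r.
  by apply: is_derive_eq (is_derive1_comp (H (u + t)) D) _; rewrite mulr1.
have dgP t : is_derive t (1 : R) g (dg t).
  have A := dshift _ _ t (fun v => is_derive_log_mod_prim v y0).
  have B := dshift _ _ t (fun v => is_derive_log_mod v y0).
  have C := is_deriveB A (is_derive_cst (log_mod_prim y u) t (1 : R)).
  have D := is_deriveM (is_derive_id t (1 : R)) (is_deriveD (is_derive_cst (log_mod y u) t (1 : R)) B).
  have E := is_deriveB C (is_deriveM D (is_derive_cst (2^-1 : R) t (1 : R))).
  apply: is_derive_eq E _; rewrite /GRing.scale /= !fctE /= /dg /df.
  lra.
have [c /andP[c0 c1] gE] := mvt (@ltr01 R) dgP.
have g0 : g 0 = 0 by rewrite /g !addr0 subrr mul0r mul0r subr0.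
have -> : log_mod_prim y (u + 1) - log_mod_prim y u - (log_mod y u + log_mod y (u + 1)) / 2 = dg c.
  by move: gE; rewrite g0 !subr0 mulr1 => <-; rewrite /g mul1r.
have ucu : u < u + c by rewrite ltrDl.
have [e /andP[ue ec] fE] := mvt ucu (fun v => is_derive_log_mod v y0).
have -> : dg c = c * (df e - df (u + c)) / 2.
  by rewrite /dg fE (_ : u + c - u = c) /df; [lra|lra].
rewrite normrM normrM [`|2^-1|]gtr0_norm// ler_wpM2r// (gtr0_norm c0).
apply: le_trans (_ : 1 * (u ^+ 2 + y ^+ 2)^-1 <= _); last by rewrite mul1r.
rewrite ler_pM ?(ltW c0) ?(ltW c1)//.
apply: log_mod_deriv_lip => //; [exact: ltW|exact: ltW|].
by rewrite ler_norml; apply/andP; split; lra.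
Qed.

(** The errors of the unit steps sum to a bound that is uniform in [y >= 1]. *)
Lemma trapezoid_sum y x n : 1 <= y -> 0 <= x ->
  `|\sum_(k < n.+1) log_mod y (x + k%:R) - (log_mod_prim y (x + n%:R) - log_mod_prim y x +
      (log_mod y x + log_mod y (x + n%:R)) / 2)| <= 2.
Proof.
move=> y1 x0.
apply: le_trans (_ : \sum_(k < n) ((k.+1%:R : R)^-1) ^+ 2 <= _); last exact: sum_invsq_le.
elim: n => [|n IH].
  by rewrite big_ord1 big_ord0 !addr0 subrr add0r (_ : _ - _ = 0) ?normr0//; lra.
rewrite big_ord_recr /= [leRHS]big_ord_recr /=.
have H : `|log_mod_prim y (x + n%:R + 1) - log_mod_prim y (x + n%:R) -
   (log_mod y (x + n%:R) + log_mod y (x + n%:R + 1)) / 2| <= (n.+1%:R^-1) ^+ 2.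
  apply: le_trans (trapezoid_error _ _) _; [lra|by rewrite addr_ge0|].
  have n0 : 0 <= n%:R :> R by [].
  rewrite -(natr1 n) exprVn -invfM lef_pV2 ?posrE; last 2 first.
  - by rewrite mulr_gt0// sq_sum_gt0//; lra.
  - by rewrite exprn_gt0//; lra.
  have h1 : n%:R ^+ 2 <= (x + n%:R) ^+ 2 by rewrite lerXn2r ?nnegrE ?addr_ge0// lerDr.
  have h2 : 1 <= y ^+ 2 by rewrite expr_ge1//; lra.
  have h3 := sqr_ge0 (n%:R - 1 : R).
  have h4 : (n%:R - 1 : R) ^+ 2 = n%:R ^+ 2 - 2 * n%:R + 1 by ring.
  have h5 : (n%:R + 1 : R) ^+ 2 = n%:R ^+ 2 + 2 * n%:R + 1 by ring.
  rewrite h5; lra.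
have e : x + n.+1%:R = x + n%:R + 1 by rewrite -addrA natr1.
rewrite e; move: IH H; set S := \sum_(i < n.+1) _; set T := \sum_(i < n) _.
move: (n.+1%:R^-1 ^+ 2) S T => s S T.
move: (log_mod_prim y (x + n%:R + 1)) (log_mod y (x + n%:R + 1)) => P1 f1.
move: (log_mod_prim y (x + n%:R)) (log_mod y (x + n%:R)) => P0 f0.
move: (log_mod_prim y x) (log_mod y x) => P f.
rewrite !ler_norml => /andP[h1 h2] /andP[h3 h4]; apply/andP; split; lra.
Qed.

Lemma atan_bounds t : 0 <= t -> 0 <= atan t <= t.
Proof.
rewrite le_eqVlt => /predU1P[<-|t0]; first by rewrite atan0 lexx.
have [c /andP[c0 _]] := mvt t0 (fun u => is_derive1_atan u).
rewrite atan0 !subr0 => ->.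
have h : 0 < 1 + c ^+ 2 by rewrite addr_gt0// exprn_gt0.
rewrite mulr_ge0 ?invr_ge0 ?(ltW h) ?(ltW t0)//=.
by rewrite ler_piMl ?(ltW t0)// invf_le1// lerDl sqr_ge0.
Qed.

Lemma log_mod_bounds y u : 0 < y -> ln y <= log_mod y u <= ln y + (u / y) ^+ 2 / 2.
Proof.
move=> y0; have e : u ^+ 2 + y ^+ 2 = y ^+ 2 * (1 + (u / y) ^+ 2).
  by field; rewrite gt_eqF.
have s0 := sqr_ge0 (u / y).
rewrite /log_mod e lnM ?posrE ?exprn_gt0//; last by rewrite ltr_wpDr.
have h1 : 0 <= ln (1 + (u / y) ^+ 2) by rewrite ln_ge0// lerDl.
have h2 : ln (1 + (u / y) ^+ 2) <= (u / y) ^+ 2.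
  by rewrite le_ln1Dx// (lt_le_trans _ s0)// ltrN10.
by rewrite lnXn// mulr2n; apply/andP; split; lra.
Qed.

Lemma log_mod_far (w c N : R) : 0 <= w -> w <= N -> 1 <= N -> c ^+ 2 <= N ->
  exists2 r : R, log_mod c (w + N) = ln N + r & 0 <= (w + N) * r <= 3 * w + 1 /\ 0 <= r <= 2.
Proof.
move=> w0 wN N1 cN; pose a := w / N; pose q := c ^+ 2 / N ^+ 2.
have N0 : 0 < N by lra.
have a0 : 0 <= a by rewrite divr_ge0// ltW.
have a1 : a <= 1 by rewrite ler_pdivrMr// mul1r.
have aN : w = a * N by rewrite /a mulfVK// gt_eqF.
have q0 : 0 <= q by rewrite divr_ge0 ?sqr_ge0.
have qN : q * N <= 1.
  by rewrite /q expr2 invfM mulrA mulfVK ?gt_eqF// ler_pdivrMr// mul1r.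
have q1 : q <= 1 by rewrite (le_trans _ qN)// ler_peMr.
pose s := 2 * a + a ^+ 2 + q.
have s0 : 0 <= s by rewrite /s; nra.
have l0 : 0 <= ln (1 + s) by rewrite ln_ge0// lerDl.
have l1 : ln (1 + s) <= s by rewrite le_ln1Dx// (lt_le_trans _ s0)// ltrN10.
exists (ln (1 + s) / 2).
  have -> : log_mod c (w + N) = ln (N ^+ 2 * (1 + s)) / 2.
    by rewrite /log_mod /s /q aN; congr (ln _ / 2); field; rewrite gt_eqF.
  rewrite lnM ?posrE ?exprn_gt0//; last by lra.
  by rewrite lnXn// mulr2n; lra.
have aa : a ^+ 2 <= a by rewrite expr2 ler_piMr.
split; last by apply/andP; split; rewrite /s in l1; lra.
rewrite mulr_ge0 ?divr_ge0//=; last by lra.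
apply: le_trans (_ : (w + N) * (s / 2) <= _).
  by rewrite ler_wpM2l ?ler_wpM2r//; lra.
rewrite aN (_ : _ * (s / 2) = (1 + a) * (a * N + a * (a * N) / 2 + q * N / 2)); last by rewrite /s; field.
have aN0 : 0 <= a * N by rewrite -aN.
have : a * (a * N) <= a * N by rewrite ler_piMl.
set aaN := a * (a * N) => haa.
have : (1 + a) * (a * N + aaN / 2 + q * N / 2) <= 2 * (a * N + aaN / 2 + q * N / 2).
  rewrite ler_wpM2r//; last by lra.
  have := mulr_ge0 a0 aN0; have := mulr_ge0 q0 (ltW N0); rewrite -/aaN; lra.
lra.
Qed.

(** The part of the trapezoidal sum coming from its far end [x + n], compared with
    the one for [1 + i]; all that survives the limit is [y (pi / 2)]. *)
Lemma log_mod_far_end x y : 1 <= y -> 0 <= x ->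
  \forall n \near \oo,
  `|(log_mod_prim y (x + n.+1%:R) + log_mod y (x + n.+1%:R) / 2) -
    (log_mod_prim 1 (1 + n.+1%:R) + log_mod 1 (1 + n.+1%:R) / 2)
    - (x - 1) * ln n.+1%:R - pi * y / 2| <= 4 * x + 20.
Proof.
move=> y1 x0; have y0 : 0 < y by lra.
have at1 z : 0 < z -> \forall n \near \oo, forall u, n%:R <= u ->
   pi / 2 - z^-1 <= atan (u / z) <= pi / 2.
  move=> z0.
  have : \forall u \near +oo, pi / 2 - z^-1 <= @atan R u.
    have := @cvgy_atan R => /cvgr_ge; apply; rewrite gtrBl invr_gt0//.
  move=> [M [_ HM]]; near=> n => u nu; rewrite (ltW (atan_ltpi2 _)) andbT.
  apply: HM; rewrite ltr_pdivlMr//; apply: lt_le_trans nu.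
  by near: n; exact: nbhs_infty_gtr.
have aty := at1 _ y0; have atn1 := at1 _ (@ltr01 R).
near=> n.
have xn : x <= n%:R by near: n; exact: nbhs_infty_ger.
have yn : y ^+ 2 <= n%:R by near: n; exact: nbhs_infty_ger.
have nN : n%:R <= n.+1%:R :> R by rewrite ler_nat.
have /andP[A1 A2] : pi / 2 - y^-1 <= atan ((x + n.+1%:R) / y) <= pi / 2.
  by near: n; apply: filterS aty => n H; apply: H; rewrite (@le_trans _ _ n.+1%:R)// ?ler_nat// lerDr.
have /andP[B1 B2] : pi / 2 - 1^-1 <= @atan R ((1 + n.+1%:R) / 1) <= pi / 2.
  by near: n; apply: filterS atn1 => n H; apply: H; rewrite (@le_trans _ _ n.+1%:R)// ?ler_nat// lerDr.
have p0 : 0 < pi / 2 :> R := lt_le_trans ltr01 (pihalf_ge1 R).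
have p2 : pi / 2 < 2 :> R := pihalf_lt2 R.
set N := n.+1%:R in nN A1 A2 B1 B2 *.
have N1 : 1 <= N by rewrite /N ler1n.
have [r rE [/andP[r1 r2] /andP[r3 r4]]] := log_mod_far x0 (le_trans xn nN) N1 (le_trans yn nN).
have oneN : 1 ^+ 2 <= N by rewrite expr1n.
have [r' rE' [/andP[r1' r2'] /andP[r3' r4']]] := log_mod_far ler01 N1 N1 oneN.
rewrite /log_mod_prim rE rE'.
have yA : pi / 2 * y - 1 <= y * atan ((x + N) / y) <= pi / 2 * y.
  apply/andP; split; last by rewrite [leRHS]mulrC ler_pM2l.
  rewrite (_ : _ - 1 = y * (pi / 2 - y^-1)) ?ler_pM2l//.
  by field; rewrite gt_eqF.
move: yA => /andP[yA1 yA2].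
move: (atan ((x + N) / y)) A1 A2 yA1 yA2 => at_y A1 A2 yA1 yA2.
move: (atan ((1 + N) / 1)) B1 B2 => at_1 B1 B2.
rewrite invr1 in B1.
have e : (x + N) * (ln N + r) - (x + N) + y * at_y + (ln N + r) / 2 -
   ((1 + N) * (ln N + r') - (1 + N) + 1 * at_1 + (ln N + r') / 2) -
   (x - 1) * ln N - pi * y / 2 =
   ((x + N) * r - (1 + N) * r') + (r - r') / 2 - x + 1 + (y * at_y - pi / 2 * y) - at_1.
  by field.
rewrite e ler_norml; clear -r1 r2 r3 r4 r1' r2' r3' r4' yA1 yA2 B1 B2 x0 p0 p2.
apply/andP; split; lra.
Unshelve. all: by end_near. Qed.

Lemma sum_log_mod_normc n x y : 1 <= y ->
  ln (normc (gauss_inv n (x +i* y))) =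
  \sum_(k < n.+2) log_mod y (x + k%:R) - ln (n.+1`!%:R) - x * ln n.+1%:R.
Proof.
move=> y1; have y0 : 0 < y by lra.
have sq (k : nat) : log_mod y (x + k%:R) = ln (normc ((x +i* y) + k%:R)).
  have s0 := sq_sum_gt0 (x + k%:R) y0.
  have n0 : 0 < normc ((x +i* y) + k%:R).
    by rewrite normc_gt0; apply: Im_neq0; rewrite !ReImE /= addr0 gt_eqF.
  have -> : log_mod y (x + k%:R) = ln (normc ((x +i* y) + k%:R) ^+ 2) / 2.
    by rewrite sqr_normcE !ReImE /= addr0.
  by rewrite lnXn// mulr2n; lra.
have pos m : 0 < \prod_(j < m) normc ((x +i* y) + j%:R).
  apply: prodr_gt0 => j _.
  by rewrite normc_gt0; apply: Im_neq0; rewrite !ReImE /= addr0 gt_eqF.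
have lnp m : ln (\prod_(j < m) normc ((x +i* y) + j%:R)) = \sum_(k < m) log_mod y (x + k%:R).
  elim: m => [|m IH]; first by rewrite !big_ord0 ln1.
  rewrite !big_ord_recr /= lnM ?IH ?sq// ?posrE//; first exact: pos.
  by rewrite normc_gt0; apply: Im_neq0; rewrite !ReImE /= addr0 gt_eqF.
have f0 : 0 < n.+1`!%:R :> R by rewrite ltr0n fact_gt0.
rewrite /gauss_inv 2!normcM normc_prod normcV normc_nat.
rewrite normc_cexp !ReImE /= mulr0 subr0.
have p1 := divr_gt0 (pos n.+2) f0.
by rewrite lnM ?posrE ?p1 ?expR_gt0// ln_div ?posrE ?pos// expRK lnp.
Qed.

(** The near end of the trapezoidal sum carries the power of [y]. *)
Lemma log_mod_near_end x y : 1 <= y -> 0 <= x ->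
  `|(log_mod y x / 2 - log_mod_prim y x) + (x - 2^-1) * ln y| <= (x + 1) * x ^+ 2 + x.
Proof.
move=> y1 x0; have y0 : 0 < y by lra.
have /andP[] := log_mod_bounds x y0.
have v1 : y^-1 <= 1 by rewrite invf_le1.
have xy0 : 0 <= x / y by rewrite divr_ge0// ltW.
have xy : (x / y) ^+ 2 <= x ^+ 2 by rewrite lerXn2r ?nnegrE// ler_pdivrMr// ler_peMr.
have /andP[] := atan_bounds xy0.
rewrite /log_mod_prim; move: (log_mod y x) (atan (x / y)) => f t t0 t1 f1 f2.
have yt0 : 0 <= y * t by rewrite mulr_ge0// ltW.
have yt1 : y * t <= x by rewrite mulrC -ler_pdivlMr.
pose r := f - ln y.
have r0 : 0 <= r by rewrite /r; lra.
have r1 : r <= x ^+ 2 by rewrite /r; have := sqr_ge0 (x / y); lra.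
rewrite (_ : _ + _ = - (x - 2^-1) * r + (x - y * t)); last by rewrite /r; field.
rewrite (le_trans (ler_normD _ _))// lerD//; last by rewrite ger0_norm; lra.
rewrite normrM ler_pM//; last by rewrite ger0_norm.
by rewrite ler_norml; apply/andP; split; lra.
Qed.

Lemma gauss_inv_reference : exists C, forall n, `|ln (normc (gauss_inv n (1 +i* 1 : R[i])))| <= C.
Proof.
pose z : R[i] := 1 +i* 1.
have z0 : 0 < Re z by rewrite /= ltr01.
pose hi := normc z * expR (`|Re z| + normc z ^+ 2).
pose lo := Re z * expR (- (2 * Re z ^+ 2)).
have lo0 : 0 < lo by rewrite mulr_gt0 ?expR_gt0.
exists (`|ln hi| + `|ln lo|) => n.
have h1 := gauss_inv_le n z; have h2 := gauss_inv_ge n z0.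
have p := lt_le_trans lo0 h2.
have l1 : ln lo <= ln (normc (gauss_inv n z)) by rewrite ler_ln.
have l2 : ln (normc (gauss_inv n z)) <= ln hi.
  by rewrite ler_ln ?posrE// (lt_le_trans p).
move: (ler_norm (ln hi)) (ler_norm (- ln lo)); rewrite normrN => h3 h4.
rewrite ler_norml; apply/andP; split.
  by rewrite lerNl (le_trans _ (_ : `|ln lo| <= _)) ?lerDr// (le_trans _ h4)// lerN2.
by rewrite (le_trans l2)// (le_trans h3)// lerDl.
Qed.

(** Stirling's formula for the modulus, up to a bounded factor. The comparison
    with [1 + i] cancels the factorial. *)
Lemma stirling_upper : exists C0 : R, forall x y, 0 <= x -> 1 <= y ->
  exists2 l, normc (Gamma (x +i* y)) = expR l &
    `|l - ((x - 2^-1) * ln y - pi * y / 2)| <= (x + 1) * x ^+ 2 + 5 * x + C0.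
Proof.
have [C1 HC1] := gauss_inv_reference.
pose near1 := log_mod 1 1 / 2 - log_mod_prim 1 1 : R.
exists (C1 + `|near1| + 24) => x y x0 y1.
set E := (x - 2^-1) * ln y - pi * y / 2; set C := _ + (_ + _ + 24).
pose z := x +i* y.
have y0 : 0 < y by lra.
have gi0 n : 0 < normc (gauss_inv n z).
  rewrite normc_gt0 /gauss_inv; apply: mulf_neq0; last exact: cexp_neq0.
  apply: mulf_neq0; last by rewrite invr_neq0// pnatr_eq0 -lt0n fact_gt0.
  by apply/prodf_neq0 => j _; apply: Im_neq0; rewrite !ReImE /= addr0 gt_eqF.
have ev : \forall n \near \oo, expR (- E - C) <= normc (gauss_inv n z) <= expR (- E + C).
  apply: filterS (log_mod_far_end y1 x0) => n far.
  suff : `|ln (normc (gauss_inv n z)) + E| <= C.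
    rewrite ler_norml => /andP[h1 h2].
    by rewrite -{1 2}(lnK (gi0 n)) !ler_expR; apply/andP; split; lra.
  have T := trapezoid_sum n.+1 y1 x0.
  have T1 := trapezoid_sum n.+1 (lexx 1) (@ler01 R).
  have S := sum_log_mod_normc n x y1.
  have S1 := sum_log_mod_normc n 1 (lexx (1 : R)).
  have near := log_mod_near_end y1 x0.
  have ref := HC1 n.
  have n1 := ler_norm near1; have n1' := ler_norm (- near1); rewrite normrN in n1'.
  rewrite /C; move: (`|near1|) n1 n1' => an1 n1 n1'.
  move: far T T1 near ref.
  rewrite !ler_norml S1 /z S /E /near1 in n1 n1' *.
  move: (\sum_(k < n.+2) log_mod y (x + k%:R)) => SS.
  move: (\sum_(k < n.+2) log_mod 1 (1 + k%:R)) => SS1.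
  move: (log_mod_prim y (x + n.+1%:R)) (log_mod y (x + n.+1%:R)) => Pxn fxn.
  move: (log_mod_prim 1 (1 + n.+1%:R)) (log_mod 1 (1 + n.+1%:R)) => P1n f1n.
  move: (log_mod_prim y x) (log_mod y x) n1 n1' => Px fx n1 n1'.
  move: (log_mod_prim 1 1) (log_mod 1 1) n1 n1' => P1 f1 n1 n1'.
  move: (ln (n.+1)`!%:R) (ln n.+1%:R) (ln y) => lf lN ly.
  move: ((x + 1) * x ^+ 2) => q.
  have -> : (x - 1) * lN = x * lN - lN by ring.
  move: (x * lN) => xlN; move: ((x - 2^-1) * ly) (pi * y) => xly piy.
  move=> /andP[a1 a2] /andP[b1 b2] /andP[c1 c2] /andP[d1 d2] /andP[e1 e2].
  clear -a1 a2 b1 b2 c1 c2 d1 d2 e1 e2 n1 n1'; by apply/andP; split; lra.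
have cv := ccvg_normc (gauss_inv_cvg z).
have m1 : expR (- E - C) <= normc (Gamma z)^-1.
  by apply: (cvgr_to_ge cv); apply: filterS ev => n /andP[].
have m2 : normc (Gamma z)^-1 <= expR (- E + C).
  by apply: (cvgr_to_le cv); apply: filterS ev => n /andP[].
rewrite normcV in m1 m2.
have m0 := lt_le_trans (expR_gt0 _) m1.
exists (- ln (normc (Gamma z))^-1); first by rewrite expRN lnK// invrK.
rewrite -{}(lnK m0) !ler_expR in m1 m2.
by rewrite ler_norml; apply/andP; split; lra.
Qed.

Lemma normc_Gamma_eq (z w : R[i]) : Re z = Re w -> normc z = normc w ->
  normc (Gamma z) = normc (Gamma w).
Proof.
move=> rzw nzw; apply: invr_inj; rewrite -!normcV.
have H := ccvg_normc (gauss_inv_cvg z); have H' := ccvg_normc (gauss_inv_cvg w).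
suff E : (fun n => normc (gauss_inv n z)) = fun n => normc (gauss_inv n w).
  by rewrite E in H; exact: (cvg_unique _ H H').
apply/funext => n; rewrite !normc_gauss_inv nzw rzw; congr (_ * _ * _).
apply: eq_bigr => j _; apply/eqP.
rewrite -(@eqrXn2 _ 2) ?normc_ge0//; apply/eqP.
by rewrite !normc_1Ddiv nzw rzw.
Qed.

(** Stirling's formula on a vertical strip, the left part being reached by the
    functional equation. *)
Lemma stirling (A B : R) : exists C : R, forall x y, A <= x <= B -> 1 <= `|y| ->
  exists2 l, normc (Gamma (x +i* y)) = expR l &
    `|l - ((x - 2^-1) * ln `|y| - pi * `|y| / 2)| <= C.
Proof.
have [C0 HC0] := stirling_upper.
(* [k] steps of the functional equation move the strip to [Re s >= 0]. *)
pose k := (Num.truncn `|A|).+1.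
have kA : 0 <= A + k%:R.
  have := truncnS_gt `|A|; have := ler_norm (- A); rewrite normrN -/k; lra.
pose M := `|A| + `|B| + k%:R + 1.
pose Q := (M + 1) * M ^+ 2 + 5 * M + C0.
exists (Q + k%:R * (M ^+ 2 / 2)) => x y /andP[Ax xB] y1.
wlog y0 : y y1 / 0 <= y.
  move=> H; have [y0|y0] := leP 0 y; first exact: H.
  have := H (- y); rewrite normrN oppr_ge0 => /(_ y1 (ltW y0)) [l lE lb].
  exists l; last exact: lb.
  by rewrite -lE; apply: normc_Gamma_eq; [exact: erefl|rewrite !normcE2 /= sqrrN].
rewrite (ger0_norm y0) in y1 *.
have xk0 : 0 <= x + k%:R by lra.
have [l lE lb] := HC0 (x + k%:R) y xk0 y1.
have yy0 : 0 < y by lra.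
pose z := x +i* y.
have zj0 j : 0 < normc (z + j%:R).
  by rewrite normc_gt0; apply: Im_neq0; rewrite !ReImE /= addr0 gt_eqF.
have GS m : normc (Gamma (z + m%:R)) = normc (Gamma z) * \prod_(j < m) normc (z + j%:R).
  elim: m => [|m IH]; first by rewrite addr0 big_ord0 mulr1.
  rewrite big_ord_recr /= mulrA -IH -natr1 addrA.
  have H := congr1 (@ComplexField.Normc.normc R) (GammaV_shift (z + m%:R)).
  rewrite normcM !normcV in H.
  rewrite -[X in X * _]invrK H invfM invrK -mulrA mulVf ?mulr1//.
  by rewrite gt_eqF.
have zjE j : normc (z + j%:R) = expR (log_mod y (x + j%:R)).
  have -> : log_mod y (x + j%:R) = ln (normc (z + j%:R)).
    have -> : log_mod y (x + j%:R) = ln (normc (z + j%:R) ^+ 2) / 2.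
      by rewrite sqr_normcE !ReImE /= addr0.
    by rewrite lnXn// mulr2n; lra.
  by rewrite lnK// posrE.
have e : (x + k%:R) +i* y = z + k%:R.
  by apply: complex_ext; rewrite !ReImE //= addr0.
exists (l - \sum_(j < k) log_mod y (x + j%:R)).
  rewrite expRB -lE e GS expR_sum.
  under [X in _ = _ / X]eq_bigr do rewrite -zjE.
  by rewrite mulfK// gt_eqF// prodr_gt0.
have xM : `|x| <= `|A| + `|B|.
  by apply: normr_itv; rewrite Ax xB.
have M0 : 0 <= M by rewrite /M !addr_ge0.
have sb : `|\sum_(j < k) log_mod y (x + j%:R) - k%:R * ln y| <= k%:R * (M ^+ 2 / 2).
  rewrite -[k%:R * ln y](_ : \sum_(j < k) ln y = _); last first.
    by rewrite sumr_const card_ord mulr_natl.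
  rewrite -sumrB (le_trans (ler_norm_sum _ _ _))//.
  rewrite (_ : k%:R * (M ^+ 2 / 2) = \sum_(j < k) (M ^+ 2 / 2)); last first.
    by rewrite sumr_const card_ord mulr_natl.
  apply: ler_sum => j _; have /andP[h1 h2] := log_mod_bounds (x + j%:R) yy0.
  rewrite ger0_norm ?subr_ge0// lerBlDl (le_trans h2)// lerD2l ler_wpM2r//.
  rewrite -[leRHS]real_normK ?num_real// -[leLHS]real_normK ?num_real//.
  rewrite lerXn2r ?nnegrE// normrM normfV (gtr0_norm yy0) ler_pdivrMr//.
  rewrite (ger0_norm M0) (le_trans (_ : _ <= M))//; last by rewrite ler_peMr.
  rewrite (le_trans (ler_normD _ _))// normr_nat.
  by rewrite (le_trans (lerD xM (_ : _ <= k%:R)))// ?ler_nat 1?ltnW// /M lerDl.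
have lb2 : (x + k%:R + 1) * (x + k%:R) ^+ 2 + 5 * (x + k%:R) + C0 <= Q.
  have xkM : x + k%:R <= M.
    by rewrite /M (le_trans (lerD (le_trans (ler_norm x) xM) (lexx _)))// lerDl.
  rewrite /Q lerD2r lerD//; last by rewrite ler_pM2l.
  by apply: ler_pM; [rewrite addr_ge0|exact: sqr_ge0|rewrite lerD2r|rewrite lerXn2r ?nnegrE].
have {}lb := le_trans lb lb2.
move: lb sb; rewrite !ler_norml => /andP[h1 h2] /andP[h3 h4].
have e2 : (x + k%:R - 2^-1) * ln y = (x - 2^-1) * ln y + k%:R * ln y by ring.
rewrite e2 in h1 h2; clear -h1 h2 h3 h4.
by apply/andP; split; lra.
Qed.

End stirling.

(** * Cauchy's theorem on a strip *)

(* Unification must not compare complex numbers by computing their components. *)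
Opaque cexp ComplexField.Normc.normc.

Lemma cintegral0 {R : realType} d (T : measurableType d) (m : {measure set T -> \bar R}) :
  cintegral m setT (fun=> 0) = 0.
Proof. by rewrite /cintegral /Rintegral /= integral0. Qed.

Section contour.
Context {R : realType}.
Local Notation mu := (@lebesgue_measure R).
Implicit Types (x y T : R) (F G : R[i] -> R[i]).

Lemma ccontinuous_cst z x : ccontinuous_at (fun=> z) x.
Proof. by split; exact: cvg_cst. Qed.

Lemma ccontinuousD (f g : R -> R[i]) x : ccontinuous_at f x -> ccontinuous_at g x ->
  ccontinuous_at (fun t => f t + g t) x.
Proof.
move=> [f1 f2] [g1 g2]; split.
  rewrite (_ : (fun t => Re (f t + g t)) = (fun t => Re (f t) + Re (g t))).
    exact: cvgD.
  by apply/funext => t; rewrite ReD.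
rewrite (_ : (fun t => Im (f t + g t)) = (fun t => Im (f t) + Im (g t))).
  exact: cvgD.
by apply/funext => t; rewrite ImD.
Qed.

Lemma ccontinuousM (f g : R -> R[i]) x : ccontinuous_at f x -> ccontinuous_at g x ->
  ccontinuous_at (fun t => f t * g t) x.
Proof.
move=> [f1 f2] [g1 g2]; split.
  rewrite (_ : (fun t => Re (f t * g t)) =
      (fun t => Re (f t) * Re (g t) - Im (f t) * Im (g t))).
    by apply: cvgB; exact: cvgM.
  by apply/funext => t; rewrite ReM.
rewrite (_ : (fun t => Im (f t * g t)) =
    (fun t => Re (f t) * Im (g t) + Im (f t) * Re (g t))).
  by apply: cvgD; exact: cvgM.
by apply/funext => t; rewrite ImM.
Qed.

Variables c1 c2 : R.
Hypothesis c12 : c1 < c2.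

(** [tame F] gathers what [F] must satisfy on the strip for Fubini's theorem and the
    fundamental theorem of calculus to apply on its rectangles. *)
Definition tame F :=
  [/\ cmeasurable (fun p : R * R => F (p.1 +i* p.2)),
      (forall T, exists B, forall x y, c1 <= x <= c2 -> `|y| <= T -> normc (F (x +i* y)) <= B) &
      (forall x y, c1 <= x <= c2 ->
         ccontinuous_at (fun t => F (t +i* y)) x /\ ccontinuous_at (fun t => F (x +i* t)) y)].

(** Holomorphy on the strip, as the pair of the partial derivatives along the
    two axes prescribed by the Cauchy-Riemann equations. *)
Definition holo F F' :=
  [/\ tame F, tame F' & forall x y, c1 <= x <= c2 ->
     is_cderive (fun t => F (t +i* y)) x (F' (x +i* y)) /\
     is_cderive (fun t => F (x +i* t)) y ('i * F' (x +i* y))].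

Lemma tame_cst z : tame (fun=> z).
Proof.
split; first exact: cmeasurable_cst.
  by move=> T; exists (normc z) => x y.
by move=> x y _; split; exact: ccontinuous_cst.
Qed.

Lemma tameM F G : tame F -> tame G -> tame (fun s => F s * G s).
Proof.
move=> [mF bF cF] [mG bG cG]; split; first exact: cmeasurableM.
  move=> T; have [BF HF] := bF T; have [BG HG] := bG T.
  exists (BF * BG) => x y xc yT; rewrite normcM.
  by rewrite ler_pM ?normc_ge0// ?HF ?HG.
move=> x y xc; have [h1 h2] := cF x y xc; have [h3 h4] := cG x y xc.
by split; exact: ccontinuousM.
Qed.

Lemma tameD F G : tame F -> tame G -> tame (fun s => F s + G s).
Proof.
move=> [mF bF cF] [mG bG cG]; split; first exact: cmeasurableD.
  move=> T; have [BF HF] := bF T; have [BG HG] := bG T.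
  exists (BF + BG) => x y xc yT; rewrite (le_trans (le_normcD _ _))//.
  by rewrite lerD// ?HF ?HG.
move=> x y xc; have [h1 h2] := cF x y xc; have [h3 h4] := cG x y xc.
by split; exact: ccontinuousD.
Qed.

Lemma holo_continuous F F' :
  (forall x y, c1 <= x <= c2 ->
     is_cderive (fun t => F (t +i* y)) x (F' (x +i* y)) /\
     is_cderive (fun t => F (x +i* t)) y ('i * F' (x +i* y))) ->
  forall x y, c1 <= x <= c2 ->
   ccontinuous_at (fun t => F (t +i* y)) x /\ ccontinuous_at (fun t => F (x +i* t)) y.
Proof.
by move=> H x y xc; have [h1 h2] := H x y xc; split; [apply: is_cderive_continuous h1|apply: is_cderive_continuous h2].
Qed.

Lemma holo_cst z : holo (fun=> z) (fun=> 0).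
Proof.
split; [exact: tame_cst|exact: tame_cst|] => x y _; rewrite mulr0.
by split; exact: is_cderive_cst.
Qed.

Lemma holoM F F' G G' : holo F F' -> holo G G' ->
  holo (fun s => F s * G s) (fun s => F' s * G s + F s * G' s).
Proof.
move=> [tF tF' dF] [tG tG' dG]; split; first exact: tameM.
  by apply: tameD; exact: tameM.
move=> x y xc; have [h1 h2] := dF x y xc; have [h3 h4] := dG x y xc; split.
  exact: is_cderiveM.
by apply: is_cderive_eq (is_cderiveM h2 h4) _; ring.
Qed.

Lemma holo_affine (z w : R[i]) : holo (fun s => z + w * s) (fun=> w).
Proof.
have D x y : is_cderive (fun t => z + w * (t +i* y)) x w /\
     is_cderive (fun t => z + w * (x +i* t)) y ('i * w).
  split.
    have E t : z + w * (t +i* y) = (z + w * (0 +i* y)) + t%:C * w.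
      by apply: complex_ext; rewrite !ReImE /=; ring.
    by under eq_fun do rewrite E; exact: is_cderive_affine.
  have E t : z + w * (x +i* t) = (z + w * x%:C) + t%:C * ('i * w).
    by apply: complex_ext; rewrite !ReImE /=; ring.
  by under eq_fun do rewrite E; exact: is_cderive_affine.
split; last by move=> x y _; exact: D.
- split.
  + apply: cmeasurableD; first exact: cmeasurable_cst.
    by apply: cmeasurableM; [exact: cmeasurable_cst|split; [exact: measurable_fst|exact: measurable_snd]].
  + move=> T; exists (normc z + normc w * (`|c1| + `|c2| + T)) => x y /andP[x1 x2] yT.
    rewrite (le_trans (le_normcD _ _))// lerD2l normcM ler_wpM2l ?normc_ge0//.
    have -> : x +i* y = x%:C + 'i * y%:C by apply: complex_ext; rewrite !ReImE /=; ring.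
    rewrite (le_trans (le_normcD _ _))// normc_real normcM normc_real.
    rewrite normc_i mul1r lerD//.
    by apply: normr_itv; rewrite x1 x2.
  + by apply: (@holo_continuous (fun s => z + w * s) (fun=> w)) => x y _; exact: D.
- exact: tame_cst.
Qed.

Lemma holo_cexp F F' : holo F F' -> holo (fun s => cexp (F s)) (fun s => F' s * cexp (F s)).
Proof.
move=> [tF tF' dF].
have D x y : c1 <= x <= c2 ->
     is_cderive (fun t => cexp (F (t +i* y))) x (F' (x +i* y) * cexp (F (x +i* y))) /\
     is_cderive (fun t => cexp (F (x +i* t))) y ('i * (F' (x +i* y) * cexp (F (x +i* y)))).
  move=> xc; have [h1 h2] := dF x y xc; split; first exact: is_cderive_cexp.
  by apply: is_cderive_eq (is_cderive_cexp h2) _; exact/esym/mulrA.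
have tE : tame (fun s => cexp (F s)).
  have [mF bF _] := tF; split; first exact: cmeasurable_cexp.
    move=> T; have [B HB] := bF T; exists (expR B) => x y xc yT.
    rewrite normc_cexp ler_expR (le_trans (ler_norm _))// (le_trans (normr_Re _))//.
    exact: HB.
  exact: (@holo_continuous (fun s => cexp (F s)) (fun s => F' s * cexp (F s)) D).
by split; [exact: tE|exact: tameM|exact: D].
Qed.

Lemma holoV F F' : holo F F' ->
  (forall T, exists2 e, 0 < e & forall x y, c1 <= x <= c2 -> `|y| <= T -> e <= normc (F (x +i* y))) ->
  holo (fun s => (F s)^-1) (fun s => - F' s * (F s)^-1 ^+ 2).
Proof.
move=> [tF tF' dF] lb.
have F0 x y : c1 <= x <= c2 -> F (x +i* y) != 0.
  move=> xc; have [e e0 H] := lb `|y|.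
  by rewrite -normc_gt0 (lt_le_trans e0)// H.
have D x y : c1 <= x <= c2 ->
     is_cderive (fun t => (F (t +i* y))^-1) x (- F' (x +i* y) * (F (x +i* y))^-1 ^+ 2) /\
     is_cderive (fun t => (F (x +i* t))^-1) y ('i * (- F' (x +i* y) * (F (x +i* y))^-1 ^+ 2)).
  move=> xc; have [h1 h2] := dF x y xc; split; first by apply: is_cderiveV => //; exact: F0.
  by apply: is_cderive_eq (is_cderiveV (F0 _ _ xc) h2) _; ring.
have tV : tame (fun s => (F s)^-1).
  have [mF bF _] := tF; split; first exact: cmeasurableV.
    move=> T; have [e e0 H] := lb T; exists e^-1 => x y xc yT.
    rewrite normcV lef_pV2 ?posrE ?H// normc_gt0; exact: F0.
  exact: (@holo_continuous (fun s => (F s)^-1) (fun s => - F' s * (F s)^-1 ^+ 2) D).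
split; [exact: tV| |exact: D]; apply: tameM.
  have := tameM (tame_cst (-1)) tF'.
  by congr tame; apply/funext => s; rewrite mulN1r.
have := tameM tV tV.
by congr tame; apply/funext => s; rewrite expr2.
Qed.

Lemma holo_prod (I : eqType) (r : seq I) (H : I -> R[i] -> R[i]) :
  (forall i, i \in r -> exists H', holo (H i) H') ->
  exists P', holo (fun s => \prod_(i <- r) H i s) P'.
Proof.
elim: r => [_|i r IH hH].
  exists (fun=> 0); rewrite (_ : (fun _ => _) = fun=> 1); first exact: holo_cst.
  by apply/funext => s; rewrite big_nil.
have [|P' hP] := IH; first by move=> j jr; apply: hH; rewrite in_cons jr orbT.
have [H' hi] := hH i (mem_head _ _).
eexists; rewrite (_ : (fun _ => _) = fun s => H i s * \prod_(i <- r) H i s).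
  exact: holoM hi hP.
by apply/funext => s; rewrite big_cons.
Qed.

Lemma tame_line_measurable F : tame F ->
  (forall x, cmeasurable (fun y : measurableTypeR R => F (x +i* y))) /\
  (forall y, cmeasurable (fun x : measurableTypeR R => F (x +i* y))).
Proof.
move=> [[m1 m2] _ _]; split => [x|y]; split.
- exact: (measurable_fun_pair2 (f := fun p : R * R => Re (F (p.1 +i* p.2))) x m1).
- exact: (measurable_fun_pair2 (f := fun p : R * R => Im (F (p.1 +i* p.2))) x m2).
- exact: (measurable_fun_pair1 (f := fun p : R * R => Re (F (p.1 +i* p.2))) y m1).
- exact: (measurable_fun_pair1 (f := fun p : R * R => Im (F (p.1 +i* p.2))) y m2).
Qed.

(** Cauchy's theorem on a rectangle: integrate [F'] over it in both orders. *)
Lemma cauchy_rectangle F F' T : 0 < T -> holo F F' ->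
  cintegral mu setT (fun y => (seg (- T) T y)%:C * (F (c2 +i* y) - F (c1 +i* y))) =
  cintegral mu setT (fun x => - 'i * ((seg c1 c2 x)%:C * (F (x +i* T) - F (x +i* - T)))).
Proof.
move=> T0 [tF tF' dF]; have [mF' bF' cF'] := tF'.
have [B HB] := bF' T.
have B0 : 0 <= B.
  have h1 : c1 <= c1 <= c2 by rewrite lexx ltW.
  have h0 : `|0 : R| <= T by rewrite normr0 ltW.
  exact: le_trans (normc_ge0 _) (HB _ _ h1 h0).
pose f (p : R * R) := (seg c1 c2 p.1 * seg (- T) T p.2)%:C * F' (p.1 +i* p.2).
have mf : cmeasurable (f : measurableTypeR R * measurableTypeR R -> R[i]).
  apply: cmeasurableM => //; apply: cmeasurable_real; apply: measurable_funM.
    by apply: measurableT_comp => //; exact: measurable_seg.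
  by apply: measurableT_comp => //; exact: measurable_seg.
have bf x y : normc (f (x, y)) <= (B * seg c1 c2 x) * seg (- T) T y.
  rewrite /f /= normcM normc_real ger0_norm ?mulr_ge0 ?seg_ge0//.
  rewrite /seg; case: (boolP (c1 <= x <= c2)) => xc; last by rewrite !mul0r mulr0 mul0r.
  case: (boolP (- T <= y <= T)) => yT; last by rewrite !mulr0 mul0r.
  by rewrite !mulr1 mul1r; apply: HB => //; rewrite ler_norml.
have Fub := cintegral_Fubini mf (integrable_mull B (integrable_seg c1 c2)) (integrable_seg (- T) T) bf.
have Iin y : cintegral mu setT (fun x => f (x, y)) = (seg (- T) T y)%:C * (F (c2 +i* y) - F (c1 +i* y)).
  have [B' HB'] := bF' `|y|.
  have bs x : normc ((seg c1 c2 x)%:C * F' (x +i* y)) <= B' * seg c1 c2 x.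
    rewrite (normc_realM _ (seg_ge0 _ _ _)).
    by apply: seg_bound => xc; exact: HB'.
  have ms : cmeasurable (fun x : measurableTypeR R => (seg c1 c2 x)%:C * F' (x +i* y)).
    apply: cmeasurableM; last exact: (tame_line_measurable tF').2.
    by apply: cmeasurable_real; exact: measurable_seg.
  have H : cintegral mu setT (fun x => (seg c1 c2 x)%:C * F' (x +i* y)) = F (c2 +i* y) - F (c1 +i* y).
    exact: (@cintegral_seg_FTC R (fun x => F' (x +i* y)) (fun x => F (x +i* y)) c1 c2 c12
      (fun x xc => (cF' x y xc).1) (fun x xc => (dF x y xc).1)).
  have is_ := cintegrable_dom ms (integrable_mull B' (integrable_seg c1 c2)) bs.
  rewrite -H -(cintegralZl _ is_).
  have e (r s : R) (z : R[i]) : (r * s)%:C * z = s%:C * (r%:C * z).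
    by rewrite (mulrC r) rmorphM [RHS]mulrA.
  by apply: eq_cintegral => x; exact: e.
have ii : - 'i * 'i = 1 :> R[i] by apply: complex_ext; rewrite !ReImE /=; ring.
have Iout x : cintegral mu setT (fun y => f (x, y)) =
    - 'i * ((seg c1 c2 x)%:C * (F (x +i* T) - F (x +i* - T))).
  case: (boolP (c1 <= x <= c2)) => xc; last first.
    rewrite (_ : seg c1 c2 x = 0); last by rewrite /seg (negbTE xc).
    rewrite mul0r mulr0 -[RHS](cintegral0 mu); apply: eq_cintegral => y.
    by rewrite /f /= /seg (negbTE xc) !mul0r.
  have s1 : seg c1 c2 x = 1 by rewrite /seg xc.
  have bs y : normc ((seg (- T) T y)%:C * ('i * F' (x +i* y))) <= B * seg (- T) T y.
    rewrite (normc_realM _ (seg_ge0 _ _ _)).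
    apply: seg_bound => yT; rewrite normcM normc_i mul1r.
    have yT' : `|y| <= T by rewrite ler_norml.
    exact: HB xc yT'.
  have ms : cmeasurable (fun y : measurableTypeR R => (seg (- T) T y)%:C * ('i * F' (x +i* y))).
    apply: cmeasurableM; last first.
      by apply: cmeasurableM; [exact: cmeasurable_cst|exact: (tame_line_measurable tF').1].
    by apply: cmeasurable_real; exact: measurable_seg.
  have NT : - T < T by rewrite gtrN.
  have cc y : - T <= y <= T -> ccontinuous_at (fun y => 'i * F' (x +i* y)) y.
    move=> _; apply: ccontinuousM; first exact: ccontinuous_cst.
    exact: (cF' _ _ xc).2.
  have H : cintegral mu setT (fun y => (seg (- T) T y)%:C * ('i * F' (x +i* y))) = F (x +i* T) - F (x +i* - T).
    exact: (@cintegral_seg_FTC R (fun y => 'i * F' (x +i* y)) (fun y => F (x +i* y)) (- T) T NT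
      cc (fun y _ => (dF x y xc).2)).
  have is_ := cintegrable_dom ms (integrable_mull B (integrable_seg (- T) T)) bs.
  rewrite s1 mul1r -H -(cintegralZl _ is_).
  by apply: eq_cintegral => y; rewrite /f s1 mul1r mulrCA (mulrA (- 'i)) ii mul1r.
have E1 := eq_cintegral mu Iin; have E2 := eq_cintegral mu Iout.
exact: etrans (etrans (esym E1) (esym Fub)) E2.
Qed.

(** Cauchy's theorem passes from the [F_ n] to their limit on each rectangle, and
    then the horizontal sides vanish as the height grows. Allowing a limit makes
    Gamma accessible through Gauss's products. *)
Theorem contour_shift (F_ : nat -> R[i] -> R[i]) F (g : R -> R) :
  (forall n, exists F', holo (F_ n) F') ->
  (forall x y, c1 <= x <= c2 -> ccvg (fun n => F_ n (x +i* y)) (F (x +i* y))) ->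
  (forall T, exists B, forall n x y, c1 <= x <= c2 -> `|y| <= T -> normc (F_ n (x +i* y)) <= B) ->
  mu.-integrable setT (EFin \o g) ->
  (forall x y, c1 <= x <= c2 -> normc (F (x +i* y)) <= g y) ->
  g n%:R @[n --> \oo] --> (0 : R) -> g (- n%:R) @[n --> \oo] --> (0 : R) ->
  cintegral mu setT (fun y => F (c2 +i* y)) = cintegral mu setT (fun y => F (c1 +i* y)).
Proof.
move=> hF cvF bF ig Fg g1 g2.
have c1c : c1 <= c1 <= c2 by rewrite lexx ltW.
have c2c : c1 <= c2 <= c2 by rewrite lexx ltW.
have tF n : tame (F_ n) by have [F' []] := hF n.
have mFv x : c1 <= x <= c2 -> cmeasurable (fun y : measurableTypeR R => F (x +i* y)).
  move=> xc; apply: (@cmeasurable_cvg _ _ _ (fun n y => F_ n (x +i* y))) => [n|y].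
    exact: (tame_line_measurable (tF n)).1.
  exact: cvF.
have segcv T x : ccvg (fun n => (seg c1 c2 x)%:C * (F_ n (x +i* T) - F_ n (x +i* - T)))
    ((seg c1 c2 x)%:C * (F (x +i* T) - F (x +i* - T))).
  case: (boolP (c1 <= x <= c2)) => xc.
    apply: ccvgM; first exact: ccvg_cst.
    by apply: ccvgD; [exact: cvF|apply: ccvgN; exact: cvF].
  rewrite /seg (negbTE xc) (_ : (fun _ => _) = fun=> 0); last first.
    by apply/funext => n; rewrite mul0r.
  by rewrite mul0r; exact: ccvg_cst.
have msegF T : cmeasurable (fun x : measurableTypeR R => (seg c1 c2 x)%:C * (F (x +i* T) - F (x +i* - T))).
  apply: (cmeasurable_cvg _ (segcv T)) => n.
  apply: cmeasurableM; first by apply: cmeasurable_real; exact: measurable_seg.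
  apply: cmeasurableD; first exact: (tame_line_measurable (tF n)).2.
  by apply: cmeasurableN; exact: (tame_line_measurable (tF n)).2.
have rect T : 0 < T ->
  cintegral mu setT (fun y => (seg (- T) T y)%:C * (F (c2 +i* y) - F (c1 +i* y))) =
  cintegral mu setT (fun x => - 'i * ((seg c1 c2 x)%:C * (F (x +i* T) - F (x +i* - T)))).
  move=> T0; have [B HB] := bF T.
  have E : (fun n => cintegral mu setT (fun y => (seg (- T) T y)%:C * (F_ n (c2 +i* y) - F_ n (c1 +i* y))))
    = fun n => cintegral mu setT (fun x => - 'i * ((seg c1 c2 x)%:C * (F_ n (x +i* T) - F_ n (x +i* - T)))).
    by apply/funext => n; have [F' hF'] := hF n; exact: cauchy_rectangle hF'.
  have L : ccvg (fun n => cintegral mu setT (fun y => (seg (- T) T y)%:C * (F_ n (c2 +i* y) - F_ n (c1 +i* y))))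
      (cintegral mu setT (fun y => (seg (- T) T y)%:C * (F (c2 +i* y) - F (c1 +i* y)))).
    apply: (cintegral_cvg _ _ (integrable_mull (B + B) (integrable_seg (- T) T))) => [n|y|n y].
    - apply: cmeasurableM; first by apply: cmeasurable_real; exact: measurable_seg.
      apply: cmeasurableD; first exact: (tame_line_measurable (tF n)).1.
      by apply: cmeasurableN; exact: (tame_line_measurable (tF n)).1.
    - apply: ccvgM; first exact: ccvg_cst.
      by apply: ccvgD; [exact: cvF|apply: ccvgN; exact: cvF].
    - rewrite (normc_realM _ (seg_ge0 _ _ _)) mulrC.
      rewrite /seg; case: (boolP (- T <= y <= T)) => yT; last by rewrite !mulr0.
      rewrite !mulr1 (le_trans (le_normcD _ _))// normcN lerD// HB// ler_norml//.
  have L' : ccvg (fun n => cintegral mu setT (fun x => - 'i * ((seg c1 c2 x)%:C * (F_ n (x +i* T) - F_ n (x +i* - T)))))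
      (cintegral mu setT (fun x => - 'i * ((seg c1 c2 x)%:C * (F (x +i* T) - F (x +i* - T))))).
    apply: (cintegral_cvg _ _ (integrable_mull (B + B) (integrable_seg c1 c2))) => [n|x|n x].
    - apply: cmeasurableM; first exact: cmeasurable_cst.
      apply: cmeasurableM; first by apply: cmeasurable_real; exact: measurable_seg.
      apply: cmeasurableD; first exact: (tame_line_measurable (tF n)).2.
      by apply: cmeasurableN; exact: (tame_line_measurable (tF n)).2.
    - by apply: ccvgM; [exact: ccvg_cst|exact: segcv].
    - rewrite normcM normcN normc_i mul1r (normc_realM _ (seg_ge0 _ _ _)) mulrC.
      rewrite /seg; case: (boolP (c1 <= x <= c2)) => xc; last by rewrite !mulr0.
      rewrite !mulr1 (le_trans (le_normcD _ _))// normcN lerD// HB// ?normrN ger0_norm// ltW//.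
  rewrite E in L; exact: ccvg_unique L L'.
have L : ccvg (fun n => cintegral mu setT (fun y => (seg (- n.+1%:R) n.+1%:R y)%:C * (F (c2 +i* y) - F (c1 +i* y))))
   (cintegral mu setT (fun y => F (c2 +i* y) - F (c1 +i* y))).
  apply: (cintegral_cvg _ _ (integrable_mull 2 ig)) => [n|y|n y].
  - apply: cmeasurableM; first by apply: cmeasurable_real; exact: measurable_seg.
    by apply: cmeasurableD; [exact: mFv|apply: cmeasurableN; exact: mFv].
  - rewrite -[X in ccvg _ X]mul1r; apply: ccvgM; last exact: ccvg_cst.
    apply: ccvg_real; apply: cvg_near_cst; near=> n.
    rewrite /seg (_ : _ <= y <= _)// -ler_norml (@le_trans _ _ n%:R)// ?ler_nat//.
    by near: n; exact: nbhs_infty_ger.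
  - rewrite (normc_realM _ (seg_ge0 _ _ _)).
    have H : normc (F (c2 +i* y) - F (c1 +i* y)) <= 2 * g y.
      by rewrite (le_trans (le_normcD _ _))// normcN mulrDl mul1r lerD// Fg.
    rewrite -[leRHS]mul1r (ler_pM (seg_ge0 _ _ _) (normc_ge0 _) _ H)// /seg.
    by case: (_ <= _ <= _).
have g1' : g n.+1%:R @[n --> \oo] --> (0 : R) by rewrite (@cvg_shiftS _ (fun n => g n%:R)).
have g2' : g (- n.+1%:R) @[n --> \oo] --> (0 : R) by rewrite (@cvg_shiftS _ (fun n => g (- n%:R))).
have L' : ccvg (fun n => cintegral mu setT (fun x => - 'i * ((seg c1 c2 x)%:C *
    (F (x +i* n.+1%:R) - F (x +i* - n.+1%:R))))) (cintegral mu setT (fun x : measurableTypeR R => 0)).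
  have gn : (g n.+1%:R + g (- n.+1%:R)) @[n --> \oo] --> (0 : R).
    have H : g n.+1%:R + g (- n.+1%:R) @[n --> \oo] --> (0 : R) + 0 by exact: cvgD.
    by rewrite addr0 in H.
  have [M [_ HM]] := cvg_seq_bounded (cvgP _ gn).
  pose B := M + 1.
  have HB n : g n.+1%:R + g (- n.+1%:R) <= B.
    have := HM B; rewrite /B ltrDl ltr01 => /(_ isT n I) /=.
    exact: le_trans (ler_norm _).
  have bnd n x : normc (- 'i * ((seg c1 c2 x)%:C * (F (x +i* n.+1%:R) - F (x +i* - n.+1%:R))))
      <= seg c1 c2 x * (g n.+1%:R + g (- n.+1%:R)).
    rewrite normcM normcN normc_i mul1r (normc_realM _ (seg_ge0 _ _ _)).
    rewrite /seg; case: (boolP (c1 <= x <= c2)) => xc; last by rewrite !mul0r.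
    by rewrite !mul1r (le_trans (le_normcD _ _))// normcN lerD// Fg.
  apply: (cintegral_cvg _ _ (integrable_mull B (integrable_seg c1 c2))) => [n|x|n x].
  - apply: cmeasurableM; first exact: cmeasurable_cst.
    exact: msegF.
  - apply: ccvg0 (fun n => bnd n x) _.
    have H : seg c1 c2 x * (g n.+1%:R + g (- n.+1%:R)) @[n --> \oo] --> seg c1 c2 x * 0.
      by apply: cvgM; [exact: cvg_cst|exact: gn].
    by rewrite mulr0 in H.
  - by rewrite (le_trans (bnd n x))// mulrC (ler_wpM2r (seg_ge0 _ _ _) (HB n)).
have L2 := ccvg_unique L.
have E : (fun n => cintegral mu setT (fun y => (seg (- n.+1%:R) n.+1%:R y)%:C * (F (c2 +i* y) - F (c1 +i* y))))
   = (fun n => cintegral mu setT (fun x => - 'i * ((seg c1 c2 x)%:C *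
    (F (x +i* n.+1%:R) - F (x +i* - n.+1%:R))))).
  by apply/funext => n; apply: rect.
rewrite E in L; have := ccvg_unique L L'.
have iF x : c1 <= x <= c2 -> cintegrable mu (fun y => F (x +i* y)).
  by move=> xc; apply: (cintegrable_dom (mFv x xc) ig) => y; exact: Fg.
move=> H0; have H1 := etrans H0 (cintegral0 _).
have H2 := cintegralB (iF _ c2c) (iF _ c1c).
by apply/eqP; rewrite -subr_eq0; apply/eqP; exact: etrans (esym H2) H1.
Unshelve. all: by end_near. Qed.

End contour.

Opaque cexp ComplexField.Normc.normc Gamma.
(** * Decay of quotients of Gamma factors *)

Section power_decay.
Context {R : realType}.
Local Notation mu := (@lebesgue_measure R).

(** [min (1, |y| ^ - q)] *)
Definition pdecay (q y : R) : R := expR (- q * Num.max 0 (ln `|y|)).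

Lemma pdecay_gt0 q y : 0 < pdecay q y. Proof. exact: expR_gt0. Qed.

Lemma pdecayN q y : pdecay q (- y) = pdecay q y.
Proof. by rewrite /pdecay normrN. Qed.

Lemma measurable_pdecay q : measurable_fun setT (pdecay q : measurableTypeR R -> R).
Proof.
apply: measurableT_comp => //; apply: measurable_funM => //.
apply: measurable_maxr => //; apply: measurableT_comp; first exact: measurable_ln.
by apply: continuous_measurable_fun; exact: norm_continuous.
Qed.

Lemma pdecay_cvg q : 1 < q -> pdecay q n%:R @[n --> \oo] --> (0 : R).
Proof.
move=> q1.
have H : forall n, pdecay q n.+1%:R <= (n.+1%:R)^-1.
  move=> n; have n0 : 0 < n.+1%:R :> R by rewrite ltr0n.
  have l0 : 0 <= ln (n.+1%:R : R) by rewrite ln_ge0// ler1n.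
  rewrite /pdecay (gtr0_norm n0) (max_idPr l0) -[leRHS]lnK ?posrE ?invr_gt0//.
  rewrite ler_expR lnV ?posrE// mulNr lerN2 ler_peMl//; exact: ltW.
rewrite -(@cvg_shiftS _ (fun n => pdecay q n%:R)).
apply: (squeeze_cvgr (_ : \forall n \near \oo, 0 <= pdecay q n.+1%:R <= (n.+1%:R)^-1)).
- by apply: nearW => n; rewrite H ltW// pdecay_gt0.
- exact: cvg_cst.
- exact: cvg_harmonic.
Qed.

(** In the variable [ln y] the decay is exponential at both ends. *)
Lemma integrable_pdecay q : 1 < q -> mu.-integrable setT (EFin \o pdecay q).
Proof.
move=> q1.
pose e := Num.min 1 (q - 1).
have e0 : 0 < e by rewrite lt_min ltr01 subr_gt0.
have half : (\int[mu]_(t in `]0%R, +oo[) (pdecay q t)%:E < +oo)%E.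
  rewrite ge0_integral_expR; last 2 first.
  - move=> t t0; have -> : pdecay q = (fun y => expR (- q * Num.max 0 (ln `|y|))) by [].
    apply: continuous_comp; last exact: continuous_expR.
    have cm : {for t, continuous (fun y : R => Num.max 0 (ln `|y|))}.
      apply: continuous_max; first exact: cvg_cst.
      apply: (@continuous_comp _ _ _ (fun y : R => `|y|) (@ln R)); first exact: norm_continuous.
      by apply: continuous_ln; rewrite normr_gt0 gt_eqF.
    by apply: cvgM; [exact: cvg_cst|exact: cm].
  - by move=> t; rewrite ltW// pdecay_gt0.
  have /integrableP[_] := integrable_expRNabs e0.
  apply: le_lt_trans; apply: ge0_le_integral => //.
  - by move=> u _; rewrite lee_fin mulr_ge0 ?expR_ge0.
  - apply/measurable_EFinP; apply: measurable_funM => //.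
    apply: measurableT_comp; first exact: measurable_pdecay.
    exact: measurable_expR.
  - apply/measurable_EFinP; apply: measurableT_comp => //.
    by apply: measurableT_comp => //; apply: measurableT_comp => //; apply: measurable_funM => //; exact: measurableT_comp.
  - move=> u _ /=; rewrite lee_fin (ger0_norm (expR_ge0 _)) /pdecay (gtr0_norm (expR_gt0 u)) expRK.
    rewrite -expRD ler_expR.
    have e1 : e <= 1 by rewrite ge_min lexx.
    have eq1 : e <= q - 1 by rewrite ge_min lexx orbT.
    have [u0|u0] := leP 0 u.
      by rewrite (ger0_norm u0); nra.
    by rewrite (ltr0_norm u0) mulr0 add0r; nra.
have mI : measurable (`]0%R, +oo[%classic : set (measurableTypeR R)) by exact: measurable_itv.
have iI : mu.-integrable (`]0%R, +oo[%classic : set (measurableTypeR R)) (EFin \o pdecay q).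
  apply/integrableP; split.
    by apply/measurable_EFinP; apply: measurable_funTS; exact: measurable_pdecay.
  apply: le_lt_trans half; apply: ge0_le_integral => //.
  - apply: measurableT_comp => //; apply/measurable_EFinP; apply: measurable_funTS; exact: measurable_pdecay.
  - apply/measurable_EFinP; apply: measurable_funTS; exact: measurable_pdecay.
  - by move=> t _ /=; rewrite lee_fin ger0_norm// ltW// pdecay_gt0.
have iJ : mu.-integrable setT (EFin \o (pdecay q \_ `]0%R, +oo[)).
  by have := (@integrable_mkcond _ (measurableTypeR R) R mu _ (EFin \o pdecay q) mI).1 iI; rewrite restrict_EFin.
have iS := integrableD measurableT (integrable_seg (-1) 1) (integrableD measurableT iJ (integrable_opp iJ)).
apply: integrable_dom iS _; first exact: measurable_pdecay.
move=> u; rewrite (ger0_norm (ltW (pdecay_gt0 _ _))) /=.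
have r0 t : 0 <= (pdecay q \_ `]0%R, +oo[) t.
  by rewrite patchE; case: ifP => // _; rewrite ltW// pdecay_gt0.
have rE t : 0 < t -> (pdecay q \_ `]0%R, +oo[) t = pdecay q t.
  by move=> t0; rewrite patchE mem_setE in_itv /= t0.
have [u0|u0] := ltP 0 u.
  by rewrite (rE _ u0) addrCA lerDl addr_ge0// seg_ge0.
move: u0; rewrite le_eqVlt => /predU1P[->|u0].
  rewrite (le_trans (_ : _ <= 1)) ?lerDl//.
    by rewrite /pdecay normr0 ln0// maxxx mulr0 expR0.
  by rewrite /seg oppr_le0 ler01 /= lerDl addr_ge0.
have u0' : 0 < - u by rewrite oppr_gt0.
by rewrite (rE _ u0') pdecayN addrA lerDr addr_ge0// seg_ge0.
Qed.

End power_decay.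

Section gamma_products.
Context {R : realType}.
Local Notation mu := (@lebesgue_measure R).
Implicit Types (L up lo : seq (R * R)) (s z : R[i]) (x y : R).

Definition arg (l : R * R) s : R[i] := l.1%:C + l.2%:C * s.

(** The integrand of the Fox function, without the power of its argument. *)
Definition fox_kernel up lo s : R[i] :=
  (\prod_(l <- lo) Gamma (arg l s)) / (\prod_(u <- up) Gamma (arg u s)).

(** Gauss's approximation of the kernel; the factors in the denominator are used
    as entire functions, and only those in the numerator need the strip to lie to
    the right of the poles. *)
Definition fox_gauss up lo n s : R[i] :=
  (\prod_(l <- lo) (gauss_inv n (arg l s))^-1) * (\prod_(u <- up) gauss_inv n (arg u s)).

Lemma Re_arg l x y : Re (arg l (x +i* y)) = l.1 + l.2 * x.
Proof. by rewrite !ReImE /=; ring. Qed.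

Lemma Im_arg l x y : Im (arg l (x +i* y)) = l.2 * y.
Proof. by rewrite !ReImE /=; ring. Qed.

Lemma fox_gauss_cvg up lo x y : (forall l, l \in lo -> 0 < l.1 + l.2 * x) ->
  ccvg (fun n => fox_gauss up lo n (x +i* y)) (fox_kernel up lo (x +i* y)).
Proof.
move=> lo0; rewrite /fox_kernel -prodfV; apply: ccvgM; last first.
  by apply: ccvg_prod => u; exact: gauss_inv_cvg.
elim: lo lo0 => [|l lo IH] lo0.
  rewrite big_nil; under [X in ccvg X]eq_fun do rewrite big_nil; exact: ccvg_cst.
rewrite big_cons; under [X in ccvg X]eq_fun do rewrite big_cons.
apply: ccvgM; last by apply: IH => l' l'lo; apply: lo0; rewrite in_cons l'lo orbT.
by apply: gauss_cvg_Gamma; rewrite Re_arg lo0// mem_head.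
Qed.

Section strip.
Variables c1 c2 : R.
Hypothesis c12 : c1 < c2.

Lemma holo_gauss_inv n l : exists H', holo c1 c2 (fun s => gauss_inv n (arg l s)) H'.
Proof.
pose r : R := ln n.+1%:R.
have [P' hP] : exists P', holo c1 c2 (fun s => \prod_(j <- enum 'I_n.+2) ((l.1 + j%:R)%:C + l.2%:C * s)) P'.
  by apply: holo_prod => j _; eexists; exact: holo_affine.
have hE := holo_cexp (holo_affine c1 c2 (- (l.1 * r))%:C (- (l.2 * r))%:C).
eexists.
rewrite (_ : (fun s => _) = fun s => ((\prod_(j <- enum 'I_n.+2) ((l.1 + j%:R)%:C + l.2%:C * s)) * (n.+1`!%:R)^-1) *
  cexp ((- (l.1 * r))%:C + (- (l.2 * r))%:C * s)).
  exact: (holoM (holoM hP (holo_cst c1 c2 (n.+1`!%:R)^-1)) hE).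
apply/funext => s; rewrite /gauss_inv; congr (_ * _ * cexp _).
  rewrite big_enum; apply: eq_bigr => j _.
  by rewrite /arg rmorphD /= rmorph_nat addrAC.
by rewrite /arg !rmorphN !rmorphM mulrDl opprD /= mulrAC mulNr.
Qed.

Lemma normc_arg_le l x y T : c1 <= x <= c2 -> `|y| <= T ->
  normc (arg l (x +i* y)) <= `|l.1| + `|l.2| * (`|c1| + `|c2| + T).
Proof.
move=> /andP[x1 x2] yT.
rewrite /arg (le_trans (le_normcD _ _))// normc_real lerD2l normcM normc_real.
rewrite ler_wpM2l//.
have -> : x +i* y = x%:C + 'i * y%:C by apply: complex_ext; rewrite !ReImE /=; ring.
rewrite (le_trans (le_normcD _ _))// normcM !normc_real normc_i mul1r.
rewrite lerD//.
by apply: normr_itv; rewrite x1 x2.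
Qed.

Lemma gauss_inv_arg_le l T : exists B, forall n x y, c1 <= x <= c2 -> `|y| <= T ->
  normc (gauss_inv n (arg l (x +i* y))) <= B.
Proof.
pose Z := `|l.1| + `|l.2| * (`|c1| + `|c2| + T).
exists (Z * expR (Z + Z ^+ 2)) => n x y xc yT.
have Hz := normc_arg_le l xc yT.
rewrite (le_trans (gauss_inv_le _ _))// ler_pM ?normc_ge0 ?expR_ge0// ler_expR lerD//.
  exact: le_trans (normr_Re _) Hz.
by rewrite lerXn2r// ?nnegrE ?normc_ge0//; exact: le_trans (normc_ge0 _) Hz.
Qed.

Lemma gauss_inv_arg_ge l : 0 < l.2 -> 0 < l.1 + l.2 * c1 -> exists2 e, 0 < e &
  forall n x y, c1 <= x <= c2 -> e <= normc (gauss_inv n (arg l (x +i* y))).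
Proof.
move=> l2 lc1; pose X := l.1 + l.2 * c2.
exists ((l.1 + l.2 * c1) * expR (- (2 * X ^+ 2))); first by rewrite mulr_gt0 ?expR_gt0.
move=> n x y /andP[x1 x2].
have h1 : l.1 + l.2 * c1 <= l.1 + l.2 * x by rewrite lerD2l ler_wpM2l// ltW.
have h2 : l.1 + l.2 * x <= X by rewrite lerD2l ler_wpM2l// ltW.
have z0 : 0 < Re (arg l (x +i* y)) by rewrite Re_arg; lra.
apply: le_trans (gauss_inv_ge n z0); rewrite Re_arg.
rewrite ler_pM ?expR_ge0 ?(ltW lc1)// ler_expR lerN2 ler_wpM2l// lerXn2r// nnegrE; lra.
Qed.


Lemma normc_prod_bounded (I : eqType) (r : seq I) (F : I -> nat -> R -> R -> R[i]) (P : R -> R -> Prop) :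
  (forall i, i \in r -> exists B, forall n x y, P x y -> normc (F i n x y) <= B) ->
  exists B, forall n x y, P x y -> normc (\prod_(i <- r) F i n x y) <= B.
Proof.
elim: r => [_|i r IH H].
  by exists 1 => n x y _; rewrite big_nil ComplexField.Normc.normc1.
have [|B HB] := IH; first by move=> j jr; apply: H; rewrite in_cons jr orbT.
have [B' HB'] := H i (mem_head _ _).
exists (B' * B) => n x y xy; rewrite big_cons normcM.
by rewrite ler_pM ?normc_ge0//; [exact: HB'|exact: HB].
Qed.

Variables up lo : seq (R * R).
Hypothesis lo2 : forall l, l \in lo -> 0 < l.2.
Hypothesis lo1 : forall l, l \in lo -> 0 < l.1 + l.2 * c1.

Lemma holo_fox_gauss n : exists H', holo c1 c2 (fox_gauss up lo n) H'.
Proof.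
have [P1 h1] : exists P', holo c1 c2 (fun s => \prod_(l <- lo) (gauss_inv n (arg l s))^-1) P'.
  apply: holo_prod => l llo; have [H' hH] := holo_gauss_inv n l.
  eexists; apply: holoV hH _ => T.
  have [e e0 he] := gauss_inv_arg_ge (lo2 llo) (lo1 llo).
  by exists e => // x y xc _; exact: he.
have [P2 h2] : exists P', holo c1 c2 (fun s => \prod_(l <- up) gauss_inv n (arg l s)) P'.
  by apply: holo_prod => l _; exact: holo_gauss_inv.
eexists; exact: holoM h1 h2.
Qed.

Lemma fox_gauss_bounded T : exists B, forall n x y, c1 <= x <= c2 -> `|y| <= T ->
  normc (fox_gauss up lo n (x +i* y)) <= B.
Proof.
pose P x y := c1 <= x <= c2 /\ `|y| <= T.
have [B1 H1] : exists B, forall n x y, P x y ->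
    normc (\prod_(l <- lo) (gauss_inv n (arg l (x +i* y)))^-1) <= B.
  apply: (@normc_prod_bounded _ lo (fun l n x y => (gauss_inv n (arg l (x +i* y)))^-1)) => l llo.
  have [e e0 he] := gauss_inv_arg_ge (lo2 llo) (lo1 llo).
  exists e^-1 => n x y [xc _].
  have h := he n x y xc.
  rewrite normcV lef_pV2 ?posrE//; exact: lt_le_trans h.
have [B2 H2] : exists B, forall n x y, P x y ->
    normc (\prod_(l <- up) gauss_inv n (arg l (x +i* y))) <= B.
  apply: (@normc_prod_bounded _ up (fun l n x y => gauss_inv n (arg l (x +i* y)))) => l _.
  have [B HB] := gauss_inv_arg_le l T.
  by exists B => n x y [xc yT]; exact: HB.
exists (B1 * B2) => n x y xc yT; rewrite /fox_gauss normcM.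
by rewrite ler_pM ?normc_ge0//; [exact: H1|exact: H2].
Qed.

Lemma lo_pos x : c1 <= x -> forall l, l \in lo -> 0 < l.1 + l.2 * x.
Proof.
move=> c1x l llo; rewrite (lt_le_trans (lo1 llo))// lerD2l ler_wpM2l// ltW//; exact: lo2.
Qed.

Lemma fox_gauss_cvg_strip x y : c1 <= x <= c2 ->
  ccvg (fun n => fox_gauss up lo n (x +i* y)) (fox_kernel up lo (x +i* y)).
Proof. by move=> /andP[x1 _]; apply: fox_gauss_cvg; exact: lo_pos. Qed.

Lemma fox_kernel_bounded T : exists B, forall x y, c1 <= x <= c2 -> `|y| <= T ->
  normc (fox_kernel up lo (x +i* y)) <= B.
Proof.
have [B HB] := fox_gauss_bounded T; exists B => x y xc yT.
apply: (cvgr_to_le (ccvg_normc (fox_gauss_cvg_strip y xc))).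
by apply: nearW => n; exact: HB.
Qed.

(** Stirling's exponent for the factor [Gamma (l.1 + l.2 s)]. *)
Definition stirling_exp (l : R * R) x y : R :=
  (l.1 + l.2 * x - 2^-1) * ln `|y| - pi / 2 * l.2 * `|y|.

Lemma stirling_arg l : 0 < l.2 -> exists C Y : R, forall x y, c1 <= x <= c2 -> Y <= `|y| ->
  exists2 t, normc (Gamma (arg l (x +i* y))) = expR t & `|t - stirling_exp l x y| <= C.
Proof.
move=> l2; pose A := l.1 + l.2 * c1; pose B := l.1 + l.2 * c2.
have [C HC] := stirling A B.
exists (C + (`|A| + `|B| + 1) * `|ln l.2|), (1 + l.2^-1) => x y /andP[x1 x2] yY.
have i0 : 0 < l.2^-1 by rewrite invr_gt0.
have y0 : 0 < `|y| by lra.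
have e : arg l (x +i* y) = (l.1 + l.2 * x) +i* (l.2 * y).
  by apply: complex_ext; rewrite ?Re_arg ?Im_arg.
have n2 : `|l.2 * y| = l.2 * `|y| by rewrite normrM (gtr0_norm l2).
have h1 : A <= l.1 + l.2 * x <= B by rewrite /A /B !lerD2l !ler_pM2l// x1 x2.
have h2 : 1 <= `|l.2 * y| by rewrite n2 mulrC -ler_pdivrMr// mul1r; lra.
have [t tE tb] := HC _ _ h1 h2; rewrite -e in tE; exists t => //.
rewrite n2 lnM ?posrE// in tb.
set X := l.1 + l.2 * x in h1 tb.
have -> : t - stirling_exp l x y = (t - ((X - 2^-1) * (ln l.2 + ln `|y|) - pi * (l.2 * `|y|) / 2)) +
   (X - 2^-1) * ln l.2.
  by rewrite /stirling_exp -/X; field.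
rewrite (le_trans (ler_normD _ _))// lerD// normrM ler_wpM2r//.
rewrite (le_trans (ler_normB _ _))//.
rewrite lerD ?(normr_itv h1)// (gtr0_norm (_ : 0 < 2^-1 :> R))//.
by rewrite invf_le1// ler1n.
Qed.

Lemma stirling_prod L : (forall l, l \in L -> 0 < l.2) ->
  exists C Y : R, forall x y, c1 <= x <= c2 -> Y <= `|y| ->
  exists2 t, normc (\prod_(l <- L) Gamma (arg l (x +i* y))) = expR t &
    `|t - \sum_(l <- L) stirling_exp l x y| <= C.
Proof.
elim: L => [_|l L IH H].
  exists 0, 0 => x y _ _; exists 0; first by rewrite big_nil ComplexField.Normc.normc1 expR0.
  by rewrite big_nil subrr normr0.
have [|C [Y HY]] := IH; first by move=> j jr; apply: H; rewrite in_cons jr orbT.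
have [C' [Y' HY']] := stirling_arg (H l (mem_head _ _)).
exists (C' + C), (Num.max Y' Y) => x y xc; rewrite ge_max => /andP[y1 y2].
have [t tE tb] := HY x y xc y2; have [t' tE' tb'] := HY' x y xc y1.
exists (t' + t); first by rewrite big_cons normcM tE tE' expRD.
rewrite big_cons (_ : _ - _ = (t' - stirling_exp l x y) + (t - \sum_(l <- L) stirling_exp l x y)).
  by rewrite (le_trans (ler_normD _ _))// lerD.
by ring.
Qed.

Hypothesis up2 : forall u, u \in up -> 0 < u.2.

(** The exponents a* and mu of the pair of parameter lists. *)
Definition fox_astar : R := \sum_(l <- lo) l.2 - \sum_(u <- up) u.2.
Definition fox_mu : R := \sum_(l <- lo) (l.1 - 2^-1) - \sum_(u <- up) (u.1 - 2^-1).

Lemma sum_stirling_exp L x y : \sum_(l <- L) stirling_exp l x y =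
  (\sum_(l <- L) (l.1 - 2^-1) + (\sum_(l <- L) l.2) * x) * ln `|y| -
    pi / 2 * (\sum_(l <- L) l.2) * `|y|.
Proof.
elim: L => [|l L IH]; first by rewrite !big_nil; ring.
by rewrite !big_cons IH /stirling_exp; ring.
Qed.

Lemma fox_kernel_stirling : exists C Y : R, forall x y, c1 <= x <= c2 -> Y <= `|y| ->
  normc (fox_kernel up lo (x +i* y)) <=
  expR (C + ((fox_mu + fox_astar * x) * ln `|y| - pi / 2 * fox_astar * `|y|)).
Proof.
have [C1 [Y1 H1]] := stirling_prod lo2; have [C2 [Y2 H2]] := stirling_prod up2.
exists (C1 + C2), (Num.max Y1 Y2) => x y xc; rewrite ge_max => /andP[y1 y2].
have [t1 E1 b1] := H1 x y xc y1; have [t2 E2 b2] := H2 x y xc y2.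
rewrite /fox_kernel normcM normcV E1 E2 -expRB ler_expR.
move: b1 b2; rewrite !sum_stirling_exp !ler_norml /fox_mu /fox_astar.
move: (\sum_(l <- lo) (l.1 - 2^-1)) (\sum_(u <- up) (u.1 - 2^-1)) => m1 m2.
move: (\sum_(l <- lo) l.2) (\sum_(u <- up) u.2) (ln `|y|) => s1 s2 ly.
move: `|y| => ay.
move=> /andP[h1 h2] /andP[h3 h4].
have -> : (m1 - m2 + (s1 - s2) * x) * ly - pi / 2 * (s1 - s2) * ay =
  ((m1 + s1 * x) * ly - pi / 2 * s1 * ay) - ((m2 + s2 * x) * ly - pi / 2 * s2 * ay) by ring.
by lra.
Qed.

Hypothesis decay : 0 < fox_astar \/ fox_astar = 0 /\ fox_mu < -1.

Lemma ln_le_linear (K e : R) : 0 <= K -> 0 < e -> exists C, forall t, 0 < t -> K * ln t <= C + e * t.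
Proof.
move=> K0 e0; pose r := (K + 1) / e.
have r0 : 0 < r by rewrite divr_gt0//; lra.
exists (K * ln r) => t t0.
have tr : ln t = ln r + ln (t / r).
  have e1 : t = r * (t / r) by rewrite mulrCA mulfV ?mulr1// gt_eqF.
  by rewrite {1}e1 lnM// posrE divr_gt0.
have h : ln (t / r) <= t / r by rewrite ltW// ln_sublinear// divr_gt0.
rewrite tr mulrDr lerD2l (le_trans (ler_wpM2l K0 h))//.
have -> : K * (t / r) = (K / (K + 1)) * (e * t).
  by rewrite /r; field; rewrite !gt_eqF//; lra.
rewrite ler_piMl ?mulr_ge0 ?(ltW e0) ?(ltW t0)// ler_pdivrMr; lra.
Qed.

(** On vertical strips the kernel is dominated by an integrable power: by an
    arbitrary one if a* > 0, by [|y| ^ mu] if a* = 0. *)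
Lemma fox_kernel_decay : exists q C : R, 1 < q /\ forall x y, c1 <= x <= c2 ->
  normc (fox_kernel up lo (x +i* y)) <= C * pdecay q y.
Proof.
have [C [Y HY]] := fox_kernel_stirling.
pose q : R := if 0 < fox_astar then 2 else - fox_mu.
have q1 : 1 < q.
  by rewrite /q; case: ifPn => [|na]; [lra|case: decay => [a0|[_]]; [rewrite a0 in na|lra]].
have [D HD] : exists D, forall x t, c1 <= x <= c2 -> 1 <= t ->
    (fox_mu + fox_astar * x) * ln t - pi / 2 * fox_astar * t <= D - q * ln t.
  rewrite /q; case: ifPn => [a0|na].
    have p0 : 0 < pi / 2 :> R := lt_le_trans ltr01 (pihalf_ge1 R).
    pose K := `|fox_mu| + fox_astar * (`|c1| + `|c2|) + 2.
    have K1 : 0 <= fox_astar * (`|c1| + `|c2|) by apply: mulr_ge0; [exact: ltW|exact: addr_ge0].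
    have K0 : 0 <= K by rewrite /K; have := normr_ge0 fox_mu; lra.
    have [D HD] := ln_le_linear K0 (mulr_gt0 p0 a0).
    exists D => x t /andP[x1 x2] t1.
    have t0 : 0 < t by lra.
    have := HD t t0; have l0 := ln_ge0 t1.
    have h : (fox_mu + fox_astar * x + 2) * ln t <= K * ln t.
      rewrite ler_wpM2r// /K lerD2r lerD ?ler_norm// ler_pM2l//.
      by rewrite (le_trans x2)// (le_trans (ler_norm c2))// lerDr.
    by rewrite mulrDl in h; lra.
  have [a0|[a0 mu1]] := decay; first by rewrite a0 in na.
  by exists 0 => x t _ _; rewrite a0; lra.
pose Y1 := Num.max 1 Y.
have [B HB] := fox_kernel_bounded Y1.
pose B1 := Num.max 0 B.
(* The second term covers [|y| <= Y1], where Stirling's bound does not apply. *)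
exists q, (expR (C + D) + B1 * expR (q * ln Y1)); split => // x y xc.
have Y11 : 1 <= Y1 by rewrite le_max lexx.
have lY : 0 <= ln Y1 by rewrite ln_ge0.
have B10 : 0 <= B1 by rewrite le_max lexx.
have [yY|yY] := leP `|y| Y1.
  apply: (@le_trans _ _ (B1 * expR (q * ln Y1) * pdecay q y)); last first.
    by rewrite ler_wpM2r ?(ltW (pdecay_gt0 _ _))// lerDr expR_ge0.
  apply: (@le_trans _ _ B1).
    by rewrite le_max (HB _ _ xc yY) orbT.
  rewrite -mulrA -[leLHS]mulr1 ler_wpM2l// -expRD -[leLHS]expR0 ler_expR.
  rewrite mulNr -mulrBr mulr_ge0//; first by lra.
  rewrite subr_ge0 ge_max lY/=.
  have [->|y0] := eqVneq y 0; first by rewrite normr0 ln0.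
  by rewrite ler_ln ?posrE ?normr_gt0//; lra.
have y1 : 1 <= `|y| by lra.
apply: (@le_trans _ _ (expR (C + D) * pdecay q y)); last first.
  by rewrite ler_wpM2r ?(ltW (pdecay_gt0 _ _))// lerDl mulr_ge0// expR_ge0.
apply: le_trans (HY x y xc _) _.
  by rewrite (le_trans _ (ltW yY))// le_max lexx orbT.
rewrite -expRD ler_expR (max_idPr (ln_ge0 y1)) mulNr.
by have := HD x `|y| xc y1; lra.
Qed.

End strip.
End gamma_products.

(** * Fox functions in an exponential variable *)

Section fox_function.
Context {R : realType}.
Local Notation mu := (@lebesgue_measure R).
Implicit Types (c u x y z : R).

Lemma inverse_mellinE c (F : R[i] -> R[i]) u : inverse_mellin c F (expR u) =
  ((2 * pi)^-1)%:C * cintegral mu setT (fun y => F (c +i* y) * cexp (- (c +i* y) * u%:C)).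
Proof.
rewrite /inverse_mellin /vertical_integral mulrA; congr (_ * _); last first.
  by apply: eq_cintegral => y; rewrite /cpow expRK.
rewrite invfM mulrAC -mulrA divff; last by apply: Im_neq0; rewrite /= oner_neq0.
by rewrite mulr1 -[2 * pi%:C](_ : (2 * pi)%:C = _) ?fmorphV// rmorphM rmorph_nat.
Qed.

(** Translate Euler's integral by [ln z]. *)
Lemma Gamma_scaled (w : R[i]) z : 0 < Re w -> 0 < z ->
  cintegral mu setT (fun u => cexp (w * u%:C) * (expR (- (z * expR u)))%:C) =
  Gamma w * cexp (- (w * (ln z)%:C)).
Proof.
move=> w0 z0; rewrite GammaE// Euler_integralE.
rewrite -(cintegral_shift (ln z) (measurable_euler_exp w)) -cintegralZr.
  apply: eq_cintegral => u.
  rewrite /euler_exp -cexp_real -!cexpD; congr cexp.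
  have -> : expR (u + ln z) = z * expR u by rewrite expRD lnK ?posrE// mulrC.
  have -> : (- (z * expR u))%:C = - (z * expR u)%:C :> R[i] by rewrite rmorphN.
  have -> : (u + ln z)%:C = u%:C + (ln z)%:C :> R[i] by rewrite rmorphD.
  by rewrite mulrDr (addrAC _ (- _)) addrK.
have [h1 h2] := cintegrable_euler_exp w0; split.
  exact: (integrable_shift (ln z) h1).
exact: (integrable_shift (ln z) h2).
Qed.

Variables up lo : seq (R * R).
Hypothesis lo2 : forall l, l \in lo -> 0 < l.2.
Hypothesis up2 : forall l, l \in up -> 0 < l.2.
Hypothesis decay : 0 < fox_astar up lo \/ fox_astar up lo = 0 /\ fox_mu up lo < -1.

Local Notation M := (fox_kernel up lo).

(** The rightmost pole of [Gamma (l.1 + l.2 s)] is [- l.1 / l.2]. *)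
Definition right_of_poles c := forall l, l \in lo -> 0 < l.1 + l.2 * c.

Lemma right_of_polesW c c' : right_of_poles c -> c <= c' -> right_of_poles c'.
Proof.
by move=> Pc cc l llo; rewrite (lt_le_trans (Pc l llo))// lerD2l ler_wpM2l// ltW// lo2.
Qed.

(** The Fox function at [exp u]: there the inverse Mellin transform is a Fourier
    integral along the line [Re s = c]. *)
Definition fox_log c u : R[i] :=
  ((2 * pi)^-1)%:C * cintegral mu setT (fun y => M (c +i* y) * cexp (- (c +i* y) * u%:C)).

Lemma foxH_log c u : foxH c up lo (expR u) = fox_log c u.
Proof. exact: inverse_mellinE. Qed.

Lemma kernel_measurable c : right_of_poles c ->
  cmeasurable (fun y : measurableTypeR R => M (c +i* y)).
Proof.
move=> Pc.
have c1 : c < c + 1 by rewrite ltrDl.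
apply: (@cmeasurable_cvg _ _ _ (fun n y => fox_gauss up lo n (c +i* y))) => [n|y].
  have [F' [tF _ _]] := holo_fox_gauss (c + 1) up lo2 Pc n.
  exact: (tame_line_measurable tF).1.
exact: fox_gauss_cvg.
Qed.

Lemma kernel_dominated c : right_of_poles c -> exists k : R -> R,
  mu.-integrable setT (EFin \o k) /\ forall y, normc (M (c +i* y)) <= k y.
Proof.
move=> Pc; have c1 : c < c + 1 by rewrite ltrDl.
have [q [C [q1 H]]] := fox_kernel_decay (c + 1) lo2 Pc up2 decay.
exists (fun y => C * pdecay q y); split; first exact: integrable_mull (integrable_pdecay q1).
by move=> y; apply: H; rewrite lexx ltW.
Qed.

Lemma normc_cexp_line c y u : normc (cexp (- (c +i* y) * u%:C)) = expR (- c * u).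
Proof. by rewrite normc_cexp !ReImE /= mulr0 subr0. Qed.

(** By [fox_kernel_decay], [contour_shift] applies to the kernel times [exp (- s u)]. *)
Lemma fox_log_shift c1 c2 u : right_of_poles c1 -> right_of_poles c2 ->
  fox_log c1 u = fox_log c2 u.
Proof.
wlog c12 : c1 c2 / c1 < c2.
  move=> H P1 P2; case: (ltgtP c1 c2) => [lt|gt|->//]; first exact: H.
  exact/esym/H.
move=> P1 _; congr (_ * _); apply/esym.
have [q [C [q1 H]]] := fox_kernel_decay c2 lo2 P1 up2 decay.
pose E := expR ((`|c1| + `|c2|) * `|u|).
have bE x y : c1 <= x <= c2 -> normc (cexp (- (x +i* y) * u%:C)) <= E.
  move=> /andP[x1 x2]; rewrite normc_cexp_line ler_expR (le_trans (ler_norm _))//.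
  rewrite normrM normrN ler_wpM2r//.
  by apply: normr_itv; rewrite x1 x2.
pose g y := (C * E) * pdecay q y.
apply: (@contour_shift _ _ _ c12 (fun n s => fox_gauss up lo n s * cexp (- s * u%:C))
   (fun s => M s * cexp (- s * u%:C)) g).
- move=> n; have [F' hF] := holo_fox_gauss c2 up lo2 P1 n.
  have hE := holo_cexp (holo_affine c1 c2 0 (- u%:C)).
  eexists; have := holoM hF hE; congr holo; apply/funext => s.
  have -> : 0 + - u%:C * s = - s * u%:C by rewrite add0r !mulNr mulrC.
  by [].
- move=> x y xc; apply: ccvgM; last exact: ccvg_cst.
  exact: (fox_gauss_cvg_strip up lo2 P1 y xc).
- move=> T; have [B HB] := fox_gauss_bounded c2 up lo2 P1 T.
  exists (B * E) => n x y xc yT; rewrite normcM.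
  by rewrite ler_pM ?normc_ge0//; [exact: HB|exact: bE].
- exact: integrable_mull (integrable_pdecay q1).
- move=> x y xc; rewrite normcM /g mulrAC.
  by rewrite ler_pM ?normc_ge0//; [exact: H|exact: bE].
- have h : C * E * pdecay q n%:R @[n --> \oo] --> C * E * 0.
    by apply: cvgM; [exact: cvg_cst|exact: pdecay_cvg].
  by rewrite mulr0 in h.
- have h : C * E * pdecay q n%:R @[n --> \oo] --> C * E * 0.
    by apply: cvgM; [exact: cvg_cst|exact: pdecay_cvg].
  rewrite mulr0 in h; rewrite /g; under eq_fun do rewrite pdecayN; exact: h.
Qed.

Definition fox_integrand c (p : R * R) : R[i] := M (c +i* p.2) * cexp (- (c +i* p.2) * p.1%:C).

Lemma measurable_fox_integrand c : right_of_poles c ->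
  cmeasurable (fox_integrand c : measurableTypeR R * measurableTypeR R -> R[i]).
Proof.
move=> Pc; have [m1 m2] := kernel_measurable Pc; apply: cmeasurableM.
  split.
    exact: (measurableT_comp (f := fun y => Re (M (c +i* y))) m1 measurable_snd).
  exact: (measurableT_comp (f := fun y => Im (M (c +i* y))) m2 measurable_snd).
apply: cmeasurable_cexp; apply: cmeasurableM.
  by apply: cmeasurableN; split; [exact: measurable_cst|exact: measurable_snd].
by apply: cmeasurable_real.
Qed.

Lemma normc_fox_integrand c (k : R -> R) u y : (forall y, normc (M (c +i* y)) <= k y) ->
  normc (fox_integrand c (u, y)) <= expR (- c * u) * k y.
Proof.
move=> Mk; rewrite /fox_integrand normcM normc_cexp_line mulrC.
by rewrite ler_wpM2l ?expR_ge0.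
Qed.

Lemma fox_log_Fubini c (w : R -> R) : right_of_poles c ->
  measurable_fun setT (w : measurableTypeR R -> R) ->
  mu.-integrable setT (EFin \o (fun u => `|w u| * expR (- c * u))) ->
  cintegral mu setT (fun u => (w u)%:C * fox_log c u) =
  ((2 * pi)^-1)%:C * cintegral mu setT (fun y => M (c +i* y) *
     cintegral mu setT (fun u => (w u)%:C * cexp (- (c +i* y) * u%:C))).
Proof.
move=> Pc mw iw; have [k [ik Mk]] := kernel_dominated Pc.
pose f (p : R * R) := (w p.1)%:C * fox_integrand c p.
have mf : cmeasurable (f : measurableTypeR R * measurableTypeR R -> R[i]).
  apply: cmeasurableM; last exact: measurable_fox_integrand.
  by apply: cmeasurable_real; exact: measurableT_comp.
have bf u y : normc (f (u, y)) <= `|w u| * expR (- c * u) * k y.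
  rewrite /f normcM normc_real -mulrA ler_wpM2l//.
  exact: normc_fox_integrand.
have Fub := cintegral_Fubini mf iw ik bf.
have fE u y : f (u, y) = (w u)%:C * (M (c +i* y) * cexp (- (c +i* y) * u%:C)) by [].
have i2 u : cintegrable mu (fun y => M (c +i* y) * cexp (- (c +i* y) * u%:C)).
  apply: (@cintegrable_dom _ (measurableTypeR R) R mu _ (fun y => expR (- c * u) * k y)).
  - have [m1 m2] := measurable_fox_integrand Pc; split.
      exact: (measurableT_comp m1 (measurable_pair1 u)).
    exact: (measurableT_comp m2 (measurable_pair1 u)).
  - exact: integrable_mull ik.
  - by move=> y; exact: (normc_fox_integrand u y Mk).
have i1 : cintegrable mu (fun u => cintegral mu setT (fun y => f (u, y))).
  split.
    apply: (integrable_fubini_dom mf.1 iw ik) => u y.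
    exact: le_trans (normr_Re _) (bf u y).
  apply: (integrable_fubini_dom mf.2 iw ik) => u y.
  exact: le_trans (normr_Im _) (bf u y).
transitivity (((2 * pi)^-1)%:C * cintegral mu setT (fun u => cintegral mu setT (fun y => f (u, y)))).
  rewrite -(cintegralZl _ i1); apply: eq_cintegral => u.
  by rewrite /fox_log mulrCA -(cintegralZl _ (i2 u)).
rewrite Fub; congr (_ * _); apply: eq_cintegral => y; rewrite -cintegralZl; last first.
  apply: (@cintegrable_dom _ (measurableTypeR R) R mu _ (fun u => `|w u| * expR (- c * u))) => [||u].
    apply: cmeasurableM; first exact: cmeasurable_real.
    apply: cmeasurable_cexp; apply: cmeasurableM; first exact: cmeasurable_cst.
    exact: cmeasurable_real.
    exact: iw.
  by rewrite normcM normc_real normc_cexp_line.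
by apply: eq_cintegral => u; rewrite fE mulrCA.
Qed.

(** Shifting the contour changes the decay of the Fox function at infinity
    into its growth at zero, and conversely. *)
Lemma fox_log_bound c : right_of_poles c ->
  exists B, forall u, `|Re (fox_log c u)| <= B * expR (- c * u).
Proof.
move=> Pc; have [k [ik Mk]] := kernel_dominated Pc.
exists ((2 * pi)^-1 * \int[mu]_y k y) => u.
have k0 : 0 <= (2 * pi : R)^-1 by rewrite invr_ge0 mulr_ge0// pi_ge0.
rewrite /fox_log !ReImE /= mul0r subr0 normrM (ger0_norm k0) -mulrA ler_wpM2l//.
have [m1 _] := measurable_fox_integrand Pc.
have mu1 := measurableT_comp m1 (measurable_pair1 u).
have ie : mu.-integrable setT (EFin \o (fun y => expR (- c * u) * k y)) by exact: integrable_mull.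
have bd y : `|Re (fox_integrand c (u, y))| <= expR (- c * u) * k y.
  by rewrite (le_trans (normr_Re _))// normc_fox_integrand.
rewrite (mulrC (\int[mu]_y k y)) -RintegralZl//.
apply: (@le_trans _ _ (\int[mu]_y `|Re (fox_integrand c (u, y))|)).
  apply: le_normr_Rintegral => //; exact: (integrable_dom mu1 ie).
apply: le_Rintegral => //.
apply: (@integrable_dom _ (measurableTypeR R) R mu _ (fun y => expR (- c * u) * k y)) => //.
  exact: measurableT_comp mu1.
by move=> y; rewrite normr_id.
Qed.

Lemma measurable_fox_log c : right_of_poles c ->
  measurable_fun setT (fun u : measurableTypeR R => Re (fox_log c u)).
Proof.
move=> Pc; have [k [ik Mk]] := kernel_dominated Pc.
pose v u := expR (c * u - `|u|).
have mv : measurable_fun setT (v : measurableTypeR R -> R).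
  apply: measurableT_comp => //; apply: measurable_funB; first exact: mulrl_measurable.
  exact: normr_measurable.
pose f (p : R * R) := v p.1 * Re (fox_integrand c p).
have mf : measurable_fun setT (f : measurableTypeR R * measurableTypeR R -> R).
  apply: measurable_funM; first exact: measurableT_comp.
  exact: (measurable_fox_integrand Pc).1.
have i1 : mu.-integrable setT (EFin \o (fun u => expR (- (1 * `|u|)))) by exact: integrable_expRNabs.
have bf u y : `|f (u, y)| <= expR (- (1 * `|u|)) * k y.
  rewrite normrM ger0_norm ?expR_ge0// (le_trans (ler_wpM2l (expR_ge0 _) (normr_Re _)))//.
  rewrite (le_trans (ler_wpM2l (expR_ge0 _) (normc_fox_integrand u y Mk)))// mulrA -expRD.
  by rewrite mul1r mulNr addrAC subrr add0r.
have /integrable_measurable mI := integrable_fubini_dom mf i1 ik bf.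
have -> : (fun u => Re (fox_log c u)) = fun u => (2 * pi)^-1 * (expR (`|u| - c * u) *
   \int[mu]_y f (u, y)).
  apply/funext => u; rewrite /fox_log !ReImE /= mul0r subr0; congr (_ * _).
  rewrite (_ : (\int[mu]_y f (u, y)) = v u * \int[mu]_y Re (fox_integrand c (u, y))); last first.
    have [m1 _] := measurable_fox_integrand Pc.
    have iu := (integrable_dom (measurableT_comp m1 (measurable_pair1 u)) (integrable_mull (expR (- c * u)) ik) (fun y => le_trans (normr_Re _) (normc_fox_integrand u y Mk))).
    exact: (RintegralZl (v u) measurableT iu).
  by rewrite mulrA /v -expRD addrA subrK subrr expR0 mul1r.
apply: measurable_funM => //; apply: measurable_funM => //.
apply: measurableT_comp => //; apply: measurable_funB; last exact: mulrl_measurable.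
exact: normr_measurable.
Qed.

(** The weights against which the Fox function is integrated are Euler's
    integrands in an exponential variable. *)
Lemma integrable_scaled_gamma a z : 0 < a -> 0 < z ->
  mu.-integrable setT (EFin \o (fun u => expR (a * u - z * expR u))).
Proof.
move=> a0 z0.
have := integrable_normc_euler_exp (z := a%:C) a0.
move=> /(integrable_shift (ln z)) /(integrable_mull (expR (- (a * ln z)))).
apply: eq_integrable => // u _ /=; rewrite -expRD; congr (expR _)%:E.
by rewrite expRD lnK ?posrE//; ring.
Qed.

Lemma Gamma_line_measurable g : 0 < g ->
  cmeasurable (fun y : measurableTypeR R => Gamma (g +i* y)).
Proof.
move=> g0; apply: (@cmeasurable_cvg _ _ _ (fun n y => fox_gauss [::] [:: (0, 1)] n (g +i* y))) => [n|y].
  have l2 (l : R * R) : l \in [:: (0, 1)] -> 0 < l.2 by rewrite inE => /eqP ->.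
  have l1 (l : R * R) : l \in [:: (0, 1)] -> 0 < l.1 + l.2 * g.
    by rewrite inE => /eqP -> /=; rewrite mul1r add0r.
  have g1 : g < g + 1 by rewrite ltrDl.
  have [F' [tF _ _]] := holo_fox_gauss (g + 1) [::] l2 l1 n.
  exact: (tame_line_measurable tF).1.
have -> : Gamma (g +i* y) = fox_kernel [::] [:: (0, 1)] (g +i* y).
  by rewrite /fox_kernel big_nil invr1 mulr1 big_seq1 /arg /= add0r mul1r.
by apply: fox_gauss_cvg => l; rewrite inE => /eqP -> /=; rewrite mul1r add0r.
Qed.

(** Laplace transform of a Fox function: Fubini's theorem turns the weight into
    a Gamma factor. *)
Lemma fox_laplace g z : 0 < g -> 0 < z -> right_of_poles (1 - g) ->
  cintegral mu setT (fun u => (expR (u - z * expR u))%:C * fox_log (1 - g) u) =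
  inverse_mellin g (fun s => Gamma s * M (1 - s)) z.
Proof.
move=> g0 z0 Pc; rewrite fox_log_Fubini//; last 2 first.
- apply: measurableT_comp => //; apply: measurable_funB => //.
  by apply: measurable_funM => //; exact: measurable_expR.
- have := integrable_scaled_gamma g0 z0; apply: eq_integrable => // u _ /=.
  by rewrite ger0_norm ?expR_ge0// -expRD; congr (expR _)%:E; ring.
rewrite -[in RHS](@lnK _ z) ?posrE// inverse_mellinE; congr (_ * _).
pose F y := M ((1 - g) +i* y) * (Gamma (g +i* (- y)) * cexp (- ((g +i* (- y)) * (ln z)%:C))).
have mF : cmeasurable (F : measurableTypeR R -> R[i]).
  apply: cmeasurableM; first exact: kernel_measurable.
  apply: cmeasurableM.
    have [m1 m2] := Gamma_line_measurable g0; split.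
      exact: (measurableT_comp m1 (@oppr_measurable R setT)).
    exact: (measurableT_comp m2 (@oppr_measurable R setT)).
  apply: cmeasurable_cexp; apply: cmeasurableN; apply: cmeasurableM.
    by split; [exact: measurable_cst|exact: (@oppr_measurable R setT)].
  exact: cmeasurable_cst.
transitivity (cintegral mu setT F).
  apply: eq_cintegral => y; rewrite /F; congr (_ * _).
  rewrite -(Gamma_scaled (w := g +i* (- y)))//; apply: eq_cintegral => u.
  rewrite -!cexp_real -!cexpD; congr cexp; apply: complex_ext; rewrite !ReImE /=; ring.
rewrite -(cintegral_opp mF); apply: eq_cintegral => y; rewrite /F opprK.
have -> : 1 - (g +i* y) = (1 - g) +i* (- y) by apply: complex_ext; rewrite !ReImE /= ?add0r.
by rewrite [RHS]mulrAC [RHS]mulrC mulNr.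
Qed.

(** Reflecting the weight replaces [1 - s] by [q + s]. *)
Lemma fox_laplace_inv q g z : 0 < g -> 0 < z -> right_of_poles (q + g) ->
  cintegral mu setT (fun u => (expR (q * u - z * expR (- u)))%:C * fox_log (q + g) u) =
  inverse_mellin g (fun s => Gamma s * M (q%:C + s)) z.
Proof.
move=> g0 z0 Pc; rewrite fox_log_Fubini//; last 2 first.
- apply: measurableT_comp => //; apply: measurable_funB; first exact: mulrl_measurable.
  by apply: measurable_funM => //; apply: measurableT_comp => //; exact: oppr_measurable.
- have := integrable_opp (integrable_scaled_gamma g0 z0); apply: eq_integrable => // u _ /=.
  by rewrite ger0_norm ?expR_ge0// -expRD; congr (expR _)%:E; ring.
rewrite -[in RHS](@lnK _ z) ?posrE// inverse_mellinE; congr (_ * _).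
apply: eq_cintegral => y.
have -> : q%:C + (g +i* y) = (q + g) +i* y by apply: complex_ext; rewrite !ReImE /= ?add0r.
rewrite [RHS]mulrAC [RHS]mulrC mulNr -(Gamma_scaled (w := g +i* y))// -cintegral_opp; last first.
  apply: cmeasurableM.
    apply: cmeasurable_real; apply: measurableT_comp => //.
    apply: measurable_funB; first exact: mulrl_measurable.
    by apply: measurable_funM => //; apply: measurableT_comp => //; exact: oppr_measurable.
  apply: cmeasurable_cexp; apply: cmeasurableM; first exact: cmeasurable_cst.
  exact: cmeasurable_real.
congr (_ * _).
apply: eq_cintegral => u.
rewrite -!cexp_real -!cexpD opprK; congr cexp; apply: complex_ext; rewrite !ReImE /=; ring.
Qed.

End fox_function.

(** * Gaussians *)

Section gaussian.
Context {R : realType}.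
Local Notation mu := (@lebesgue_measure R).
Implicit Types (x y t c : R).

Definition gauss1 t x : R := expR (- (x ^+ 2 / (2 * t))).

Lemma gauss1E t : 0 < t -> gauss1 t = fun x => Num.sqrt (2 * pi * t) * normal_pdf 0 (Num.sqrt t) x.
Proof.
move=> t0; apply/funext => x; rewrite /normal_pdf gt_eqF ?sqrtr_gt0//.
rewrite /normal_fun /normal_peak subr0 sqr_sqrtr ?(ltW t0)// /gauss1.
have -> : t * pi *+ 2 = 2 * pi * t by ring.
rewrite mulrA divff ?mul1r ?mulNr; last first.
  by rewrite gt_eqF// sqrtr_gt0 !mulr_gt0// pi_gt0.
by rewrite -(mulr_natl t 2).
Qed.

Lemma integrable_gauss1 t : 0 < t -> mu.-integrable setT (EFin \o gauss1 t).
Proof. by move=> t0; rewrite gauss1E//; apply: integrable_mull; exact: integrable_normal_pdf. Qed.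

Lemma Rintegral_gauss1 t : 0 < t -> \int[mu]_x gauss1 t x = Num.sqrt (2 * pi * t).
Proof.
move=> t0; rewrite gauss1E// RintegralZl//; last exact: integrable_normal_pdf.
by rewrite /Rintegral integral_normal_pdf mulr1.
Qed.

Lemma measurable_gauss1 t : measurable_fun setT (gauss1 t : measurableTypeR R -> R).
Proof.
by apply: measurableT_comp => //; apply: measurableT_comp => //; apply: measurable_funM => //; exact: measurable_funX.
Qed.

Lemma gauss1_cvg t : 0 < t -> gauss1 t n%:R @[n --> \oo] --> (0 : R).
Proof.
move=> t0; apply: (@squeeze_cvgr _ _ _ _ (fun=> 0) (fun n : nat => (2 * t) * (n%:R)^-1)).
- near=> n; have n0 : (0 < n%:R :> R) by rewrite ltr0n; near: n; exact: nbhs_infty_gt.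
  rewrite expR_ge0/= /gauss1 expRN -[leRHS]invrK lef_pV2 ?posrE ?expR_gt0//; last first.
    by rewrite invr_gt0 !mulr_gt0// invr_gt0.
  rewrite invfM invrK (le_trans _ (expR_ge1Dx _))// expr2 mulrC -mulrA.
  rewrite (le_trans (_ : _ <= n%:R * (n%:R / (2 * t)))) ?lerDr//.
  by rewrite ler_peMl// ?divr_ge0 ?mulr_ge0 ?(ltW t0)// ler1n -(ltr0n R).
- exact: cvg_cst.
- have h : 2 * t * (n%:R)^-1 @[n --> \oo] --> 2 * t * 0.
    apply: cvgM; first exact: cvg_cst.
    apply/gtr0_cvgV0; last exact: cvgr_idn.
    by near=> n; rewrite ltr0n; near: n; exact: nbhs_infty_gt.
  by rewrite mulr0 in h.
Unshelve. all: by end_near. Qed.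

(** On the strip between the two lines, [|exp (s ^ 2 / (2 t))|] is at most a
    constant times [gauss1 t (Im s)]. *)
Lemma gauss_contour t a : 0 < t -> 0 < a ->
  cintegral mu setT (fun x => cexp ((a +i* x) * (a +i* x) * ((2 * t)^-1)%:C)) =
  cintegral mu setT (fun x => cexp ((0 +i* x) * (0 +i* x) * ((2 * t)^-1)%:C)).
Proof.
move=> t0 a0.
pose F (s : R[i]) := cexp (s * s * ((2 * t)^-1)%:C).
have F2 x y : normc (F (x +i* y)) = expR (x ^+ 2 / (2 * t)) * gauss1 t y.
  by rewrite /F normc_cexp !ReImE /= -expRD; congr expR; ring.
have t2 : 0 < (2 * t)^-1 by rewrite invr_gt0 mulr_gt0.
have bF x y : 0 <= x <= a -> normc (F (x +i* y)) <= expR (a ^+ 2 / (2 * t)) * gauss1 t y.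
  move=> /andP[x0 xa]; rewrite F2 ler_wpM2r ?expR_ge0// ler_expR ler_wpM2r ?(ltW t2)//.
  by rewrite ler_sqr ?nnegrE// (ltW a0).
have g_cvg : expR (a ^+ 2 / (2 * t)) * gauss1 t n%:R @[n --> \oo] --> (0 : R).
  have h : expR (a ^+ 2 / (2 * t)) * gauss1 t n%:R @[n --> \oo] --> expR (a ^+ 2 / (2 * t)) * 0.
    by apply: cvgM; [exact: cvg_cst|exact: gauss1_cvg].
  by rewrite mulr0 in h.
apply: (@contour_shift _ _ _ a0 (fun=> F) F (fun y => expR (a ^+ 2 / (2 * t)) * gauss1 t y)).
- move=> _; have hi := holo_affine 0 a 0 1.
  have h0 : holo 0 a (fun s => (0 + 1 * s) * (0 + 1 * s) * ((2 * t)^-1)%:C) _ :=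
    holoM (holoM hi hi) (holo_cst 0 a _).
  eexists; have := holo_cexp h0; congr holo; apply/funext => s.
  by rewrite add0r mul1r.
- by move=> x y _; exact: ccvg_cst.
- move=> T; exists (expR (a ^+ 2 / (2 * t))) => _ x y xa _.
  rewrite (le_trans (bF _ _ xa))// ler_piMr ?expR_ge0// -[leRHS]expR0 ler_expR oppr_le0.
  by rewrite mulr_ge0 ?sqr_ge0 ?(ltW t2).
- exact: integrable_mull (integrable_gauss1 t0).
- exact: bF.
- exact: g_cvg.
- by have -> : (fun n : nat => expR (a ^+ 2 / (2 * t)) * gauss1 t (1 *- n)) =
    (fun n : nat => expR (a ^+ 2 / (2 * t)) * gauss1 t n%:R)
    by apply/funext => n; rewrite /gauss1 sqrrN.
Qed.

Lemma integrable_gauss1_cos t y c : 0 < t ->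
  mu.-integrable setT (EFin \o (fun x => gauss1 t x * cos (y * x + c))).
Proof.
move=> t0; apply: integrable_dom (integrable_gauss1 t0) _.
  apply: measurable_funM; first exact: measurable_gauss1.
  apply: measurableT_comp; first by apply: continuous_measurable_fun => z; exact: continuous_cos.
  by apply: measurable_funD => //; exact: mulrl_measurable.
by move=> x; rewrite normrM ger0_norm ?expR_ge0// ler_piMr ?expR_ge0// ler_norml cos_geN1 cos_le1.
Qed.

(** The line [Re s = t y] of [gauss_contour] completes the square. *)
Lemma gauss1_fourier t y c : 0 < t ->
  \int[mu]_x (gauss1 t x * cos (y * x + c)) =
  Num.sqrt (2 * pi * t) * expR (- (t * y ^+ 2 / 2)) * cos c.
Proof.
move=> t0; have t2 : t != 0 by rewrite gt_eqF.
have pos a : 0 < a -> \int[mu]_x (gauss1 t x * cos (a * x)) =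
      Num.sqrt (2 * pi * t) * expR (- (t * a ^+ 2 / 2)) /\
    \int[mu]_x (gauss1 t x * sin (a * x)) = 0.
  move=> a0; have at0 : 0 < a * t by rewrite mulr_gt0.
  have eR x : Re (cexp (((a * t) +i* x) * ((a * t) +i* x) * ((2 * t)^-1)%:C)) =
      expR (t * a ^+ 2 / 2) * (gauss1 t x * cos (a * x)).
    rewrite Re_cexp !ReImE /= mulrA -expRD; congr (expR _ * cos _); field; exact: t2.
  have eI x : Im (cexp (((a * t) +i* x) * ((a * t) +i* x) * ((2 * t)^-1)%:C)) =
      expR (t * a ^+ 2 / 2) * (gauss1 t x * sin (a * x)).
    rewrite Im_cexp !ReImE /= mulrA -expRD; congr (expR _ * sin _); field; exact: t2.
  have eR0 x : Re (cexp ((0 +i* x) * (0 +i* x) * ((2 * t)^-1)%:C)) = gauss1 t x.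
    rewrite -[RHS]mulr1 -[X in _ = _ * X]cos0 Re_cexp !ReImE /=.
    by congr (expR _ * cos _); ring.
  have eI0 x : Im (cexp ((0 +i* x) * (0 +i* x) * ((2 * t)^-1)%:C)) = 0.
    by rewrite Im_cexp !ReImE /= [X in sin X](_ : _ = 0) ?sin0 ?mulr0//; ring.
  have [E1 E2] : \int[mu]_x (expR (t * a ^+ 2 / 2) * (gauss1 t x * cos (a * x))) =
      \int[mu]_x gauss1 t x /\
    \int[mu]_x (expR (t * a ^+ 2 / 2) * (gauss1 t x * sin (a * x))) = 0.
    have := gauss_contour t0 at0; rewrite /cintegral => -[H1 H2]; split.
      rewrite -[RHS](_ : \int[mu]_x Re (cexp ((0 +i* x) * (0 +i* x) * ((2 * t)^-1)%:C)) = _); last first.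
        by congr (Rintegral _ _ _); apply/funext.
      by rewrite -H1; congr (Rintegral _ _ _); apply/funext => x; rewrite eR.
    transitivity (\int[mu]_x Im (cexp ((0 +i* x) * (0 +i* x) * ((2 * t)^-1)%:C))).
      by rewrite -H2; congr (Rintegral _ _ _); apply/funext => x; rewrite eI.
    rewrite (_ : (fun x => _) = fun=> 0); last by apply/funext.
    by rewrite Rintegral_cst//= mul0r.
  have ic := integrable_gauss1_cos a 0 t0.
  have isn := integrable_gauss1_cos a (- (pi / 2)) t0.
  rewrite RintegralZl// in E1; last first.
    by move: ic; apply: eq_integrable => // x _ /=; rewrite addr0.
  rewrite RintegralZl// in E2; last first.
    by move: isn; apply: eq_integrable => // x _ /=; rewrite cosBpihalf.
  rewrite Rintegral_gauss1// in E1; split.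
    rewrite -E1 mulrC mulrA -expRD addrC subrr expR0 mul1r//.
  by move/eqP: E2; rewrite mulf_eq0 gt_eqF ?expR_gt0//= => /eqP.
have all a : \int[mu]_x (gauss1 t x * cos (a * x)) =
      Num.sqrt (2 * pi * t) * expR (- (t * a ^+ 2 / 2)) /\
    \int[mu]_x (gauss1 t x * sin (a * x)) = 0.
  have [a0|a0|->] := ltgtP a 0; last 2 first.
  - exact: pos.
  - rewrite expr0n /= mulr0 mul0r oppr0 expR0 mulr1 -Rintegral_gauss1//; split.
      by congr (Rintegral _ _ _); apply/funext => x; rewrite mul0r cos0 mulr1.
    rewrite (_ : (fun x => _) = fun=> 0); last by apply/funext => x; rewrite mul0r sin0 mulr0.
    by rewrite Rintegral_cst//= mul0r.
  have [|H1 H2] := pos (- a); first by rewrite oppr_gt0.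
  split; first by rewrite -sqrrN -H1; congr (Rintegral _ _ _); apply/funext => x; rewrite mulNr cosN.
  have : - (\int[mu]_x (gauss1 t x * sin (a * x))) = 0; last by move/eqP; rewrite oppr_eq0 => /eqP.
  rewrite -mulN1r -RintegralZl//; last first.
    have := integrable_gauss1_cos a (- (pi / 2)) t0.
    by apply: eq_integrable => // x _ /=; rewrite cosBpihalf.
  by rewrite -H2; congr (Rintegral _ _ _); apply/funext => x; rewrite mulN1r (mulNr a) sinN mulrN.
have [H1 H2] := all y.
have ic := integrable_gauss1_cos y 0 t0.
have isn := integrable_gauss1_cos y (- (pi / 2)) t0.
transitivity (\int[mu]_x (cos c * (gauss1 t x * cos (y * x)) - sin c * (gauss1 t x * sin (y * x)))).
  by congr (Rintegral _ _ _); apply/funext => x; rewrite cosD; ring.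
have ic' : mu.-integrable setT (EFin \o (fun x => gauss1 t x * cos (y * x))).
  by move: ic; apply: eq_integrable => // x _ /=; rewrite addr0.
have isn' : mu.-integrable setT (EFin \o (fun x => gauss1 t x * sin (y * x))).
  by move: isn; apply: eq_integrable => // x _ /=; rewrite cosBpihalf.
rewrite RintegralB//; [|exact: integrable_mull|exact: integrable_mull].
by rewrite !RintegralZl// H1 H2 mulr0 subr0 mulrC.
Qed.

End gaussian.

Section gaussian_Rn.
Context {R : realType}.
Implicit Types (t c : R).

Lemma dotRn_cons n (a b : R) (x y : Rn R n) :
  dotRn (consRn (a, x)) (consRn (b, y)) = a * b + dotRn x y.
Proof.
rewrite /dotRn big_ord_recl !(tnth_nth 0) /=; congr (_ + _); apply: eq_bigr => i _.
by rewrite !(tnth_nth 0).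
Qed.

Lemma consRnP n (y : Rn R n.+1) : exists b (z : Rn R n), y = consRn (b, z).
Proof. by case/tupleP: y => b z; exists b, z; apply/val_inj. Qed.

Lemma measurable_dotRnl n (y : Rn R n) : measurable_fun setT (fun x : Rn R n => dotRn y x).
Proof.
apply: measurable_sum => i; apply: measurable_funM => //; exact: measurable_tnth.
Qed.

Lemma measurable_dotRn2 n : measurable_fun setT (fun x : Rn R n => dotRn x x).
Proof.
by apply: measurable_sum => i; apply: measurable_funM; exact: measurable_tnth.
Qed.

Lemma measurable_cosR : measurable_fun setT (cos : measurableTypeR R -> R).
Proof. by apply: continuous_measurable_fun => z; exact: continuous_cos. Qed.

Lemma measurable_cos_dotRn n (y : Rn R n) c :
  measurable_fun setT (fun x : Rn R n => cos (dotRn y x + c)).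
Proof.
apply: (measurableT_comp measurable_cosR); apply: measurable_funD => //.
exact: measurable_dotRnl.
Qed.

Definition gaussRn n t (x : Rn R n) : R := expR (- (dotRn x x / (2 * t))).

Lemma gaussRn_ge0 n t (x : Rn R n) : 0 <= gaussRn t x. Proof. exact: expR_ge0. Qed.

Lemma gaussRn_cons n t a (x : Rn R n) : gaussRn t (consRn (a, x)) = gauss1 t a * gaussRn t x.
Proof. by rewrite /gaussRn dotRn_cons /gauss1 -expRD -opprD mulrDl expr2. Qed.

Lemma measurable_gaussRn n t : measurable_fun setT (@gaussRn n t).
Proof.
apply: measurableT_comp => //; apply: measurableT_comp => //; apply: measurable_funM => //.
exact: measurable_dotRn2.
Qed.

Lemma lebesgue_Rn_cons_integral n (f : Rn R n.+1 -> R) (g1 : R -> R) (g2 : Rn R n -> R) :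
  measurable_fun setT f ->
  (@lebesgue_measure R).-integrable setT (EFin \o g1) ->
  (lebesgue_Rn R n).-integrable setT (EFin \o g2) ->
  (forall a x, `|f (consRn (a, x))| <= g1 a * g2 x) ->
  (lebesgue_Rn R n.+1).-integrable setT (EFin \o f) /\
  \int[lebesgue_Rn R n.+1]_x f x =
  \int[@lebesgue_measure R]_a \int[lebesgue_Rn R n]_x f (consRn (a, x)).
Proof.
move=> mf i1 i2 fg.
have mfc : measurable_fun setT (f \o @consRn R n).
  by apply: measurableT_comp => //; exact: measurable_consRn.
have ifc := integrable_prod_dom mfc i1 i2 fg.
have mfE : measurable_fun setT (EFin \o f) by exact/measurable_EFinP.
split; first exact: (integrable_pushforward (@measurable_consRn R n) mfE ifc measurableT).
rewrite [LHS]/Rintegral.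
have -> : (\int[lebesgue_Rn R n.+1]_x (f x)%:E =
   \int[(@lebesgue_measure R \x lebesgue_Rn R n)%E]_p (f (consRn p))%:E)%E.
  exact: (integral_pushforward (@measurable_consRn R n) mfE ifc measurableT).
rewrite -(integral12_prod_meas1 ifc) /Rintegral; congr fine; apply: eq_integral => a _.
rewrite fineK//; apply: integrable_fin_num => //.
have := integrable_section2 (f := f \o @consRn R n) mfc i2 fg a.
exact.
Qed.

(** By induction on the dimension: the Gaussian is a product, and the phase [c]
    absorbs the coordinate that is not yet integrated. *)
Lemma gaussRn_fourier n t : 0 < t ->
  (lebesgue_Rn R n).-integrable setT (EFin \o gaussRn t) /\
  forall (y : Rn R n) c, \int[lebesgue_Rn R n]_x (gaussRn t x * cos (dotRn y x + c)) =
    Num.sqrt (2 * pi * t) ^+ n * expR (- (t * dotRn y y / 2)) * cos c.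
Proof.
move=> t0; elim: n => [|n [IHi IHf]].
  have g1 (x : Rn R 0) : gaussRn t x = 1 by rewrite /gaussRn /dotRn big_ord0 mul0r oppr0 expR0.
  split.
    rewrite (_ : EFin \o _ = fun=> 1%:E); last by apply/funext => x /=; rewrite g1.
    apply/integrableP; split => //.
    by rewrite integral_dirac//= diracE in_setT mul1e normr1 ltry.
  move=> y c; rewrite /Rintegral integral_dirac//; last first.
    apply/measurable_EFinP; apply: measurable_funM; first exact: measurable_gaussRn.
    exact: measurable_cos_dotRn.
  rewrite diracE in_setT mul1e /= g1 /dotRn !big_ord0 add0r mulr0 mul0r oppr0 expR0.
  by rewrite expr0 !mul1r.
have bd a (x : Rn R n) : `|gaussRn t (consRn (a, x))| <= gauss1 t a * gaussRn t x.
  by rewrite ger0_norm ?gaussRn_ge0// gaussRn_cons.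
have [H _] := lebesgue_Rn_cons_integral (measurable_gaussRn (n := n.+1) t) (integrable_gauss1 t0) IHi bd.
split=> // y c; have [b [z ->]] := consRnP y.
pose f x := gaussRn t x * cos (dotRn (consRn (b, z)) x + c).
have mf : measurable_fun setT f.
  by apply: measurable_funM; [exact: measurable_gaussRn|exact: measurable_cos_dotRn].
have bf a (x : Rn R n) : `|f (consRn (a, x))| <= gauss1 t a * gaussRn t x.
  rewrite /f normrM -[leRHS]mulr1 ler_pM//.
  by rewrite ler_norml cos_geN1 cos_le1.
have [_ ->] := lebesgue_Rn_cons_integral mf (integrable_gauss1 t0) IHi bf.
transitivity (\int[@lebesgue_measure R]_a (Num.sqrt (2 * pi * t) ^+ n * expR (- (t * dotRn z z / 2)) *
   (gauss1 t a * cos (b * a + c)))).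
  congr (Rintegral _ _ _); apply/funext => a; rewrite /f.
  rewrite (_ : (fun x => _) = fun x => gauss1 t a * (gaussRn t x * cos (dotRn z x + (b * a + c)))); last first.
    by apply/funext => x; rewrite gaussRn_cons dotRn_cons -mulrA (addrC (b * a)) -addrA.
  rewrite RintegralZl//; last first.
    apply: integrable_dom IHi _.
      by apply: measurable_funM; [exact: measurable_gaussRn|exact: measurable_cos_dotRn].
    move=> x; rewrite normrM ger0_norm ?expR_ge0// ler_piMr ?expR_ge0// ler_norml.
    by rewrite cos_geN1 cos_le1.
  by rewrite IHf; ring.
rewrite RintegralZl//; last exact: integrable_gauss1_cos.
rewrite gauss1_fourier// dotRn_cons [_ ^+ n.+1]exprS.
rewrite (_ : - (t * (b * b + dotRn z z) / 2) = - (t * dotRn z z / 2) + - (t * b ^+ 2 / 2)); last by ring.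
by rewrite expRD; ring.
Qed.

End gaussian_Rn.

(** * Uniqueness of the Fourier transform *)

Section sign_iteration.
Context {R : realType}.
Implicit Types s t : R.

(** The cubic with attracting fixed points 1 and -1: its iterates on [-1, 1]
    approximate the sign function by polynomials. *)
Definition sign_step s : R := (3 * s - s ^+ 3) / 2.

Lemma sign_stepN s : sign_step (- s) = - sign_step s.
Proof. by rewrite /sign_step; ring. Qed.

Lemma sign_step_bounds e s : 0 < e <= 1 -> e <= s <= 1 ->
  e <= sign_step s <= 1 /\ 1 - sign_step s <= (1 - e / 2) * (1 - s).
Proof.
move=> /andP[e0 e1] /andP[es s1].
have s0 : 0 < s := lt_le_trans e0 es.
have E1 : 1 - sign_step s = (1 - s) * ((1 - s) * (2 + s) / 2) by rewrite /sign_step; field.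
have E2 : sign_step s - s = s * ((1 - s) * (1 + s)) / 2 by rewrite /sign_step; field.
have s1' : 0 <= 1 - s by rewrite subr_ge0.
split.
  rewrite -subr_ge0 -[_ <= 1]subr_ge0 E1.
  have -> : sign_step s - e = (s - e) + (sign_step s - s) by ring.
  rewrite E2; apply/andP; split.
    by rewrite addr_ge0 ?subr_ge0// divr_ge0// !mulr_ge0// ?(ltW s0)// addr_ge0 ?(ltW s0).
  by rewrite !mulr_ge0// addr_ge0// (ltW s0).
rewrite E1 mulrC ler_wpM2r// -subr_ge0.
have -> : 1 - e / 2 - (1 - s) * (2 + s) / 2 = (s - e) / 2 + s ^+ 2 / 2 by field.
by rewrite addr_ge0 ?divr_ge0 ?sqr_ge0// subr_ge0.
Qed.

Lemma iter_sign_step_gt0 s n : 0 < s <= 1 ->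
  s <= iter n sign_step s <= 1 /\ 1 - iter n sign_step s <= (1 - s / 2) ^+ n.
Proof.
move=> s01; have /andP[s0 s1] := s01.
elim: n => [|n [IH1 IH2]].
  by rewrite /= lexx s1 expr0; split=> //; rewrite gerBl ltW.
have [H1 H2] := sign_step_bounds s01 IH1.
split; first exact: H1.
rewrite iterS exprS (le_trans H2)// ler_wpM2l// subr_ge0 ler_pdivrMr//.
by rewrite mul1r (le_trans s1)// ler1n.
Qed.

Lemma iter_sign_stepN s n : iter n sign_step (- s) = - iter n sign_step s.
Proof. by elim: n => //= n ->; rewrite sign_stepN. Qed.

Lemma iter_sign_step0 n : iter n sign_step 0 = 0 :> R.
Proof. by elim: n => //= n ->; rewrite /sign_step mulr0 expr0n subr0 mul0r. Qed.

Lemma iter_sign_step_bound s n : `|s| <= 1 -> `|iter n sign_step s| <= 1.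
Proof.
have pos t : 0 < t <= 1 -> `|iter n sign_step t| <= 1.
  move=> t01; have [/andP[h1 h2] _] := iter_sign_step_gt0 n t01.
  by rewrite ger0_norm// (le_trans _ h1)//; case/andP: t01 => /ltW.
rewrite ler_norml => /andP[sN s1]; have [s0|s0|->] := ltgtP s 0; last 2 first.
- by apply: pos; rewrite s0.
- by rewrite iter_sign_step0 normr0.
by rewrite -(opprK s) iter_sign_stepN normrN pos// oppr_gt0 s0 lerNl.
Qed.

Lemma iter_sign_step_cvg s : `|s| <= 1 -> iter n sign_step s @[n --> \oo] --> Num.sg s.
Proof.
have pos t : 0 < t <= 1 -> iter n sign_step t @[n --> \oo] --> (1 : R).
  move=> t01; have /andP[t0 t1] := t01.
  apply: (@squeeze_cvgr _ _ _ _ (fun n => 1 - (1 - t / 2) ^+ n) (fun=> 1)).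
  - near=> n; have [/andP[_ h1] h2] := iter_sign_step_gt0 n t01.
    by rewrite h1 andbT lerBlDl -lerBlDr.
  - have h : 1 - (1 - t / 2) ^+ n @[n --> \oo] --> 1 - (0 : R).
      apply: cvgB; first exact: cvg_cst.
      apply: cvg_expr; rewrite ger0_norm ?ltrBlDr ?ltrDl ?divr_gt0//.
      by rewrite subr_ge0 ler_pdivrMr// mul1r (le_trans t1)// ler1n.
    by rewrite subr0 in h.
  - exact: cvg_cst.
rewrite ler_norml => /andP[sN s1]; have [s0|s0|->] := ltgtP s 0; last 2 first.
- by rewrite gtr0_sg//; apply: pos; rewrite s0.
- by rewrite sgr0; under eq_fun do rewrite iter_sign_step0; exact: cvg_cst.
rewrite ltr0_sg// -[s]opprK; under eq_fun do rewrite iter_sign_stepN.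
by apply: cvgN; apply: pos; rewrite oppr_gt0 s0 lerNl.
Unshelve. all: by end_near. Qed.

End sign_iteration.

Section fourier_uniqueness.
Context {R : realType} (n : nat).
Implicit Types (g k : Rn R n -> R) (y : Rn R n) (c : R).

Definition bounded_measurable g :=
  measurable_fun setT g /\ exists B, forall x, `|g x| <= B.

Lemma bmM g k : bounded_measurable g -> bounded_measurable k ->
  bounded_measurable (fun x => g x * k x).
Proof.
move=> [mg [B HB]] [mk [C HC]]; split; first exact: measurable_funM.
by exists (B * C) => x; rewrite normrM ler_pM.
Qed.

Lemma bmD g k : bounded_measurable g -> bounded_measurable k ->
  bounded_measurable (fun x => g x + k x).
Proof.
move=> [mg [B HB]] [mk [C HC]]; split; first exact: measurable_funD.
by exists (B + C) => x; rewrite (le_trans (ler_normD _ _))// lerD.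
Qed.

Lemma bm_cst c : bounded_measurable (fun=> c).
Proof. by split => //; exists `|c|. Qed.

Lemma bm_cos y c : bounded_measurable (fun x => cos (dotRn y x + c)).
Proof.
split; first exact: measurable_cos_dotRn.
by exists 1 => x; rewrite ler_norml cos_geN1 cos_le1.
Qed.

Lemma bm_integrable (mu : {measure set (Rn R n) -> \bar R}) f g :
  mu.-integrable setT (EFin \o f) -> bounded_measurable g ->
  mu.-integrable setT (EFin \o (fun x => g x * f x)).
Proof.
move=> fi [mg [B HB]].
apply: (@integrable_dom _ _ _ mu _ (fun x => B * `|f x|)).
- by apply: measurable_funM => //; exact: (integrable_measurable fi).
- by apply: integrable_mull; exact: (integrable_norm fi).
- by move=> x; rewrite normrM ler_wpM2r.
Qed.

Variables mu1 mu2 : {measure set (Rn R n) -> \bar R}.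
Variables f1 f2 : Rn R n -> R.
Hypothesis i1 : mu1.-integrable setT (EFin \o f1).
Hypothesis i2 : mu2.-integrable setT (EFin \o f2).

Definition same_fourier g := forall y c,
  \int[mu1]_x (g x * cos (dotRn y x + c) * f1 x) =
  \int[mu2]_x (g x * cos (dotRn y x + c) * f2 x).

(** The functions by which two measures of equal Fourier transform may be
    multiplied. They form an algebra closed under bounded pointwise limits. *)
Definition multiplier g := bounded_measurable g /\
  forall k, bounded_measurable k -> same_fourier k -> same_fourier (fun x => g x * k x).

Lemma multiplier_cst c : multiplier (fun=> c).
Proof.
split; first exact: bm_cst.
move=> k bk sk y c'.
have ik (m : {measure set (Rn R n) -> \bar R}) f : m.-integrable setT (EFin \o f) ->
    \int[m]_x (c * k x * cos (dotRn y x + c') * f x) =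
    c * \int[m]_x (k x * cos (dotRn y x + c') * f x).
  move=> fi; rewrite -RintegralZl//; last first.
    exact: (bm_integrable fi (bmM bk (bm_cos y c'))).
  by congr (Rintegral _ _ _); apply/funext => x; rewrite !mulrA.
by rewrite !ik// sk.
Qed.

Lemma multiplierM g h : multiplier g -> multiplier h -> multiplier (fun x => g x * h x).
Proof.
move=> [bg Hg] [bh Hh]; split; first exact: bmM.
move=> k bk sk; have := Hg _ (bmM bh bk) (Hh k bk sk).
by congr same_fourier; apply/funext => x; rewrite mulrA.
Qed.

Lemma multiplierD g h : multiplier g -> multiplier h -> multiplier (fun x => g x + h x).
Proof.
move=> [bg Hg] [bh Hh]; split; first exact: bmD.
move=> k bk sk y c.
have ik (m : {measure set (Rn R n) -> \bar R}) f : m.-integrable setT (EFin \o f) ->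
    \int[m]_x ((g x + h x) * k x * cos (dotRn y x + c) * f x) =
    \int[m]_x (g x * k x * cos (dotRn y x + c) * f x) +
    \int[m]_x (h x * k x * cos (dotRn y x + c) * f x).
  move=> fi; rewrite -RintegralD//.
  - by congr (Rintegral _ _ _); apply/funext => x; rewrite !mulrDl.
  - exact: (bm_integrable fi (bmM (bmM bg bk) (bm_cos y c))).
  - exact: (bm_integrable fi (bmM (bmM bh bk) (bm_cos y c))).
by rewrite !ik// (Hg k bk sk) (Hh k bk sk).
Qed.

Lemma multiplier_lim (g_ : nat -> Rn R n -> R) g B : (forall j, multiplier (g_ j)) ->
  (forall j x, `|g_ j x| <= B) -> (forall x, g_ j x @[j --> \oo] --> g x) -> multiplier g.
Proof.
move=> Mg gB gcvg.
have bg : bounded_measurable g.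
  split.
    apply: (measurable_fun_cvg (h := g_)) => [j|x _]; first by case: (Mg j) => -[].
    exact: gcvg.
  exists B => x; have hn : `|g_ j x| @[j --> \oo] --> `|g x| by exact: cvg_norm.
  by apply: (cvgr_to_le hn); exact: nearW.
split=> // k bk sk y c; have [mk [C kC]] := bk.
have ik (m : {measure set (Rn R n) -> \bar R}) f : m.-integrable setT (EFin \o f) ->
    \int[m]_x (g_ j x * k x * cos (dotRn y x + c) * f x) @[j --> \oo] -->
    \int[m]_x (g x * k x * cos (dotRn y x + c) * f x).
  move=> fi; apply: (Rintegral_cvg (g := fun x => B * C * `|f x|)).
  - move=> j; apply: (integrable_measurable (mu := m)).
    by apply: (bm_integrable fi (bmM (bmM _ bk) (bm_cos y c))); case: (Mg j).
  - move=> x; apply: cvgM; last exact: cvg_cst.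
    apply: cvgM; last exact: cvg_cst.
    by apply: cvgM; [exact: gcvg|exact: cvg_cst].
  - by apply: integrable_mull; exact: (integrable_norm fi).
  - move=> j x; rewrite normrM ler_wpM2r// normrM -[leRHS]mulr1 ler_pM//.
      by rewrite normrM ler_pM.
    by rewrite ler_norml cos_geN1 cos_le1.
have h1 := ik mu1 f1 i1; have h2 := ik mu2 f2 i2.
rewrite (_ : (fun j => _) = fun j => \int[mu2]_x (g_ j x * k x * cos (dotRn y x + c) * f2 x)) in h1.
  exact: (cvg_unique _ h1 h2).
by apply/funext => j; case: (Mg j) => _ /(_ k bk sk y c).
Qed.

(** The product of two cosines is a half-sum of cosines. *)
Lemma multiplier_cos y c : multiplier (fun x => cos (dotRn y x + c)).
Proof.
split; first exact: bm_cos.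
move=> k bk sk y' c'.
pose yD e : Rn R n := [tuple tnth y' i + e * tnth y i | i < n].
have dotD e x : dotRn (yD e) x = dotRn y' x + e * dotRn y x.
  rewrite /dotRn mulr_sumr -big_split; apply: eq_bigr => i _ /=.
  by rewrite tnth_mktuple mulrDl mulrA.
have ik (m : {measure set (Rn R n) -> \bar R}) f : m.-integrable setT (EFin \o f) ->
    \int[m]_x (cos (dotRn y x + c) * k x * cos (dotRn y' x + c') * f x) =
    2^-1 * (\int[m]_x (k x * cos (dotRn (yD 1) x + (c' + c)) * f x) +
    \int[m]_x (k x * cos (dotRn (yD (-1)) x + (c' - c)) * f x)).
  move=> fi.
  have J1 := bm_integrable fi (bmM bk (bm_cos (yD 1) (c' + c))).
  have J2 := bm_integrable fi (bmM bk (bm_cos (yD (- 1)) (c' - c))).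
  rewrite -RintegralD// -RintegralZl//; last exact: (integrableD measurableT J1 J2).
  congr (Rintegral _ _ _); apply/funext => x; rewrite !dotD.
  rewrite (_ : dotRn y' x + 1 * dotRn y x + (c' + c) =
    (dotRn y' x + c') + (dotRn y x + c)); last by ring.
  rewrite (_ : dotRn y' x + -1 * dotRn y x + (c' - c) =
    (dotRn y' x + c') - (dotRn y x + c)); last by ring.
  by move: (dotRn y x + c) (dotRn y' x + c') => u v; rewrite cosD cosB; field.
by rewrite !ik// !sk.
Qed.

Lemma multiplier_sg g : multiplier g -> (forall x, `|g x| <= 1) ->
  multiplier (fun x => Num.sg (g x)).
Proof.
move=> Mg g1; apply: (multiplier_lim (g_ := fun j x => iter j sign_step (g x)) (B := 1)).
- elim=> [//|j IH] /=; have M3 := multiplierM IH (multiplierM IH IH).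
  have := multiplierD (multiplierM (multiplier_cst (3 / 2)) IH) (multiplierM (multiplier_cst (- 2^-1)) M3).
  by congr multiplier; apply/funext => x; rewrite /sign_step; field.
- by move=> j x; exact: iter_sign_step_bound.
- by move=> x; exact: iter_sign_step_cvg.
Qed.

(** For [j] large, [sin ((x_i - a) / j)] has the sign of [x_i - a]. *)
Lemma multiplier_sg_coord i a : multiplier (fun x => Num.sg (tnth x i - a)).
Proof.
(* The phase [- pi / 2] below turns the cosine into a sine. *)
pose y j : Rn R n := [tuple (l == i)%:R / j.+1%:R | l < n].
apply: (multiplier_lim (g_ := fun j x => Num.sg (sin ((tnth x i - a) / j.+1%:R))) (B := 1)).
- move=> j; apply: multiplier_sg; last by move=> x; rewrite ler_norml sin_geN1 sin_le1.
  have := multiplier_cos (y j) (- a / j.+1%:R - pi / 2).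
  congr multiplier; apply/funext => x; rewrite addrA cosBpihalf; congr sin.
  rewrite mulrBl mulNr; congr (_ - _); rewrite /dotRn (bigD1 i)//= big1 ?addr0.
    by rewrite tnth_mktuple eqxx mul1r mulrC.
  by move=> l li; rewrite tnth_mktuple (negbTE li) !mul0r.
- by move=> j x; rewrite normr_sg; case: (_ != 0).
- move=> x; set t := tnth x i - a.
  have pos (s : R) : 0 < s -> \forall j \near \oo, Num.sg (sin (s / j.+1%:R)) = 1.
    move=> s0; near=> j; rewrite gtr0_sg//; apply: sin_gt0_pi.
    rewrite divr_gt0//= (@lt_le_trans _ _ 1)//.
      rewrite ltr_pdivrMr// mul1r; near: j.
      apply: filterS (nbhs_infty_gtr s) => j /= sj.
      by rewrite (lt_trans sj)// ltr_nat.
    by rewrite (le_trans _ (pi_ge2 R))// ler1n.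
  have [t0|t0|t0] := ltgtP t 0.
  - rewrite ltr0_sg//; apply: cvg_near_cst.
    have := pos (- t); rewrite oppr_gt0 => /(_ t0); apply: filterS => j.
    by rewrite mulNr sinN sgrN => /eqP; rewrite eqr_oppLR => /eqP.
  - by rewrite gtr0_sg//; apply: cvg_near_cst; exact: pos.
  - rewrite t0 sgr0; apply: cvg_near_cst; apply: nearW => j.
    by rewrite mul0r sin0 sgr0.
Unshelve. all: by end_near. Qed.

Definition multiplier_set (A : set (Rn R n)) := multiplier (\1_A).

Lemma multiplier_set_salgebra : sigma_algebra setT multiplier_set.
Proof.
split.
- by have := multiplier_cst 0; congr multiplier; apply/funext => x; rewrite indicE in_set0.
- move=> A MA; rewrite setTD.
  have := multiplierD (multiplier_cst 1) (multiplierM (multiplier_cst (-1)) MA).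
  congr multiplier; apply/funext => x; rewrite !indicE in_setC.
  by case: (x \in A); rewrite /= ?mulr1 ?mulr0 ?subrr ?addr0.
move=> A MA.
have MC j : multiplier (fun x => \prod_(k < j) (1 - \1_(A k) x)).
  elim: j => [|j IH].
    have := multiplier_cst 1; congr multiplier; apply/funext => x.
    by rewrite big_ord0.
  have := multiplierM IH (multiplierD (multiplier_cst 1) (multiplierM (multiplier_cst (-1)) (MA j))).
  by congr multiplier; apply/funext => x; rewrite big_ord_recr /= mulN1r.
have b01 (k : nat) (x : Rn R n) : (1 - \1_(A k) x : R) = (x \notin A k)%:R.
  by rewrite indicE; case: (x \in A k); rewrite ?subrr ?subr0.
have C01 j (x : Rn R n) : (\prod_(k < j) (1 - \1_(A k) x) : R) = [forall k : 'I_j, x \notin A k]%:R.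
  have [/forallP H|] := boolP [forall k : 'I_j, x \notin A k].
    by rewrite big1// => k _; rewrite b01 H.
  rewrite negb_forall => /existsP[k /negPn xk]; apply/eqP/prodf_eq0.
  by exists k => //; rewrite b01 xk.
apply: (multiplier_lim (g_ := fun j x => 1 - \prod_(k < j) (1 - \1_(A k) x)) (B := 1)).
- move=> j; have := multiplierD (multiplier_cst 1) (multiplierM (multiplier_cst (-1)) (MC j)).
  by congr multiplier; apply/funext => x; rewrite mulN1r.
- move=> j x; rewrite C01; case: [forall _, _] => /=; first by rewrite subrr normr0.
  by rewrite subr0 normr1.
- move=> x; rewrite indicE; have [|] := boolP (x \in \bigcup_k A k).
    rewrite inE => -[k _ xk]; apply: cvg_near_cst; near=> j.
    rewrite C01 (_ : [forall _, _] = false) ?subr0//.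
    apply/negbTE; rewrite negb_forall; apply/existsP.
    have kj : (k < j)%N by near: j; exact: nbhs_infty_gt.
    by exists (Ordinal kj); rewrite negbK inE.
  rewrite notin_setE => xA; apply: cvg_near_cst; near=> j.
  rewrite C01 (_ : [forall _, _] = true) ?subrr//; apply/forallP => k.
  by rewrite notin_setE => xk; apply: xA; exists k.
Unshelve. all: by end_near. Qed.

Lemma multiplier_coord i (B : set (measurableTypeR R)) : measurable B ->
  multiplier_set ((fun x => tnth x i) @^-1` B).
Proof.
have [S0 SC SU] := multiplier_set_salgebra.
pose D := [set B : set R | multiplier_set ((fun x : Rn R n => tnth x i) @^-1` B)].
suff : measurable `<=` D by apply.
rewrite [X in X `<=` _](RGenOInfty.measurableE R); apply: smallest_sub.
  split; first by rewrite /D /= preimage_set0.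
    by move=> A; rewrite /D /= => DA; have := SC _ DA; rewrite !setTD preimage_setC.
  by move=> A DA; rewrite /D /= preimage_bigcup; apply: SU => k; exact: DA.
move=> _ [a ->]; rewrite /D /= /multiplier_set.
have M := multiplier_sg_coord i a.
have := multiplierM (multiplier_cst 2^-1) (multiplierM M (multiplierD M (multiplier_cst 1))).
congr multiplier; apply/funext => x; rewrite indicE.
have -> : (x \in (fun x : Rn R n => tnth x i) @^-1` `]a, +oo[) = (0 < tnth x i - a).
  rewrite subr_gt0; apply/idP/idP => [/set_mem /=|h]; first by rewrite in_itv/= andbT.
  by apply/mem_set; rewrite /= in_itv/= andbT.
have [t0|t0|t0] := ltgtP (tnth x i - a) 0.
- by rewrite ltr0_sg// addNr !mulr0.
- by rewrite gtr0_sg// mul1r mulVf// pnatr_eq0.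
- by rewrite t0 sgr0 mul0r mulr0.
Qed.

Lemma measurable_multiplier A : measurable A -> multiplier_set A.
Proof.
suff : measurable `<=` multiplier_set by apply.
apply: smallest_sub; first exact: multiplier_set_salgebra.
apply: (big_ind (fun S => S `<=` multiplier_set)) => [//|U V HU HV|i _].
- by rewrite subUset.
- by move=> _ [B mB <-]; rewrite setTI; exact: multiplier_coord.
Qed.

(** By [measurable_multiplier] the two integrals still agree after a multiplication
    by the indicator of [A]; take the frequency 0. *)
Theorem fourier_unique :
  (forall y c, \int[mu1]_x (cos (dotRn y x + c) * f1 x) =
               \int[mu2]_x (cos (dotRn y x + c) * f2 x)) ->
  forall A, measurable A -> \int[mu1]_(x in A) f1 x = \int[mu2]_(x in A) f2 x.
Proof.
move=> H A mA; have [_ /(_ (fun=> 1) (bm_cst 1))] := measurable_multiplier mA.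
have s1 : same_fourier (fun=> 1).
  move=> y c; transitivity (\int[mu1]_x (cos (dotRn y x + c) * f1 x)).
    by congr (Rintegral _ _ _); apply/funext => x; rewrite mul1r.
  by rewrite H; congr (Rintegral _ _ _); apply/funext => x; rewrite mul1r.
move=> /(_ s1 [tuple 0 | _ < n] 0).
have E (m : {measure set (Rn R n) -> \bar R}) f :
    \int[m]_x (\1_A x * 1 * cos (dotRn [tuple 0 | _ < n] x + 0) * f x) = \int[m]_(x in A) f x.
  rewrite [RHS]Rintegral_mkcond; congr (Rintegral _ _ _); apply/funext => x.
  rewrite /dotRn big1 => [|i _]; last by rewrite tnth_mktuple mul0r.
  rewrite addr0 cos0 !mulr1 patchE indicE; case: (x \in A); by rewrite ?mul1r ?mul0r.
by rewrite !E.
Qed.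

End fourier_uniqueness.

(** * Mixtures of Gaussians *)

Section gaussian_mixture.
Context {R : realType}.
Local Notation leb1 := (@lebesgue_measure R).
Variable h : R -> R.
Hypothesis mh : measurable_fun setT (h : measurableTypeR R -> R).
Hypothesis h0 : forall u, 0 <= h u.

(** With [h] a density in the variable [u = ln t], the case [q = s = 1] is the
    Laplace transform of [h (ln t)], and [s = - 1] mixes Gaussians of
    variance [t]. *)
Definition exp_transform (q s z : R) : R :=
  \int[leb1]_u (expR (q * u - z * expR (s * u)) * h u).

Section weight.
Variables q s : R.
Hypothesis iq : leb1.-integrable setT (EFin \o (fun u => expR (q * u) * h u)).

Lemma exp_transform_bound z u : 0 <= z ->
  `|expR (q * u - z * expR (s * u)) * h u| <= expR (q * u) * h u.
Proof.
move=> z0; rewrite ger0_norm ?mulr_ge0 ?expR_ge0// ler_wpM2r// ler_expR gerBl.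
by rewrite mulr_ge0 ?expR_ge0.
Qed.

Lemma measurable_exp_transform z :
  measurable_fun setT (fun u : measurableTypeR R => expR (q * u - z * expR (s * u)) * h u).
Proof.
apply: measurable_funM => //; apply: measurableT_comp => //; apply: measurable_funB.
  exact: mulrl_measurable.
apply: measurable_funM => //; apply: measurableT_comp => //; exact: mulrl_measurable.
Qed.

Lemma integrable_exp_transform z : 0 <= z ->
  leb1.-integrable setT (EFin \o (fun u => expR (q * u - z * expR (s * u)) * h u)).
Proof.
move=> z0; apply: (integrable_dom (measurable_exp_transform z) iq) => u.
exact: exp_transform_bound.
Qed.

Lemma exp_transform_cvg (z_ : nat -> R) (z : R) : (forall j, 0 <= z_ j) ->
  z_ j @[j --> \oo] --> z -> exp_transform q s (z_ j) @[j --> \oo] --> exp_transform q s z.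
Proof.
move=> z0 zcvg; apply: (@Rintegral_cvg _ (measurableTypeR R) R leb1 _ _ (fun u => expR (q * u) * h u)).
- by move=> j; exact: measurable_exp_transform.
- move=> u; apply: cvgM; last exact: cvg_cst.
  have H : q * u - z_ j * expR (s * u) @[j --> \oo] --> q * u - z * expR (s * u).
    by apply: cvgB; [exact: cvg_cst|apply: cvgM => //; exact: cvg_cst].
  exact: (cvg_comp _ _ H (@continuous_expR R _)).
- exact: iq.
- by move=> j u; exact: exp_transform_bound.
Qed.

End weight.

Variable d : nat.
Local Notation q := (1 - d%:R / 2).
Hypothesis i1 : leb1.-integrable setT (EFin \o (fun u => expR (1 * u) * h u)).
Hypothesis iq : leb1.-integrable setT (EFin \o (fun u => expR (q * u) * h u)).

(** The factor [t ^ (- d / 2)] of the Gaussian density of variance [t = exp u] is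
    part of the weight [t ^ q h (ln t)], so that [t h (ln t)] is the mixing density. *)
Definition mixture (x : Rn R d) : R := exp_transform q (-1) (dotRn x x / 2).

Lemma dotRn_ge0 n (x : Rn R n) : 0 <= dotRn x x.
Proof. by apply: sumr_ge0 => i _; rewrite -expr2 sqr_ge0. Qed.

Let F (p : Rn R d * R) : R := expR (q * p.2 - dotRn p.1 p.1 / 2 * expR (- 1 * p.2)) * h p.2.

Let FE x u : F (x, u) = expR (q * u) * h u * gaussRn (expR u) x.
Proof.
rewrite /F /= /gaussRn [RHS]mulrAC -expRD; congr (expR (_ - _) * _).
by rewrite mulN1r expRN invfM mulrA.
Qed.

Let F0 p : 0 <= F p.
Proof. by rewrite mulr_ge0 ?expR_ge0. Qed.

Let mF : measurable_fun setT (F : Rn R d * measurableTypeR R -> R).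
Proof.
have m2 : measurable_fun setT (fun p : Rn R d * measurableTypeR R => p.2) by exact: measurable_snd.
apply: measurable_funM; last exact: (measurableT_comp mh m2).
apply: measurableT_comp => //; apply: measurable_funB; first exact: measurable_funM.
apply: measurable_funM; last by apply: measurableT_comp => //; exact: measurable_funM.
apply: measurable_funM => //; exact: (measurableT_comp (measurable_dotRn2 (n := d)) measurable_fst).
Qed.

Let sqrt_expR (u : R) : Num.sqrt (2 * pi * expR u) ^+ d = Num.sqrt (2 * pi) ^+ d * expR (d%:R / 2 * u).
Proof.
rewrite sqrtrM ?mulr_ge0 ?pi_ge0// exprMn; congr (_ * _).
have -> : expR u = expR (u / 2) ^+ 2 by rewrite -expRM_natl; congr expR; field.
by rewrite sqrtr_sqr ger0_norm ?expR_ge0// -expRM_natl; congr expR; ring.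
Qed.

Let F_fourier (y : Rn R d) c u :
  \int[lebesgue_Rn R d]_x (F (x, u) * cos (dotRn y x + c)) =
  Num.sqrt (2 * pi) ^+ d * cos c * (expR (1 * u - dotRn y y / 2 * expR (1 * u)) * h u).
Proof.
have [ig fg] := gaussRn_fourier d (expR_gt0 u).
have igc : (lebesgue_Rn R d).-integrable setT
    (EFin \o (fun x => gaussRn (expR u) x * cos (dotRn y x + c))).
  apply: integrable_dom ig _.
    by apply: measurable_funM; [exact: measurable_gaussRn|exact: measurable_cos_dotRn].
  move=> x; rewrite normrM ger0_norm ?expR_ge0// ler_piMr ?expR_ge0// ler_norml.
  by rewrite cos_geN1 cos_le1.
transitivity (\int[lebesgue_Rn R d]_x (expR (q * u) * h u * (gaussRn (expR u) x * cos (dotRn y x + c)))).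
  by congr (Rintegral _ _ _); apply/funext => x; rewrite FE mulrA.
rewrite RintegralZl// fg sqrt_expR.
rewrite (_ : 1 * u - dotRn y y / 2 * expR (1 * u) = q * u + (d%:R / 2 * u + - (expR u * dotRn y y / 2))).
  by rewrite !expRD; ring.
by rewrite mul1r; field.
Qed.

Let F_mass u : \int[lebesgue_Rn R d]_x F (x, u) = Num.sqrt (2 * pi) ^+ d * (expR (1 * u) * h u).
Proof.
have := F_fourier [tuple 0 | _ < d] 0 u.
have D0 (x : Rn R d) : dotRn [tuple 0 | _ < d] x = 0.
  by rewrite /dotRn big1// => i _; rewrite tnth_mktuple mul0r.
rewrite D0 mul0r mul0r subr0 cos0 mulr1 => <-; congr (Rintegral _ _ _); apply/funext => x.
by rewrite D0 addr0 cos0 mulr1.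
Qed.

Let F_section1 u : (lebesgue_Rn R d).-integrable setT (fun x => (F (x, u))%:E).
Proof.
have [ig _] := gaussRn_fourier d (expR_gt0 u).
have := integrable_mull (expR (q * u) * h u) ig.
by apply: eq_integrable => // x _ /=; rewrite FE.
Qed.

Let F_section2 x : leb1.-integrable setT (fun u => (F (x, u))%:E).
Proof.
have z0 : 0 <= dotRn x x / 2 by rewrite divr_ge0 ?dotRn_ge0.
exact: (integrable_exp_transform (-1) iq z0).
Qed.

(** Tonelli's theorem: the Gaussian in [x] has mass [(2 pi t) ^ (d / 2)], which
    turns the weight [t ^ (1 - d / 2)] into [t]. *)
Let F_integrable : (lebesgue_Rn R d \x leb1)%E.-integrable setT (EFin \o F).
Proof.
apply/integrable21ltyP; first exact/measurable_EFinP.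
rewrite (eq_integral (fun u : measurableTypeR R => (Num.sqrt (2 * pi) ^+ d * (expR (1 * u) * h u))%:E)).
  apply: integrable_lty => //; exact: (integrable_mull (Num.sqrt (2 * pi) ^+ d) i1).
move=> u _; rewrite -F_mass /Rintegral fineK; last exact: integrable_fin_num (F_section1 u).
by apply: eq_integral => x _ /=; rewrite ger0_norm.
Qed.

Lemma integrable_mixture : (lebesgue_Rn R d).-integrable setT (EFin \o mixture).
Proof.
have := integrable_fubini_F F_integrable; apply: eq_integrable => // x _ /=.
by rewrite fineK//; exact: integrable_fin_num (F_section2 x).
Qed.

(** Fubini's theorem: a mixture of Gaussians has the same mixture of Gaussians as
    its Fourier transform, which is a Laplace transform at [|y| ^ 2 / 2]. *)
Lemma mixture_fourier (y : Rn R d) c :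
  \int[lebesgue_Rn R d]_x (cos (dotRn y x + c) * mixture x) =
  Num.sqrt (2 * pi) ^+ d * cos c * exp_transform 1 1 (dotRn y y / 2).
Proof.
pose G (p : Rn R d * R) := F p * cos (dotRn y p.1 + c).
have mG : measurable_fun setT (G : Rn R d * measurableTypeR R -> R).
  apply: measurable_funM => //.
  exact: (measurableT_comp (measurable_cos_dotRn y c) measurable_fst).
have GF p : `|G p| <= F p.
  by rewrite /G normrM ger0_norm// ler_piMr// ler_norml cos_geN1 cos_le1.
have iG : (lebesgue_Rn R d \x leb1)%E.-integrable setT (EFin \o G).
  exact: integrable_dom mG F_integrable GF.
have G2 x : leb1.-integrable setT (fun u => (G (x, u))%:E).
  apply: (@integrable_dom _ (measurableTypeR R) R leb1 _ (fun u => F (x, u))) => //; last exact: F_section2.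
  exact: measurable_fun_pair2 mG.
have G1 u : (lebesgue_Rn R d).-integrable setT (fun x => (G (x, u))%:E).
  apply: (@integrable_dom _ _ R (lebesgue_Rn R d) _ (fun x => F (x, u))) => //; last exact: F_section1.
  exact: measurable_fun_pair1 mG.
have := Rintegral_Fubini iG G2 G1 => Fub.
transitivity (\int[lebesgue_Rn R d]_x \int[leb1]_u G (x, u)).
  congr (Rintegral _ _ _); apply/funext => x; rewrite /mixture /exp_transform.
  rewrite -RintegralZl//; last exact: F_section2.
  by congr (Rintegral _ _ _); apply/funext => u; rewrite mulrC.
rewrite Fub /exp_transform -RintegralZl//; last first.
  have z0 : 0 <= dotRn y y / 2 by rewrite divr_ge0 ?dotRn_ge0.
  exact: (integrable_exp_transform 1 i1 z0).
by congr (Rintegral _ _ _); apply/funext => u; rewrite -F_fourier.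
Qed.

End gaussian_mixture.

(** * A non-negative Fox function as a mixing density *)

Lemma cintegral_real {R : realType} d (T : measurableType d) (m : {measure set T -> \bar R})
  (r : T -> R) : cintegral m setT (fun x => (r x)%:C) = (\int[m]_x r x)%:C.
Proof.
rewrite /cintegral /=; congr (_ +i* _).
by rewrite /Rintegral integral0_eq.
Qed.

Section fox_density.
Context {R : realType}.
Local Notation leb1 := (@lebesgue_measure R).
Variables up lo : seq (R * R).
Hypothesis lo2 : forall l, l \in lo -> 0 < l.2.
Hypothesis up2 : forall l, l \in up -> 0 < l.2.
Hypothesis decay : 0 < fox_astar up lo \/ fox_astar up lo = 0 /\ fox_mu up lo < -1.

Lemma right_of_poles_open c : right_of_poles lo c ->
  exists2 e, 0 < e & right_of_poles lo (c - e).
Proof.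
move=> Pc; suff H (s : seq (R * R)) : (forall l, l \in s -> 0 < l.2 /\ 0 < l.1 + l.2 * c) ->
    exists2 e, 0 < e & forall l, l \in s -> 0 < l.1 + l.2 * (c - e).
  by apply: H => l llo; split; [exact: lo2|exact: Pc].
elim: s => [|l s IH] H; first by exists 1.
have [l2 l1] := H l (mem_head _ _).
have [e e0 He] := IH (fun l' h => H l' (mem_behead (s := l :: s) h)).
exists (Num.min e ((l.1 + l.2 * c) / l.2 / 2)).
  by rewrite lt_min e0 !divr_gt0.
move=> l'; rewrite inE => /orP[/eqP ->|ls].
  have : Num.min e ((l.1 + l.2 * c) / l.2 / 2) <= (l.1 + l.2 * c) / l.2 / 2 by rewrite ge_min lexx orbT.
  move: (Num.min _ _) => m; rewrite -(ler_pM2l l2).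
  have -> : l.2 * ((l.1 + l.2 * c) / l.2 / 2) = (l.1 + l.2 * c) / 2 by field; rewrite gt_eqF.
  by move=> *; lra.
have [l2' _] := H l' (mem_behead (s := l :: s) ls).
rewrite (lt_le_trans (He l' ls))// lerD2l ler_wpM2l ?(ltW l2')// lerD2l lerN2.
by rewrite ge_min lexx.
Qed.

Variable g : R.
Hypothesis Pg : right_of_poles lo g.
Hypothesis foxH_ge0 : forall tau : R, 0 < tau -> 0 <= foxH g up lo tau.

(** The Fox function at [exp u], as a real number. *)
Definition fox_density u := Re (fox_log up lo g u).

Lemma fox_densityE c u : right_of_poles lo c -> fox_log up lo c u = (fox_density u)%:C.
Proof.
move=> Pc; rewrite (fox_log_shift lo2 up2 decay u Pc Pg) /fox_density.
have := foxH_ge0 (expR_gt0 u); rewrite foxH_log lecE => /andP[/eqP H _].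
by apply: complex_ext => //; rewrite H.
Qed.

Lemma fox_density_ge0 u : 0 <= fox_density u.
Proof. by have := foxH_ge0 (expR_gt0 u); rewrite foxH_log lecE => /andP[]. Qed.

Lemma measurable_fox_density : measurable_fun setT (fox_density : measurableTypeR R -> R).
Proof. exact: measurable_fox_log. Qed.

(** To the right of the poles the density has all exponential moments: the two
    bounds come from contours on either side of [Re s = q]. *)
Lemma integrable_fox_density q : right_of_poles lo q ->
  leb1.-integrable setT (EFin \o (fun u => expR (q * u) * fox_density u)).
Proof.
move=> Pq; have [e e0 Pe] := right_of_poles_open Pq.
have Pe' : right_of_poles lo (q + e) by apply: (right_of_polesW lo2 Pq); rewrite lerDl ltW.
have [B1 H1] := fox_log_bound lo2 up2 decay Pe.
have [B2 H2] := fox_log_bound lo2 up2 decay Pe'.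
apply: (@integrable_dom _ (measurableTypeR R) R leb1 _ (fun u => (`|B1| + `|B2|) * expR (- (e * `|u|)))).
- apply: measurable_funM; last exact: measurable_fox_density.
  by apply: measurableT_comp => //; exact: mulrl_measurable.
- exact: integrable_mull (integrable_expRNabs e0).
move=> u; rewrite ger0_norm ?mulr_ge0 ?expR_ge0 ?fox_density_ge0//.
have [u0|u0] := leP 0 u.
  have := H2 u; rewrite (fox_densityE u Pe') /= ger0_norm ?fox_density_ge0// => h.
  rewrite (le_trans (ler_wpM2l (expR_ge0 _) h))// mulrCA -expRD.
  rewrite (_ : q * u + - (q + e) * u = - (e * u)); last by ring.
  rewrite (ger0_norm u0).
  by rewrite ler_wpM2r ?expR_ge0// (le_trans (ler_norm _))// lerDr.
have := H1 u; rewrite (fox_densityE u Pe) /= ger0_norm ?fox_density_ge0// => h.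
rewrite (le_trans (ler_wpM2l (expR_ge0 _) h))// mulrCA -expRD.
rewrite (_ : q * u + - (q - e) * u = - (e * - u)); last by ring.
rewrite (ltr0_norm u0).
by rewrite ler_wpM2r ?expR_ge0// (le_trans (ler_norm _))// lerDl.
Qed.

Lemma fox_density_laplace c z : 0 < c -> 0 < z -> right_of_poles lo (1 - c) ->
  inverse_mellin c (fun s => Gamma s * fox_kernel up lo (1 - s)) z =
  (exp_transform fox_density 1 1 z)%:C.
Proof.
move=> c0 z0 Pc; rewrite -(fox_laplace lo2 up2 decay c0 z0 Pc) -cintegral_real.
by apply: eq_cintegral => u; rewrite (fox_densityE u Pc) !mul1r -rmorphM.
Qed.

Lemma fox_density_laplace_inv q c z : 0 < c -> 0 < z -> right_of_poles lo (q + c) ->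
  inverse_mellin c (fun s => Gamma s * fox_kernel up lo (q%:C + s)) z =
  (exp_transform fox_density q (-1) z)%:C.
Proof.
move=> c0 z0 Pc; rewrite -(fox_laplace_inv lo2 up2 decay c0 z0 Pc) -cintegral_real.
by apply: eq_cintegral => u; rewrite (fox_densityE u Pc) !mulN1r -rmorphM.
Qed.

End fox_density.

(** * The parameters of the Wright function *)

Lemma eq_inverse_mellin {R : realType} c z (F G : R[i] -> R[i]) : (forall s, F s = G s) ->
  inverse_mellin c F z = inverse_mellin c G z.
Proof. by move=> /funext ->. Qed.

Section wright_parameters.
Context {R : realType}.
Variables (p m : nat) (a alpha : 'I_p -> R) (b beta : 'I_m -> R).
Local Notation up := (params a alpha).
Local Notation lo := (params b beta).

Lemma paramsP n (c e : 'I_n -> R) l : l \in params c e -> exists j, l = (c j, e j).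
Proof. by move=> /mapP[j _ ->]; exists j. Qed.

Lemma big_params (T : Type) (op : T -> T -> T) (idx : T) n (c e : 'I_n -> R) (F : R * R -> T) :
  \big[op/idx]_(l <- params c e) F l = \big[op/idx]_(i < n) F (c i, e i).
Proof. by rewrite /params big_map enumT. Qed.

Lemma params_astar : fox_astar up lo = astar alpha beta.
Proof. by rewrite /fox_astar /astar !big_params. Qed.

Lemma params_mu : fox_mu up lo = mu_param a b.
Proof.
rewrite /fox_mu /mu_param !big_params /= !big_split /= !sumr_const !card_ord.
by rewrite !mulNrn -(mulr_natl _ m) -(mulr_natl _ p); field.
Qed.

Lemma fox_kernel_params s : fox_kernel up lo s =
  (\prod_j Gamma ((b j)%:C + (beta j)%:C * s)) / (\prod_i Gamma ((a i)%:C + (alpha i)%:C * s)).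
Proof. by rewrite /fox_kernel !big_params. Qed.

Lemma wright_negE c z : z != 0 -> wright_neg a alpha b beta c z =
  inverse_mellin c (fun s => Gamma s * fox_kernel up lo (1 - s)) z.
Proof.
move=> /negbTE z0; rewrite /wright_neg z0; apply: eq_inverse_mellin => s.
have e n (c' e' : 'I_n -> R) : \prod_j Gamma ((c' j + e' j)%:C - (e' j)%:C * s) =
    \prod_j Gamma ((c' j)%:C + (e' j)%:C * (1 - s)).
  by apply: eq_bigr => i _; rewrite mulrBr mulr1 rmorphD addrA.
by rewrite fox_kernel_params mulrA (e m) (e p).
Qed.

Lemma foxGE d c z : foxG a alpha b beta d c z =
  inverse_mellin c (fun s => Gamma s * fox_kernel up lo ((1 - d%:R / 2)%:C + s)) z.
Proof.
rewrite /foxG /foxH; apply: eq_inverse_mellin => s.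
have e n (c' e' : 'I_n -> R) :
    \prod_(l <- params (fun j => c' j + e' j * (1 - d%:R / 2)) e') Gamma (l.1%:C + l.2%:C * s) =
    \prod_j Gamma ((c' j)%:C + (e' j)%:C * ((1 - d%:R / 2)%:C + s)).
  by rewrite big_params; apply: eq_bigr => i _; rewrite [in RHS]mulrDr rmorphD rmorphM addrA.
rewrite fox_kernel_params big_cons /= (e m) (e p).
by rewrite rmorph0 add0r rmorph1 mul1r mulrA.
Qed.

End wright_parameters.

(** * Identification of the Wright measure *)

Section wright_fourier.
Context {R : realType} (d : nat).
Variable mu : probability (Rn R d) R.
Implicit Types (y : Rn R d).

Lemma cexp_i (t : R) : cexp ('i * t%:C) = cos t +i* sin t.
Proof.
apply: complex_ext; rewrite ?Re_cexp ?Im_cexp !ReImE /= !mul0r !mul1r sub0r oppr0 expR0 mul1r ?addr0 ?add0r//.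
Qed.

Lemma charfunE y : cintegral mu setT (fun x => cexp ('i * (dotRn y x)%:C)) =
  (\int[mu]_x cos (dotRn y x)) +i* (\int[mu]_x sin (dotRn y x)).
Proof.
by rewrite /cintegral; congr (_ +i* _); congr (Rintegral _ _ _); apply/funext => x; rewrite cexp_i.
Qed.

Lemma integrable_bounded (f : Rn R d -> R) : measurable_fun setT f -> (forall x, `|f x| <= 1) ->
  mu.-integrable setT (EFin \o f).
Proof.
move=> mf f1; apply: (integrable_dom (g := fun=> 1)) => //.
exact: finite_measure_integrable_cst.
Qed.

Lemma integrable_cos_prob y c : mu.-integrable setT (EFin \o (fun x => cos (dotRn y x + c))).
Proof.
apply: integrable_bounded; first exact: measurable_cos_dotRn.
by move=> x; rewrite ler_norml cos_geN1 cos_le1.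
Qed.

Lemma Rintegral_cosD y c : \int[mu]_x cos (dotRn y x + c) =
  cos c * (\int[mu]_x cos (dotRn y x)) - sin c * (\int[mu]_x sin (dotRn y x)).
Proof.
have ic : mu.-integrable setT (EFin \o (fun x => cos (dotRn y x))).
  by have := integrable_cos_prob y 0; apply: eq_integrable => // x _ /=; rewrite addr0.
have isn : mu.-integrable setT (EFin \o (fun x => sin (dotRn y x))).
  by have := integrable_cos_prob y (- (pi / 2)); apply: eq_integrable => // x _ /=; rewrite cosBpihalf.
rewrite -!RintegralZl// -RintegralB//; [|exact: integrable_mull|exact: integrable_mull].
by congr (Rintegral _ _ _); apply/funext => x; rewrite cosD; ring.
Qed.

Let yn (j : nat) : Rn R d := [tuple j.+1%:R^-1 | _ < d].

Lemma dotRn_diag j : dotRn (yn j) (yn j) = d%:R * (j.+1%:R^-1 * j.+1%:R^-1).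
Proof.
rewrite /dotRn (eq_bigr (fun=> j.+1%:R^-1 * j.+1%:R^-1)); last by move=> i _; rewrite tnth_mktuple.
by rewrite sumr_const card_ord mulr_natl.
Qed.

Lemma dotRn_diag_cvg x : dotRn (yn j) x @[j --> \oo] --> (0 : R).
Proof.
have e j : dotRn (yn j) x = j.+1%:R^-1 * \sum_i tnth x i.
  by rewrite /dotRn mulr_sumr; apply: eq_bigr => i _; rewrite tnth_mktuple.
under eq_fun do rewrite e.
have h : j.+1%:R^-1 * (\sum_i tnth x i) @[j --> \oo] --> 0 * \sum_i tnth x i.
  by apply: cvgM; [exact: cvg_harmonic|exact: cvg_cst].
by rewrite mul0r in h.
Qed.

(** Continuity of the characteristic function at the origin, along the diagonal. *)
Lemma charfun_diag_cvg :
  \int[mu]_x cos (dotRn (yn j) x) @[j --> \oo] --> (1 : R) /\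
  \int[mu]_x sin (dotRn (yn j) x) @[j --> \oo] --> (0 : R).
Proof.
have i1 : mu.-integrable setT (EFin \o (fun=> 1)) by exact: finite_measure_integrable_cst.
have msin : measurable_fun setT (sin : measurableTypeR R -> R).
  by apply: continuous_measurable_fun => z; exact: continuous_sin.
split.
  have -> : (1 : R) = \int[mu]_x (cst 1 x).
    rewrite Rintegral_cst//.
    have -> : fine (mu setT) = 1 by exact: (congr1 fine (probability_setT mu)).
    by rewrite mulr1.
  apply: (Rintegral_cvg (g := fun=> 1)) => //.
  - by move=> j; exact: measurableT_comp measurable_cosR (measurable_dotRnl (yn j)).
  - move=> x; rewrite /cst -cos0; exact: (cvg_comp _ _ (dotRn_diag_cvg x) (@continuous_cos R 0)).
  - by move=> j x; rewrite ler_norml cos_geN1 cos_le1.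
have -> : (0 : R) = \int[mu]_x (cst 0 x) by rewrite Rintegral_cst// mul0r.
apply: (Rintegral_cvg (g := fun=> 1)) => //.
- by move=> j; exact: measurableT_comp msin (measurable_dotRnl (yn j)).
- move=> x; rewrite /cst -sin0; exact: (cvg_comp _ _ (dotRn_diag_cvg x) (@continuous_sin R 0)).
- by move=> j x; rewrite ler_norml sin_geN1 sin_le1.
Qed.

Variables (h : R -> R) (K : R[i]) (Psi : R -> R[i]).
Hypothesis mh : measurable_fun setT (h : measurableTypeR R -> R).
Hypothesis h0 : forall u, 0 <= h u.
Hypothesis d0 : (0 < d)%N.
Hypothesis i1 : (@lebesgue_measure R).-integrable setT (EFin \o (fun u => expR (1 * u) * h u)).
Hypothesis iq : (@lebesgue_measure R).-integrable setT
  (EFin \o (fun u => expR ((1 - d%:R / 2) * u) * h u)).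
Hypothesis Psi0 : Psi 0 = K.
Hypothesis PsiE : forall z, 0 < z -> Psi z = (exp_transform h 1 1 z)%:C.
Hypothesis mu_charfun : forall y, cintegral mu setT (fun x => cexp ('i * (dotRn y x)%:C)) =
  K^-1 * Psi (dotRn y y / 2).

(** The value 1 of the characteristic function at the origin is its limit along the
    diagonal, hence [K^-1] times the total mass. In particular [K] is real and
    nonzero. *)
Lemma total_mass : K = (exp_transform h 1 1 0)%:C /\ exp_transform h 1 1 0 != 0.
Proof.
pose z j := dotRn (yn j) (yn j) / 2.
have z0 j : 0 < z j.
  by rewrite /z dotRn_diag divr_gt0// !mulr_gt0 ?ltr0n ?invr_gt0.
have zcvg : z j @[j --> \oo] --> (0 : R).
  rewrite /z; under eq_fun do rewrite dotRn_diag.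
  have H : d%:R * (j.+1%:R^-1 * j.+1%:R^-1) / 2 @[j --> \oo] --> d%:R * (0 * 0) / (2 : R).
    apply: cvgM; last exact: cvg_cst.
    apply: cvgM; first exact: cvg_cst.
    by apply: cvgM; exact: cvg_harmonic.
  by rewrite !mulr0 mul0r in H.
have Lcvg := exp_transform_cvg mh h0 (s := 1) i1 (fun j => ltW (z0 j)) zcvg.
have E j : (\int[mu]_x cos (dotRn (yn j) x) = Re K^-1 * exp_transform h 1 1 (z j)) /\
    (\int[mu]_x sin (dotRn (yn j) x) = Im K^-1 * exp_transform h 1 1 (z j)).
  have := mu_charfun (yn j); rewrite charfunE (PsiE (z0 j)) => H.
  move: (congr1 (@complex.Re R) H) (congr1 (@complex.Im R) H); rewrite !ReImE /= mulr0 subr0 mulr0 add0r.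
  by move=> -> ->.
have [C S] := charfun_diag_cvg.
have C' : \int[mu]_x cos (dotRn (yn j) x) @[j --> \oo] --> Re K^-1 * exp_transform h 1 1 0.
  by under eq_fun do rewrite (E _).1; apply: cvgM => //; exact: cvg_cst.
have S' : \int[mu]_x sin (dotRn (yn j) x) @[j --> \oo] --> Im K^-1 * exp_transform h 1 1 0.
  by under eq_fun do rewrite (E _).2; apply: cvgM => //; exact: cvg_cst.
have CE : 1 = Re K^-1 * exp_transform h 1 1 0 by exact: (cvg_unique _ C C').
have SE : 0 = Im K^-1 * exp_transform h 1 1 0 by exact: (cvg_unique _ S S').
have L0 : exp_transform h 1 1 0 != 0.
  by apply/eqP => H; move/eqP: CE; rewrite H mulr0 oner_eq0.
split=> //; apply: invr_inj; rewrite -fmorphV; apply: complex_ext => /=.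
  by apply: (mulIf L0); rewrite -CE mulVf.
by apply/eqP; move/eqP: SE; rewrite eq_sym mulf_eq0 (negbTE L0) orbF.
Qed.

Lemma charfun_mixture y :
  \int[mu]_x cos (dotRn y x) = (exp_transform h 1 1 0)^-1 * exp_transform h 1 1 (dotRn y y / 2) /\
  \int[mu]_x sin (dotRn y x) = 0.
Proof.
have [KE L0] := total_mass.
suff H : cintegral mu setT (fun x => cexp ('i * (dotRn y x)%:C)) =
    ((exp_transform h 1 1 0)^-1 * exp_transform h 1 1 (dotRn y y / 2))%:C.
  by move: H; rewrite charfunE => -[-> ->].
rewrite mu_charfun.
have -> : ((exp_transform h 1 1 0)^-1 * exp_transform h 1 1 (dotRn y y / 2))%:C =
    K^-1 * (exp_transform h 1 1 (dotRn y y / 2))%:C by rewrite KE -fmorphV -rmorphM.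
have : 0 <= dotRn y y / 2 by rewrite divr_ge0 ?dotRn_ge0.
by rewrite le_eqVlt => /predU1P[<-|/PsiE -> //]; rewrite Psi0 KE.
Qed.

(** [charfun_mixture] and [mixture_fourier] compute the same Fourier transform, so
    that [fourier_unique] applies. *)
Lemma mixture_density A : measurable A ->
  mu A = (\int[lebesgue_Rn R d]_(x in A)
    ((Num.sqrt (2 * pi) ^+ d * exp_transform h 1 1 0)^-1 * mixture h x)%:E)%E.
Proof.
move=> mA; have [_ L0] := total_mass.
set C := (_ * _)^-1.
have im : (lebesgue_Rn R d).-integrable setT (EFin \o (fun x => C * mixture h x)).
  exact: integrable_mull (integrable_mixture mh h0 i1 iq).
have ic : mu.-integrable setT (EFin \o (fun=> 1)) by exact: finite_measure_integrable_cst.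
have S0 : Num.sqrt (2 * pi : R) ^+ d != 0.
  by rewrite expf_neq0// gt_eqF// sqrtr_gt0 mulr_gt0// pi_gt0.
have := fourier_unique ic im _ mA.
have H y c : \int[mu]_x (cos (dotRn y x + c) * 1) =
    \int[lebesgue_Rn R d]_x (cos (dotRn y x + c) * (C * mixture h x)).
  rewrite (_ : (fun x => _) = fun x => cos (dotRn y x + c)); last first.
    by apply/funext => x; rewrite mulr1.
  rewrite Rintegral_cosD; have [-> ->] := charfun_mixture y.
  rewrite mulr0 subr0.
  rewrite (_ : (fun x => cos (dotRn y x + c) * (C * mixture h x)) =
    fun x => C * (cos (dotRn y x + c) * mixture h x)); last first.
    by apply/funext => x; rewrite mulrCA.
  rewrite RintegralZl//; last first.
    apply: (bm_integrable (integrable_mixture mh h0 i1 iq)); exact: bm_cos.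
  rewrite (mixture_fourier mh h0 i1 iq) /C.
  move: (exp_transform h 1 1 0) (exp_transform h 1 1 (dotRn y y / 2)) L0 => L Ly L0.
  by move: (Num.sqrt (2 * pi) ^+ d) S0 => S S0; field; rewrite S0 L0.
move=> /(_ H); rewrite /Rintegral => E.
have : (\int[mu]_(x in A) 1%:E)%E = mu A by rewrite integral_cst// mul1e.
move=> <-.
rewrite -[LHS]fineK ?E ?fineK//.
  by apply: integrable_fin_num => //; exact: integrableS im.
by rewrite integral_cst// mul1e fin_num_measure.
Qed.

End wright_fourier.

Theorem theorem2p14 (R : realType) (m p d : nat)
  (a alpha : 'I_p -> R) (b beta : 'I_m -> R)
  (gH gPsi gG : R) (mu : probability (Rn R d) R)
  (d_gt0 : (0 < d)%N)
  (alpha_gt0 : forall i, 0 < alpha i)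
  (a_alpha_gt0 : forall i, 0 < a i + alpha i)
  (beta_gt0 : forall j, 0 < beta j)
  (b_beta_gt0 : forall j, 0 < b j + beta j)
  (astar_mu : 0 < astar alpha beta \/
              astar alpha beta = 0 /\ mu_param a b < -1)
  (gH01 : 0 < gH < 1) (gH_left : poles_left gH (params b beta))
  (foxH_ge0 : forall tau : R, 0 < tau ->
    0 <= foxH gH (params a alpha) (params b beta) tau)
  (gPsi01 : 0 < gPsi < 1)
  (gPsi_lt : forall j, gPsi < (b j + beta j) / beta j)
  (mu_wright : is_wright_measure a alpha b beta gPsi mu)
  (d_lt : forall j, beta j * d%:R < 2 * (b j + beta j))
  (gG01 : 0 < gG < 1) :
  mu `<< lebesgue_Rn R d /\
  exists2 rho : Rn R d -> R,
    is_density (lebesgue_Rn R d) mu rho &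
    forall x : Rn R d, exists2 Gx : R[i],
      is_value0 (foxG a alpha b beta d gG) (dotRn x x / 2) Gx &
      (rho x)%:C =
        (((2 * pi) `^ (d%:R / 2))%:C * wright_const a alpha b beta)^-1 * Gx.
Proof.
have lo2 l : l \in params b beta -> 0 < l.2 by move=> /paramsP[j ->] /=; exact: beta_gt0.
have up2 l : l \in params a alpha -> 0 < l.2 by move=> /paramsP[j ->] /=; exact: alpha_gt0.
have decay : 0 < fox_astar (params a alpha) (params b beta) \/
    fox_astar (params a alpha) (params b beta) = 0 /\ fox_mu (params a alpha) (params b beta) < -1.
  by rewrite params_astar params_mu.
have right c : (forall j, 0 < b j + beta j * c) -> right_of_poles (params b beta) c.
  by move=> H _ /paramsP[j ->]; exact: H.
have PH : right_of_poles (params b beta) gH.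
  (* The rightmost pole is the one with [k = 0]. *)
  move=> l llo; have := gH_left l 0%N llo.
  by rewrite addr0 ltr_pdivrMr ?lo2// => H; rewrite mulrC; lra.
have P1 : right_of_poles (params b beta) 1 by apply: right => j; rewrite mulr1.
have PPsi : right_of_poles (params b beta) (1 - gPsi).
  apply: right => j; have := gPsi_lt j; rewrite ltr_pdivlMr// -subr_gt0.
  by rewrite mulrBr mulr1 addrA [beta j * _]mulrC.
have Pq : right_of_poles (params b beta) (1 - d%:R / 2).
  by apply: right => j; have := d_lt j => H; rewrite mulrBr mulr1 mulrA; lra.
case/andP: gG01 => gG0 _; case/andP: gPsi01 => gPsi0 _.
have PG : right_of_poles (params b beta) (1 - d%:R / 2 + gG).
  by apply: (right_of_polesW lo2 Pq); rewrite lerDl ltW.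
pose h := fox_density (params a alpha) (params b beta) gH.
have mh : measurable_fun setT (h : measurableTypeR R -> R) by exact: measurable_fox_density.
have h0 u : 0 <= h u by exact: fox_density_ge0.
have i1 := integrable_fox_density lo2 up2 decay PH foxH_ge0 P1.
have iq := integrable_fox_density lo2 up2 decay PH foxH_ge0 Pq.
have PsiE z : 0 < z -> wright_neg a alpha b beta gPsi z = (exp_transform h 1 1 z)%:C.
  move=> z0; rewrite wright_negE ?gt_eqF//.
  exact: (fox_density_laplace lo2 up2 decay PH foxH_ge0 gPsi0 z0 PPsi).
have Psi0 : wright_neg a alpha b beta gPsi 0 = wright_const a alpha b beta.
  by rewrite /wright_neg eqxx.
have GE z : 0 < z -> foxG a alpha b beta d gG z = (exp_transform h (1 - d%:R / 2) (-1) z)%:C.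
  move=> z0; rewrite foxGE.
  exact: (fox_density_laplace_inv lo2 up2 decay PH foxH_ge0 gG0 z0 PG).
have [KE L0] := total_mass mh h0 d_gt0 i1 PsiE mu_wright.
have muE := mixture_density mh h0 d_gt0 i1 iq Psi0 PsiE mu_wright.
set C := (_ * _)^-1 in muE.
have irho : (lebesgue_Rn R d).-integrable setT (EFin \o (fun x => C * mixture h x)).
  exact: integrable_mull (integrable_mixture mh h0 i1 iq).
split.
  apply/null_content_dominatesP => A mA A0; rewrite muE// null_set_integral//.
  apply: measurable_funTS; apply/measurable_EFinP; exact: integrable_measurable irho.
exists (fun x => C * mixture h x).
  by split; [exact: irho|exact: muE].
move=> x; exists (mixture h x)%:C; last first.
  rewrite KE -!rmorphM -fmorphV -rmorphM /C; congr (_ * _)%:C; congr (_ * _)^-1.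
  rewrite -powR12_sqrt; last by rewrite mulr_ge0// pi_ge0.
  by rewrite -powR_mulrn ?powR_ge0// -powRrM (mulrC d%:R).
rewrite /is_value0; have [z0|z0] := eqVneq (dotRn x x / 2) 0; last first.
  have zp : 0 < dotRn x x / 2 by rewrite lt_neqAle eq_sym z0 divr_ge0 ?dotRn_ge0.
  exact: (esym (GE _ zp)).
have lim : exp_transform h (1 - d%:R / 2) (-1) z @[z --> 0^'+] --> mixture h x.
  rewrite /mixture z0; apply/cvg_at_rightP => v [v0 vcvg].
  exact: (exp_transform_cvg mh h0 iq (fun j => ltW (v0 j)) vcvg).
have near0 : \forall z \near 0^'+,
    foxG a alpha b beta d gG z = (exp_transform h (1 - d%:R / 2) (-1) z)%:C.
  by near=> z; apply: GE; near: z; exact: nbhs_right_gt.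
split.
  apply: cvg_trans lim; apply: near_eq_cvg; apply: filterS near0 => z Gz.
  exact: (esym (congr1 (@complex.Re R) Gz)).
apply: (@cvg_trans _ ((fun=> 0 : R) @ 0^'+)); last exact: cvg_cst.
apply: near_eq_cvg; apply: filterS near0 => z Gz.
exact: (esym (congr1 (@complex.Im R) Gz)).
Unshelve. all: by end_near. Qed.
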